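(* Let $\mathcal{G}(\mathcal{V},\mathcal{E},\bm{A},\bm{\tau})$ be a delay-embedded graph. Assume there is an edge $(k,l)\in\mathcal{E}$ with $\tau_{kl}\overline{\lambda}>\frac{\pi}{2}$, and let $\widehat{\bm{L}}_\tau^{(k,l)}$ denote the delay-embedded signed Laplacian after deleting the edge $(k,l)$. Suppose $\widehat{\bm{L}}_\tau^{(k,l)}$ is positive semi-definite with a simple zero eigenvalue. Then the system $$\dot{x}_i(t)=\sum_{j=1}^n a_{ij}\bigl(x_j(t-\tau_{ij})-x_i(t-\tau_{ij})\bigr),\qquad i=1,\dots,n,$$ reaches an average consensus if $r^{\mathrm{eff}}(\widehat{\bm{L}}_\tau,\{k\},\{l\})>0$, or equivalently, if the following inequality holds: $$-a_{kl}\cos(\tau_{kl}\overline{\lambda})<\frac{1}{r^{\mathrm{eff}}(\widehat{\bm{L}}_\tau^{(k,l)},\{k\},\{l\})}\quad\text{if }\frac{\pi}{2}<\tau_{kl}\overline{\lambda}<\pi,$$ $$a_{kl}<\frac{1}{r^{\mathrm{eff}}(\widehat{\bm{L}}_\tau^{(k,l)},\{k\},\{l\})}\quad\text{if }\tau_{kl}\overline{\lambda}\ge\pi.$$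
   Context: Delay-embedded graph: $\mathcal{G}(\mathcal{V},\mathcal{E},\bm{A},\bm{\tau})$ is a connected weighted undirected graph with node set $\mathcal{V}=\{1,\dots,n\}$ and edge set $\mathcal{E}$ (unordered pairs $(i,j)$, $i\ne j$). $\bm{A}=[a_{ij}]\in\mathbb{R}^{n\times n}$ is the weighted adjacency matrix: $a_{ii}=0$; $a_{ij}=a_{ji}$ is the weight (positive or negative) of the edge $(i,j)\in\mathcal{E}$; $a_{ij}=0$ if $(i,j)\notin\mathcal{E}$. $\bm{\tau}=[\tau_{ij}]\in\mathbb{R}^{n\times n}$ is the delay matrix: $\tau_{ii}=0$; $\tau_{ij}=\tau_{ji}\ge 0$ is the delay of the edge $(i,j)\in\mathcal{E}$ (arbitrarily large values allowed); $\tau_{ij}=0$ if $(i,j)\notin\mathcal{E}$. Laplacian of edge values $w_{ij}=w_{ji}$ (with $w_{ij}=0$ if $(i,j)\notin\mathcal{E}$): the real symmetric matrix with diagonal entries $\sum_{j\ne i}w_{ij}$ and off-diagonal entries $-w_{ij}$. $\bm{L}_0$ is the Laplacian with $w_{ij}=a_{ij}$; $\bm{L}_0^{\mathrm{abs}}$ is the Laplacian with $w_{ij}=|a_{ij}|$; $\overline{\lambda}=\lambda_{\max}(\bm{L}_0^{\mathrm{abs}})$ is its largest eigenvalue. Standing assumption: $\bm{L}_0$ is positive semi-definite with a simple zero eigenvalue. Delay-embedded signed Laplacian: $\widehat{\bm{L}}_\tau\in\mathbb{R}^{n\times n}$ is the Laplacian with edge values, for $(i,j)\in\mathcal{E}$,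 - $w_{ij}=a_{ij}$ if $a_{ij}>0$, $\tau_{ij}=0$; - $w_{ij}=a_{ij}e^{-\tau_{ij}\overline{\lambda}}\cos(\tau_{ij}\overline{\lambda})$ if $a_{ij}>0$, $0<\tau_{ij}\overline{\lambda}<\frac{\pi}{2}$; - $w_{ij}=a_{ij}\cos(\tau_{ij}\overline{\lambda})$ if $a_{ij}>0$, $\frac{\pi}{2}\le\tau_{ij}\overline{\lambda}<\pi$; - $w_{ij}=-a_{ij}$ if $a_{ij}>0$, $\tau_{ij}\overline{\lambda}\ge\pi$; - $w_{ij}=a_{ij}$ if $a_{ij}<0$. $\widehat{\bm{L}}_\tau^{(k,l)}$ is the Laplacian with the same edge values $w_{ij}$ as $\widehat{\bm{L}}_\tau$ (with $\overline{\lambda}$ that of the original graph) except that the value of the edge $(k,l)$ is set to zero, i.e. $\widehat{\bm{L}}_\tau=\widehat{\bm{L}}_\tau^{(k,l)}+w_{kl}(\bm{e}_k-\bm{e}_l)(\bm{e}_k-\bm{e}_l)^T$, with $\bm{e}_i$ the standard basis vectors. Extended effective resistance: let $\bm{L}$ be a Laplacian over the graph, $\mathcal{V}_a,\mathcal{V}_b\subset\mathcal{V}$ non-empty and disjoint, $\mathcal{V}_c=\mathcal{V}\setminus(\mathcal{V}_a\cup\mathcal{V}_b)$, $a=|\mathcal{V}_a|$, $b=|\mathcal{V}_b|$, and partition $\bm{L}$ into blocks $\bm{L}_{aa},\bm{L}_{ab},\bm{L}_{ac},\bm{L}_{bb},\bm{L}_{bc},\bm{L}_{cc}$ accordingly.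 Then $$r^{\mathrm{eff}}(\bm{L},\mathcal{V}_a,\mathcal{V}_b)=\bigl[\bm{e}_{\mathcal{V}_a}^T(\bm{L}/\bm{L}_{cc})\bm{e}_{\mathcal{V}_a}\bigr]^{-1},\qquad \bm{L}/\bm{L}_{cc}=\begin{bmatrix}\bm{L}_{aa}&\bm{L}_{ab}\\ \bm{L}_{ab}^T&\bm{L}_{bb}\end{bmatrix}-\begin{bmatrix}\bm{L}_{ac}\\ \bm{L}_{bc}\end{bmatrix}\bm{L}_{cc}^{-1}\begin{bmatrix}\bm{L}_{ac}^T&\bm{L}_{bc}^T\end{bmatrix},$$ where $\bm{e}_{\mathcal{V}_a}\in\mathbb{R}^{a+b}$ has entries one at the indices in $\mathcal{V}_a$ and zero elsewhere. If $\mathcal{V}_c=\emptyset$, then $\bm{L}/\bm{L}_{cc}$ is $\bm{L}$ itself. The quantity is well defined when $\bm{L}_{cc}$ is nonsingular and the bracketed scalar is nonzero; the condition $r^{\mathrm{eff}}>0$ is understood to include well-definedness. Solutions: $\bm{x}(t)=[x_i(t)]\in\mathbb{R}^n$ is continuous on $[0,\infty)$ with arbitrary initial value $\bm{x}(0)$, satisfies the equation for almost every $t\ge0$, with $x_i(t)=0$ for $t<0$ (so that its Laplace transform $\bm{X}(s)=[X_i(s)]$ satisfies $sX_i(s)-x_i(0)=\sum_j a_{ij}e^{-\tau_{ij}s}(X_j(s)-X_i(s))$). The system reaches an average consensus if, for every $\bm{x}(0)$, $\lim_{t\to\infty}\bm{x}(t)=c\bm{1}_n$ with $c=\frac1n\bm{1}_n^T\bm{x}(0)$,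 where $\bm{1}_n$ is the all-ones vector.
   Formalization: The equivalence with the displayed inequalities is stated only for a_kl > 0: if a_kl < 0 they hold trivially and neither the equivalence nor consensus need follow. Solutions are taken locally absolutely continuous, as merely continuous a.e. solutions would make the claim false. *)

(* Defs.v *)
From HB Require Import structures.
From mathcomp Require Import all_boot all_order all_algebra.
From mathcomp Require Import all_classical all_reals all_analysis.
Set Implicit Arguments.
Unset Strict Implicit.
Unset Printing Implicit Defensive.
Import Order.TTheory GRing.Theory Num.Theory.
Import numFieldNormedType.Exports.
Local Open Scope classical_set_scope.
Local Open Scope ring_scope.

Record delay_graph (R : realType) (n : nat) := DelayGraph {
  edge : rel 'I_n;
  weight : 'M[R]_n;
  delay : 'M[R]_n;
  edge_irr : irreflexive edge;
  edge_sym : symmetric edge;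
  edge_conn : forall i j, connect edge i j;
  weight_sym : forall i j, weight i j = weight j i;
  weight_edge : forall i j, (weight i j != 0) = edge i j;
  delay_sym : forall i j, delay i j = delay j i;
  delay_ge0 : forall i j, 0 <= delay i j;
  delay_nonedge : forall i j, ~~ edge i j -> delay i j = 0
}.

Definition laplacian (R : realType) (n : nat) (w : 'I_n -> 'I_n -> R) : 'M[R]_n :=
  \matrix_(i, j) if i == j then \sum_(m | m != i) w i m else - w i j.

Definition psdmx (R : realType) (n : nat) (M : 'M[R]_n) : Prop :=
  M^T = M /\ forall v : 'cV[R]_n, 0 <= (v^T *m M *m v) 0 0.

(* Simplicity is algebraic: 0 is a root of multiplicity one of the
   characteristic polynomial. *)
Definition psd_simple_zero (R : realType) (n : nat) (M : 'M[R]_n) : Prop :=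
  psdmx M /\ mup 0 (char_poly M) = 1%N.

(* The supremum is a maximum when M is symmetric and 0 < n: the set is then
   finite and nonempty. *)
Definition lambda_max (R : realType) (n : nat) (M : 'M[R]_n) : R :=
  sup [set a : R | eigenvalue M a].

Definition L0 (R : realType) (n : nat) (G : delay_graph R n) : 'M[R]_n :=
  laplacian (fun i j => weight G i j).

Definition L0abs (R : realType) (n : nat) (G : delay_graph R n) : 'M[R]_n :=
  laplacian (fun i j => `|weight G i j|).

Definition lambda_bar (R : realType) (n : nat) (G : delay_graph R n) : R :=
  lambda_max (L0abs G).

(* Off the edges the weight is 0, so the last branch returns 0 there.  In the
   branch [t < pi / 2], t is positive since an edge forces 0 < lambda_bar G. *)
Definition what (R : realType) (n : nat) (G : delay_graph R n)
    (i j : 'I_n) : R :=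
  let a := weight G i j in
  let t := delay G i j * lambda_bar G in
  if 0 < a then
    if delay G i j == 0 then a
    else if t < pi / 2 then a * expR (- t) * cos t
    else if t < pi then a * cos t
    else - a
  else a.

Definition del_edge (R : realType) (n : nat) (w : 'I_n -> 'I_n -> R)
    (k l : 'I_n) (i j : 'I_n) : R :=
  if ((i == k) && (j == l)) || ((i == l) && (j == k)) then 0 else w i j.

Definition Lhat (R : realType) (n : nat) (G : delay_graph R n) : 'M[R]_n :=
  laplacian (what G).

(* The edge values, hence also lambda_bar, are those of the original graph. *)
Definition Lhat_del (R : realType) (n : nat) (G : delay_graph R n)
    (k l : 'I_n) : 'M[R]_n :=
  laplacian (del_edge (what G) k l).

Definition mxblk (R : realType) (n : nat) (L : 'M[R]_n) (A B : {set 'I_n})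
    : 'M[R]_(#|A|, #|B|) :=
  \matrix_(i, j) L (enum_val i) (enum_val j).

(* L / L_cc with rows and columns ordered as A followed by B, where
   C = ~: (A :|: B).  When C is empty the subtracted product has inner
   dimension 0 and vanishes. *)
Definition schur_compl (R : realType) (n : nat) (L : 'M[R]_n)
    (A B : {set 'I_n}) : 'M[R]_(#|A| + #|B|) :=
  let C := ~: (A :|: B) in
  block_mx (mxblk L A A) (mxblk L A B) (mxblk L A B)^T (mxblk L B B)
  - col_mx (mxblk L A C) (mxblk L B C) *m invmx (mxblk L C C)
    *m row_mx (mxblk L A C)^T (mxblk L B C)^T.

Definition ind_vec (R : realType) (n : nat) (A B : {set 'I_n})
    : 'cV[R]_(#|A| + #|B|) :=
  col_mx (const_mx 1) (const_mx 0).

Definition eff_cond (R : realType) (n : nat) (L : 'M[R]_n)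
    (A B : {set 'I_n}) : R :=
  ((ind_vec R A B)^T *m schur_compl L A B *m ind_vec R A B) 0 0.

Definition reff (R : realType) (n : nat) (L : 'M[R]_n) (A B : {set 'I_n}) : R :=
  (eff_cond L A B)^-1.

Definition reff_defined (R : realType) (n : nat) (L : 'M[R]_n)
    (A B : {set 'I_n}) : Prop :=
  let C := ~: (A :|: B) in
  mxblk L C C \in unitmx /\ eff_cond L A B != 0.

Definition reff_pos (R : realType) (n : nat) (L : 'M[R]_n)
    (A B : {set 'I_n}) : Prop :=
  reff_defined L A B /\ 0 < reff L A B.

Definition abs_continuous_on (R : realType) (f : R -> R) (a b : R) : Prop :=
  forall e : R, 0 < e -> exists2 d : R, 0 < d &
    forall (m : nat) (u v : 'I_m -> R),
      (forall i, a <= u i /\ u i <= v i /\ v i <= b) ->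
      (forall i j, i != j -> v i <= u j \/ v j <= u i) ->
      \sum_(i < m) (v i - u i) < d ->
      \sum_(i < m) `|f (v i) - f (u i)| < e.

(* Solutions are understood in the sense of Caratheodory.  Without local
   absolute continuity an almost-everywhere equation would not determine x
   from x(0): one could add Cantor-type functions to a solution. *)
Definition solution (R : realType) (n : nat) (G : delay_graph R n)
    (x : 'I_n -> R -> R) : Prop :=
  [/\ forall i t, t < 0 -> x i t = 0,
      forall i, {within `[0, +oo[, continuous (x i)},
      forall i T, 0 < T -> abs_continuous_on (x i) 0 T
    & {ae (@lebesgue_measure R), forall t : R, 0 <= t -> forall i,
        is_derive t (1 : R) (x i)
          (\sum_(j < n) weight G i j *
             (x j (t - delay G i j) - x i (t - delay G i j)))}].

Definition average_consensus (R : realType) (n : nat) (G : delay_graph R n)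
    : Prop :=
  forall x : 'I_n -> R -> R, solution G x ->
    forall i, x i t @[t --> +oo] --> (\sum_(j < n) x j 0) / n%:R.

(* Main.v *)
(* By the Dirichlet principle for the Laplacian without the edge (k,l), a
   positive effective resistance makes the form of the full delay-embedded
   Laplacian coercive on mean-zero vectors.  For Re s >= 0 with |s| up
   to lambda_bar this form bounds from below the real part of the symbol
   s + L(s) of the delay system, while for larger |s| the symbol is dominated
   by s itself because lambda_bar bounds L(s); hence the symbol is invertible
   on mean-zero vectors, uniformly in Re s >= 0.

   Instead of inverting a Laplace transform, the bound on the symbol is
   carried to the time domain by sampling the damped solution
   exp(-sigma t) x(t), cutting it off near the ends of a time window and
   applying the discrete Parseval identity.  The outcome is an inequality
   bounding the energy in a window by the energy near its ends, with a
   constant independent of sigma >= 0.  It leaves a gap: the cumulated energy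
   is either bounded or grows at a definite exponential rate.  So sigma can be
   lowered in fixed steps from a large value down to 0; the undamped energy is
   then finite, which forces convergence to the mean. *)
Require Import Defs.
From mathcomp Require Import all_boot all_order all_algebra.
From mathcomp Require Import all_classical all_reals all_analysis.
From mathcomp Require Import ring lra zify.
Import Order.TTheory GRing.Theory Num.Theory.
Import numFieldNormedType.Exports.
Local Open Scope ring_scope.
Set Implicit Arguments.
Unset Strict Implicit.
Unset Printing Implicit Defensive.

(** * Symmetric matrices and Laplacians *)

(** The edge values in [what] are the minima of [a exp(-p) cos phi] over the box [0 <= p <= t],
    [|phi| <= t] with [t = delay * lambda_bar]. This ties the hypothesis, which concerns a real
    symmetric matrix, to the complex symbol.

    Sampling costs some room: on a grid the derivative has symbol [H (1 - exp(i theta))], whose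
    modulus is a chord rather than the arc [H |theta|], and delays are rounded to the mesh. The
    strict coercivity constant [mu] absorbs this loss once the mesh is fine. In the limit the mesh
    disappears, together with every constant that depends on the particular solution.

    A second obstacle is regularity. The history is zero and the initial value arbitrary, so a
    solution jumps at 0, and the jump reappears in the right-hand side at each delay. Beyond the
    largest delay the right-hand side is continuous, and absolute continuity upgrades the equation
    from almost every time to every time. The analysis therefore starts at a later time; only the
    conservation of the sum looks back to time 0. *)

(** In a basis adapted to the row space, [M] becomes a matrix [Z] whose last [n - \rank M] columns
    vanish, and each of these columns of the characteristic matrix carries a factor [X]. *)
Lemma dvdp_char_poly_corank (F : fieldType) (n : nat) (M : 'M[F]_n) :
  'X^(n - \rank M) %| char_poly M.
Proof.
set r := \rank M; pose U := row_ebase M.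
pose Z := U *m col_ebase M *m (pid_mx r : 'M[F]_n).
have UM : U *m M = Z *m U by rewrite -[in LHS](mulmx_ebase M) /Z -!mulmxA.
pose d : 'rV[{poly F}]_n := \row_j (if (j < r)%N then 1 else 'X).
pose N : 'M[{poly F}]_n :=
  \matrix_(i, j) if (j < r)%N then char_poly_mx Z i j else (i == j)%:R.
have ZN : char_poly_mx Z = N *m diag_mx d.
  apply/matrixP => i j; rewrite mul_mx_diag !mxE.
  case: ifPn => [_|jr]; first by rewrite mulr1.
  rewrite big1 ?subr0 ?mulrb; first by case: ifP => _; rewrite ?mul1r ?mul0r.
  move=> k _; rewrite [pid_mx _ _ _]mxE; case: eqP => [kj|_]; last by rewrite mulr0.
  by rewrite kj (negbTE jr) mulr0.
have UP : map_mx polyC U *m char_poly_mx M = char_poly_mx Z *m map_mx polyC U.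
  by rewrite /char_poly_mx mulmxBr mulmxBl -!map_mxM UM scalar_mxC.
have := congr1 determinant UP; rewrite !det_mulmx ZN det_mulmx det_diag.
rewrite mulrC => /mulIf H; rewrite /char_poly H; last first.
  by rewrite det_map_mx polyC_eq0 -unitfE -unitmxE row_ebase_unit.
have -> : \prod_i d 0 i = 'X^(n - r).
  under eq_bigr do rewrite mxE -if_neg.
  rewrite -big_mkcond /= prodr_const; congr (_ ^+ _).
  rewrite -sum1_card (eq_bigl (fun j : 'I_n => true && (r <= j)%N)); last first.
    by move=> j; rewrite unfold_in /= -leqNgt.
  by rewrite -(big_geq_mkord r n predT (fun=> 1%N)) sum_nat_const_nat muln1.
exact: dvdp_mull.
Qed.

(** Algebraic simplicity bounds the corank by one, and the constants already fill a kernel of that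
    dimension. Symmetry moves between column vectors and the row kernel [kermx]. *)
Lemma sym_simple_kernel (F : fieldType) (n : nat) (M : 'M[F]_n) :
  M^T = M -> mup 0 (char_poly M) = 1%N -> M *m const_mx 1 = 0 :> 'cV_n ->
  forall v : 'cV_n, M *m v = 0 -> exists a, v = const_mx a.
Proof.
move=> Msym mu1 M1 v Mv.
case: n => [|n] in M Msym mu1 M1 v Mv *.
  by exists 0; apply/matrixP => -[].
have kerT (u : 'cV_n.+1) : M *m u = 0 -> (u^T <= kermx M)%MS.
  by move=> Mu; apply/sub_kermxP; rewrite -[in LHS]Msym -trmx_mul Mu trmx0.
have c1 : \rank (const_mx 1 : 'rV[F]_n.+1) = 1%N.
  rewrite rank_rV; case: eqP => // /rowP /(_ 0); rewrite !mxE => /eqP.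
  by rewrite oner_eq0.
have cK : ((const_mx 1 : 'rV[F]_n.+1) <= kermx M)%MS.
  by rewrite -trmx_const; apply: kerT.
have rK : (\rank (kermx M) <= 1)%N.
  rewrite mxrank_ker -mu1 mup_geq ?monic_neq0 ?char_poly_monic// subr0.
  exact: dvdp_char_poly_corank.
have Kc : (kermx M <= (const_mx 1 : 'rV[F]_n.+1))%MS.
  by rewrite -(geq_leqif (mxrank_leqif_sup cK)) c1.
have /sub_rVP[a va] := submx_trans (kerT v Mv) Kc.
by exists a; apply: trmx_inj; rewrite va trmx_const; apply/rowP => i; rewrite !mxE mulr1.
Qed.

Lemma psdmx_cauchy_schwarz (R : realType) (n : nat) (M : 'M[R]_n) (u v : 'cV[R]_n) :
  psdmx M ->
  (u^T *m M *m v) 0 0 ^+ 2 <= (u^T *m M *m u) 0 0 * (v^T *m M *m v) 0 0.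
Proof.
move=> [Msym M0].
set b := (u^T *m M *m v) 0 0; set p := (u^T *m M *m u) 0 0; set q := (v^T *m M *m v) 0 0.
have bT : (v^T *m M *m u) 0 0 = b.
  transitivity ((v^T *m M *m u)^T 0 0); first by rewrite [RHS]mxE.
  by rewrite !trmx_mul trmxK Msym mulmxA.
have form s t : 0 <= s ^+ 2 * p - 2 * s * t * b + t ^+ 2 * q.
  have := M0 (s *: u - t *: v).
  have -> : (s *: u - t *: v)^T = s *: u^T - t *: v^T.
    by apply/rowP => i; rewrite !mxE.
  have BE (X Y : 'M[R]_1) : (X - Y) 0 0 = X 0 0 - Y 0 0 by rewrite !mxE.
  have ZE c (X : 'M[R]_1) : (c *: X) 0 0 = c * X 0 0 by rewrite !mxE.
  rewrite !mulmxBl !mulmxBr -!scalemxAl -!scalemxAr !BE !ZE.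
  rewrite -/p -/q -/b bT; move: bT => _; move: b p q => b p q h.
  by rewrite (le_trans h)// le_eqVlt; apply/orP; left; apply/eqP; ring.
have q0 : 0 <= q by exact: M0.
have p0 : 0 <= p by exact: M0.
case: (ltgtP q 0) q0 => // [q_gt0 _|q_eq0 _].
  have := form q b; rewrite (_ : _ + _ = q * (p * q - b ^+ 2)); last by ring.
  by rewrite pmulr_rge0// subr_ge0.
have [->|b0] := eqVneq b 0; first by rewrite expr0n mulr_ge0// q_eq0.
(* With [q = 0] the form is affine in [t], and this choice makes it equal to [-1]. *)
have := form 1 ((p + 1) / (2 * b)); rewrite q_eq0 (_ : _ + _ = - 1) ?ler0N1//; last by field.
Qed.

Lemma psdmx_kernel (R : realType) (n : nat) (M : 'M[R]_n) (v : 'cV[R]_n) :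
  psdmx M -> (v^T *m M *m v) 0 0 = 0 -> M *m v = 0.
Proof.
move=> Mpsd v0; apply/colP => i; rewrite [RHS]mxE.
have := psdmx_cauchy_schwarz (delta_mx i 0) v Mpsd; rewrite v0 mulr0.
rewrite real_exprn_even_le0 ?num_real//= => /eqP <-.
by rewrite trmx_delta -rowE -row_mul [RHS]mxE.
Qed.

Lemma sqr_colE (R : comNzRingType) (n : nat) (v : 'cV[R]_n) :
  (v^T *m v) 0 0 = \sum_i v i 0 ^+ 2.
Proof. by rewrite mxE; apply: eq_bigr => i _; rewrite mxE expr2. Qed.

Lemma sqr_col_ge0 (R : realType) (n : nat) (v : 'cV[R]_n) : 0 <= (v^T *m v) 0 0.
Proof. by rewrite sqr_colE sumr_ge0// => i _; rewrite sqr_ge0. Qed.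

Lemma sqr_col_eq0 (R : realType) (n : nat) (v : 'cV[R]_n) :
  (v^T *m v) 0 0 = 0 -> v = 0.
Proof.
rewrite sqr_colE => /eqP; rewrite psumr_eq0; last by move=> i _; rewrite sqr_ge0.
by move=> /allP v0; apply/colP => i; have /= := v0 i (mem_index_enum i); rewrite sqrf_eq0 mxE => /eqP.
Qed.

Lemma form_bound (R : realType) (n : nat) (W : 'M[R]_n) (v : 'cV[R]_n) :
  `|(v^T *m W *m v) 0 0| <= (\sum_i \sum_j `|W i j|) * (v^T *m v) 0 0.
Proof.
rewrite sqr_colE -mulmxA mxE (le_trans (ler_norm_sum _ _ _))// mulr_suml.
apply: ler_sum => i _; rewrite !mxE normrM mulr_suml.
have le_sq (k : 'I_n) : v k 0 ^+ 2 <= \sum_i v i 0 ^+ 2.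
  by rewrite (bigD1 k)//= lerDl sumr_ge0// => j _; rewrite sqr_ge0.
rewrite (le_trans (ler_wpM2l (normr_ge0 _) (ler_norm_sum _ _ _)))// mulr_sumr.
apply: ler_sum => j _; rewrite normrM mulrCA ler_wpM2l//.
have := le_sq i; have := le_sq j; have := sqr_ge0 (`|v i 0| - `|v j 0|).
rewrite sqrrB !real_normK ?num_real//; set a := `|v i 0|; set b := `|v j 0|; set c := \sum__ _.
by move: (v i 0) (v j 0) a b c => x y a b c; lra.
Qed.

Lemma sym_inj_unitmx (F : fieldType) (n : nat) (M : 'M[F]_n) :
  M^T = M -> (forall v : 'cV_n, M *m v = 0 -> v = 0) -> M \in unitmx.
Proof.
move=> Msym Minj.
rewrite -row_free_unit -kermx_eq0; apply/eqP/row_matrixP => i; rewrite row0.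
apply: trmx_inj; rewrite trmx0; apply: Minj.
have -> : M *m (row i (kermx M))^T = (row i (kermx M) *m M)^T.
  by rewrite trmx_mul Msym.
by rewrite -row_mul mulmx_ker row0 trmx0.
Qed.

(** Cauchy-Schwarz for [v] and [invmx M *m v] bounds the square of [|v|^2] by the form at [v] times
    the form of the inverse at [v]; the latter is at most a constant times [|v|^2]. *)
Lemma psdmx_coercive (R : realType) (n : nat) (M : 'M[R]_n) :
  psdmx M -> (forall v : 'cV_n, M *m v = 0 -> v = 0) ->
  exists2 mu, 0 < mu & forall v : 'cV_n, mu * (v^T *m v) 0 0 <= (v^T *m M *m v) 0 0.
Proof.
move=> Mpsd Minj; have [Msym M0] := Mpsd.
have Mu := sym_inj_unitmx Msym Minj.
pose W := invmx M; pose C := \sum_i \sum_j `|W^T i j| + 1.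
have C0 : 0 < C by rewrite ltr_wpDl// sumr_ge0// => i _; rewrite sumr_ge0.
exists C^-1; first by rewrite invr_gt0.
move=> v; rewrite mulrC ler_pdivrMr//.
have MWv : M *m (W *m v) = v by rewrite /W mulKVmx.
have := psdmx_cauchy_schwarz v (W *m v) Mpsd.
rewrite -(mulmxA v^T M (W *m v)) -(mulmxA (W *m v)^T) MWv trmx_mul => CS.
have := form_bound W^T v; have := sqr_col_ge0 v; have := M0 v; move: CS.
rewrite -/C; have -> : \sum_i \sum_j `|W^T i j| = C - 1 by rewrite /C addrK.
set b := (v^T *m v) 0 0; set q := (v^T *m M *m v) 0 0; set e := (_ *m _) 0 0.
move=> CS q0; rewrite le_eqVlt => /predU1P[<- _|b0]; first by rewrite mulr_ge0// ltW.
move=> eb; have {}eb : e <= C * b by have := ler_norm e; nra.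
have : b * b <= b * (q * C); last by rewrite ler_pM2l.
by rewrite -expr2 (le_trans CS)//; nra.
Qed.

(** The least [c0] with [c0%:M - N] positive semi-definite exists because this condition is closed.
    If [c0] were not an eigenvalue, this matrix would be injective, hence coercive, and [c0] could
    be lowered. So [c0] is an eigenvalue, and no eigenvalue exceeds it. *)
Lemma lambda_max_form (R : realType) (n : nat) (N : 'M[R]_n) (v : 'cV[R]_n) :
  N^T = N -> (v^T *m N *m v) 0 0 <= lambda_max N * (v^T *m v) 0 0.
Proof.
move=> Nsym; have := sqr_col_ge0 v; rewrite le_eqVlt => /predU1P[v0|v_gt0].
  by rewrite -v0 (sqr_col_eq0 (esym v0)) mulmx0 mxE mulr0.
have form c (u : 'cV_n) : (u^T *m (c%:M - N) *m u) 0 0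
    = c * (u^T *m u) 0 0 - (u^T *m N *m u) 0 0.
  by rewrite mulmxBr mulmxBl scalar_mxC mul_scalar_mx -scalemxAl !mxE.
have symB c : (c%:M - N)^T = c%:M - N by rewrite linearB /= tr_scalar_mx Nsym.
pose S := [set c : R | psdmx (c%:M - N)]%classic.
have SE c : S c <-> forall u : 'cV_n, (u^T *m N *m u) 0 0 <= c * (u^T *m u) 0 0.
  split=> [[_ c0] u|c0]; first by rewrite -subr_ge0 -form.
  by split=> // u; rewrite form subr_ge0.
have Slb : lbound S ((v^T *m N *m v) 0 0 / (v^T *m v) 0 0).
  by move=> c /SE cv; rewrite ler_pdivrMr.
have Sinf : has_inf S.
  split; last by exists ((v^T *m N *m v) 0 0 / (v^T *m v) 0 0).
  exists (\sum_i \sum_j `|N i j|); apply/SE => u.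
  exact: le_trans (ler_norm _) (form_bound _ _).
pose c0 := inf S.
have Sc0 : S c0.
  apply/SE => u; have := sqr_col_ge0 u; rewrite le_eqVlt => /predU1P[u0|u_gt0].
    by rewrite -u0 (sqr_col_eq0 (esym u0)) mulmx0 mxE mulr0.
  by rewrite -ler_pdivrMr//; apply: lb_le_inf Sinf.1 _ => c /SE cu; rewrite ler_pdivrMr.
have eig_le a : eigenvalue N a -> a <= c0.
  move=> /eigenvalueP[u ua u0].
  have := (SE c0).1 Sc0 u^T; rewrite trmxK ua -scalemxAl mxE ler_pM2r//.
  have := sqr_col_ge0 u^T; rewrite trmxK le_eqVlt => /predU1P[uu|//].
  have := @sqr_col_eq0 _ _ u^T; rewrite trmxK => /(_ (esym uu)) /(congr1 trmx).
  by rewrite trmxK trmx0 => /eqP; rewrite (negbTE u0).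
have eig_c0 : eigenvalue N c0.
  apply: contrapT => Nc0.
  have [u cu|mu mu0 muP] := psdmx_coercive Sc0.
    apply: contrapT => u0; apply: Nc0; apply/eigenvalueP; exists u^T.
      apply: trmx_inj; rewrite trmx_mul trmxK Nsym linearZ /= trmxK.
      by move/eqP: cu; rewrite mulmxBl mul_scalar_mx subr_eq0 => /eqP.
    by apply/eqP => /(congr1 trmx); rewrite trmxK trmx0.
  have /(ge_inf Sinf.2) : S (c0 - mu).
    by apply/SE => u; have := muP u; rewrite form mulrBl; lra.
  by rewrite -/c0; lra.
have := (SE c0).1 Sc0 v; move/le_trans; apply; rewrite ler_pM2r//.
apply: ub_le_sup => //; exists c0 => a; exact: eig_le.
Qed.

(** Summation by parts on a graph: averaging the sum with its copy under exchange of [i] and [j]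
    turns [f i] into half of [f i - f j]. *)
Lemma sum_sym_form (R : realFieldType) (I : finType) (W : I -> I -> R) (f g : I -> R) :
  (forall i j, W i j = W j i) ->
  \sum_i f i * (\sum_j W i j * (g i - g j)) =
  2^-1 * \sum_i \sum_j W i j * ((f i - f j) * (g i - g j)).
Proof.
move=> Wsym.
have -> : \sum_i \sum_j W i j * ((f i - f j) * (g i - g j)) =
    \sum_i \sum_j W i j * (f i * (g i - g j))
    + \sum_i \sum_j W i j * (f j * (g j - g i)).
  rewrite -big_split; apply: eq_bigr => i _; rewrite -big_split.
  by apply: eq_bigr => j _ /=; ring.
rewrite [X in _ + X]exchange_big /=.
have -> : \sum_j \sum_i W i j * (f j * (g j - g i)) =
    \sum_i \sum_j W i j * (f i * (g i - g j)).
  by apply: eq_bigr => i _; apply: eq_bigr => j _; rewrite Wsym.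
have -> : \sum_i f i * (\sum_j W i j * (g i - g j)) =
    \sum_i \sum_j W i j * (f i * (g i - g j)).
  by apply: eq_bigr => i _; rewrite mulr_sumr; apply: eq_bigr => j _; rewrite mulrCA.
by rewrite -mulr2n -[X in _ * X]mulr_natl mulrA mulVf ?mul1r// pnatr_eq0.
Qed.

(** The factor [2^-1] offsets the double count of each unordered pair, so that this is the quadratic
    form of [laplacian w] when [w] is symmetric. *)
Definition dirichlet (R : realFieldType) (n : nat) (w : 'I_n -> 'I_n -> R) (x : 'I_n -> R) : R :=
  2^-1 * \sum_i \sum_j w i j * (x i - x j) ^+ 2.

Lemma laplacian_mulE (R : realType) (n : nat) (w : 'I_n -> 'I_n -> R) (v : 'cV[R]_n) i :
  (laplacian w *m v) i 0 = \sum_j w i j * (v i 0 - v j 0).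
Proof.
rewrite mxE [LHS](bigD1 i)//= [RHS](bigD1 i)//= subrr mulr0 add0r !mxE eqxx mulr_suml.
rewrite -big_split /=; apply: eq_bigr => j ji.
by rewrite mxE eq_sym (negbTE ji); ring.
Qed.

Lemma laplacian_sym (R : realType) (n : nat) (w : 'I_n -> 'I_n -> R) :
  (forall i j, w i j = w j i) -> (laplacian w)^T = laplacian w.
Proof.
move=> wsym; apply/matrixP => i j; rewrite !mxE eq_sym.
by case: eqP => [->|_]; rewrite 1?wsym.
Qed.

Lemma laplacian_form (R : realType) (n : nat) (w : 'I_n -> 'I_n -> R) (v : 'cV[R]_n) :
  (forall i j, w i j = w j i) ->
  (v^T *m laplacian w *m v) 0 0 = dirichlet w (fun i => v i 0).
Proof.
move=> wsym; rewrite -mulmxA mxE /dirichlet.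
under [in RHS]eq_bigr do under eq_bigr do rewrite expr2.
rewrite -(sum_sym_form _ _ wsym); apply: eq_bigr => i _.
by rewrite laplacian_mulE mxE.
Qed.

Lemma laplacian_const (R : realType) (n : nat) (w : 'I_n -> 'I_n -> R) :
  laplacian w *m const_mx 1 = 0 :> 'cV_n.
Proof.
apply/colP => i; rewrite laplacian_mulE big1 ?mxE// => j _.
by rewrite !mxE subrr mulr0.
Qed.

Lemma dirichlet_le_lambda_bar (R : realType) (n : nat) (G : delay_graph R n) (x : 'I_n -> R) :
  dirichlet (fun i j => `|weight G i j|) x <= lambda_bar G * \sum_i x i ^+ 2.
Proof.
have wsym i j : `|weight G i j| = `|weight G j i| by rewrite weight_sym.
have := @lambda_max_form _ _ (L0abs G) (\col_i x i) (laplacian_sym wsym).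
have xE : (fun i => (\col_i x i) i 0) = x by apply/funext => i; rewrite mxE.
rewrite laplacian_form// sqr_colE xE -/(lambda_bar G).
by under eq_bigr do rewrite mxE.
Qed.

Lemma laplacian_simple_kernel (R : realType) (n : nat) (w : 'I_n -> 'I_n -> R) (v : 'cV[R]_n) :
  psd_simple_zero (laplacian w) -> (v^T *m laplacian w *m v) 0 0 = 0 ->
  exists a, v = const_mx a.
Proof.
move=> [psdL mu1] v0.
exact: (sym_simple_kernel psdL.1 mu1 (laplacian_const w) (psdmx_kernel psdL v0)).
Qed.

(** Adding the all-ones matrix [J], whose form is the square of the sum of the entries, makes the
    form definite and changes nothing on mean-zero vectors. *)
Lemma laplacian_coercive (R : realType) (n : nat) (w : 'I_n -> 'I_n -> R) :
  (forall i j, w i j = w j i) -> psd_simple_zero (laplacian w) ->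
  exists2 mu, 0 < mu & forall x : 'I_n -> R, \sum_i x i = 0 ->
    mu * \sum_i x i ^+ 2 <= dirichlet w x.
Proof.
move=> wsym Lpsd; pose J : 'M[R]_n := const_mx 1.
have JE (v : 'cV_n) i : (J *m v) i 0 = \sum_j v j 0.
  by rewrite mxE; apply: eq_bigr => j _; rewrite mxE mul1r.
have Jform (v : 'cV_n) : (v^T *m J *m v) 0 0 = (\sum_j v j 0) ^+ 2.
  rewrite -mulmxA mxE expr2 mulr_suml; apply: eq_bigr => i _.
  by rewrite JE mxE.
have DE (X Y : 'M[R]_1) : (X + Y) 0 0 = X 0 0 + Y 0 0 by rewrite !mxE.
have form (v : 'cV_n) : (v^T *m (laplacian w + J) *m v) 0 0
    = (v^T *m laplacian w *m v) 0 0 + (\sum_j v j 0) ^+ 2.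
  by rewrite mulmxDr mulmxDl DE Jform.
have psdJ : psdmx (laplacian w + J).
  split; first by rewrite linearD /= laplacian_sym// trmx_const.
  by move=> v; rewrite form addr_ge0 ?sqr_ge0// Lpsd.1.2.
have [|mu mu0 muP] := psdmx_coercive psdJ.
  move=> v Lv; have := form v; rewrite -mulmxA Lv mulmx0 [LHS]mxE => /esym/eqP.
  rewrite paddr_eq0 ?sqr_ge0 ?Lpsd.1.2// => /andP[/eqP v0]; rewrite sqrf_eq0 => /eqP sv0.
  have [a va] := laplacian_simple_kernel Lpsd v0.
  apply/colP => i; move: sv0; rewrite va; under eq_bigr do rewrite mxE.
  rewrite sumr_const card_ord -mulr_natr => /eqP; rewrite mulf_eq0 !mxE => /orP[/eqP//|].
  by rewrite pnatr_eq0 => /eqP n0; case: i {va} => m; rewrite n0.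
exists mu => // x x0; have := muP (\col_i x i).
have xE : (fun i => (\col_i x i) i 0) = x by apply/funext => i; rewrite mxE.
rewrite form laplacian_form// sqr_colE xE.
under [X in _ + X ^+ 2]eq_bigr do rewrite mxE.
rewrite x0 expr0n addr0.
by under eq_bigr do rewrite mxE.
Qed.

Definition extend0 (R : realType) (n : nat) (C : {set 'I_n}) (v : 'cV[R]_#|C|) (i : 'I_n) : R :=
  \sum_c (enum_val c == i)%:R * v c 0.

Lemma extend0_val (R : realType) (n : nat) (C : {set 'I_n}) (v : 'cV[R]_#|C|) c :
  extend0 v (enum_val c) = v c 0.
Proof.
rewrite /extend0 (bigD1 c)//= eqxx mul1r big1 ?addr0// => d dc.
by rewrite (inj_eq enum_val_inj) (negbTE dc) mul0r.
Qed.

Lemma extend0_out (R : realType) (n : nat) (C : {set 'I_n}) (v : 'cV[R]_#|C|) i :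
  i \notin C -> extend0 v i = 0.
Proof.
move=> iC; rewrite /extend0 big1// => c _; case: eqP => [ci|_]; last by rewrite mul0r.
by move: iC; rewrite -ci enum_valP.
Qed.

Lemma sum_extend0 (R : realType) (n : nat) (C : {set 'I_n}) (v : 'cV[R]_#|C|) (F : 'I_n -> R) :
  \sum_i F i * extend0 v i = \sum_c F (enum_val c) * v c 0.
Proof.
under eq_bigr do rewrite /extend0 mulr_sumr.
rewrite exchange_big /=; apply: eq_bigr => c _; rewrite (bigD1 (enum_val c))//= eqxx mul1r.
by rewrite big1 ?addr0// => i ic; rewrite eq_sym (negbTE ic) mul0r mulr0.
Qed.

Lemma laplacian_row_sum (R : realType) (n : nat) (w : 'I_n -> 'I_n -> R) (x : 'I_n -> R) i :
  \sum_j laplacian w i j * x j = \sum_j w i j * (x i - x j).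
Proof.
transitivity ((laplacian w *m \col_j x j) i 0).
  by rewrite mxE; apply: eq_bigr => j _; rewrite [(\col_j x j) j 0]mxE.
by rewrite laplacian_mulE; apply: eq_bigr => j _; rewrite !mxE.
Qed.

Lemma laplacian_symE (R : realType) (n : nat) (w : 'I_n -> 'I_n -> R) :
  (forall i j, w i j = w j i) -> forall i j, laplacian w i j = laplacian w j i.
Proof. by move=> wsym i j; rewrite -[in LHS](laplacian_sym wsym) mxE. Qed.

(** * Effective resistance *)

Section effective_resistance.
Context (R : realType) (n : nat) (k l : 'I_n).
Hypothesis kl : k != l.
Local Notation C := (~: ([set k] :|: [set l])).

Lemma inC i : (i \in C) = (i != k) && (i != l).
Proof. by rewrite !inE negb_or. Qed.

(** A kernel vector of the block, extended by zero, annihilates the full form, so it is constant;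
    its value at [k] is zero. *)
Lemma laplacian_block_unit (w : 'I_n -> 'I_n -> R) :
  (forall i j, w i j = w j i) -> psd_simple_zero (laplacian w) ->
  mxblk (laplacian w) C C \in unitmx.
Proof.
move=> wsym Lpsd; apply: sym_inj_unitmx.
  by apply/matrixP => i j; rewrite mxE [LHS]mxE [RHS]mxE laplacian_symE.
move=> v Lv; pose x := \col_i extend0 v i.
have x0 : (x^T *m laplacian w *m x) 0 0 = 0.
  rewrite -mulmxA mxE big1// => i _; have [iC|iC] := boolP (i \in C); last first.
    by rewrite !mxE extend0_out// mul0r.
  rewrite -(enum_rankK_in iC iC); set c := enum_rank_in iC i.
  have xE j : x j 0 = extend0 v j by rewrite mxE.
  rewrite [X in _ * X]mxE; under eq_bigr do rewrite xE.
  rewrite sum_extend0; have /colP/(_ c) := Lv; rewrite [LHS]mxE [RHS]mxE.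
  by under eq_bigr do rewrite mxE; move->; rewrite mulr0.
have [a xa] := laplacian_simple_kernel Lpsd x0.
have a0 : a = 0.
  by have /colP/(_ k) := xa; rewrite !mxE extend0_out// inC eqxx.
apply/colP => c; rewrite -(extend0_val v c) [RHS]mxE.
by have /colP/(_ (enum_val c)) := xa; rewrite !mxE a0.
Qed.

Lemma eff_condE (L : 'M[R]_n) :
  eff_cond L [set k] [set l] = L k k -
  \sum_c \sum_d L k (enum_val c) * invmx (mxblk L C C) c d * L k (enum_val d).
Proof.
rewrite /eff_cond /schur_compl /ind_vec.
set A := [set k]; set B := [set l]; set I := invmx _.
rewrite tr_col_mx mulmxBr mulmxBl.
have BE (X Y : 'M[R]_1) : (X - Y) 0 0 = X 0 0 - Y 0 0 by rewrite !mxE.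
rewrite BE mul_row_block !trmx_const !mul0mx !addr0 mul_row_col mulmx0 addr0.
rewrite !mulmxA mul_row_col mul0mx addr0 -!mulmxA mul_row_col mulmx0 addr0.
have sumA (F : 'I_n -> R) : \sum_(a : 'I_#|A|) F (enum_val a) = F k.
  by rewrite -(big_enum_val F) big_set1.
congr (_ - _).
  rewrite mulmxA mxE -[RHS](sumA (fun a => L k a)); apply: eq_bigr => a _.
  rewrite mxE [X in _ * X]mxE mulr1 -(sumA (fun b => L b (enum_val a))).
  by apply: eq_bigr => b _; rewrite !mxE mul1r.
rewrite !mulmxA mxE -[RHS](sumA (fun a => \sum_c \sum_d L k (enum_val c) * I c d * L a (enum_val d))).
apply: eq_bigr => a _; rewrite [X in _ * X]mxE mulr1 mxE exchange_big.
apply: eq_bigr => d _; rewrite !mxE -mulr_suml; congr (_ * _).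
apply: eq_bigr => c _; congr (_ * _); rewrite mxE -(sumA (fun b => L b (enum_val c))).
by apply: eq_bigr => b _; rewrite !mxE mul1r.
Qed.

(** [h] is the electric potential with voltage 1 at [k], 0 at [l] and no source elsewhere; the Schur
    complement entry is the current leaving [k]. *)
Lemma eff_cond_harmonic (w : 'I_n -> 'I_n -> R) :
  (forall i j, w i j = w j i) -> mxblk (laplacian w) C C \in unitmx ->
  exists h : 'I_n -> R, [/\ h k = 1, h l = 0,
    (forall i, i != k -> i != l -> \sum_j w i j * (h i - h j) = 0)
  & \sum_j w k j * (h k - h j) = eff_cond (laplacian w) [set k] [set l]].
Proof.
move=> wsym Lu; set L := laplacian w.
pose p : 'cV_#|C| := \col_c L (enum_val c) k.
(* Harmonicity at the nodes of [C] reads [mxblk L C C *m y = - p]. *)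
pose y := - (invmx (mxblk L C C) *m p).
pose h i := (i == k)%:R + extend0 y i.
have sumh i : \sum_j L i j * h j = L i k + \sum_c L i (enum_val c) * y c 0.
  under eq_bigr do rewrite mulrDr; rewrite big_split /= sum_extend0; congr (_ + _).
  by rewrite (bigD1 k)//= eqxx mulr1 big1 ?addr0// => j /negbTE ->; rewrite mulr0.
exists h; split.
- by rewrite /h eqxx extend0_out ?addr0// inC eqxx.
- by rewrite /h eq_sym (negbTE kl) extend0_out ?addr0// inC eqxx andbF.
- move=> i ik il; rewrite -laplacian_row_sum sumh.
  have iC : i \in C by rewrite inC ik.
  rewrite -(enum_rankK_in iC iC); set c := enum_rank_in iC i.
  have : (mxblk L C C *m y) c 0 = - p c 0.
    by rewrite /y mulmxN mulKVmx// mxE.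
  rewrite mxE; under eq_bigr do rewrite mxE; move->.
  by rewrite [p c 0]mxE subrr.
- rewrite -laplacian_row_sum sumh eff_condE; congr (_ + _); rewrite -sumrN.
  have yE c : y c 0 = - (\sum_d invmx (mxblk L C C) c d * L (enum_val d) k).
    by rewrite /y mxE; congr (- _); rewrite mxE; apply: eq_bigr => d _; rewrite [p d 0]mxE.
  apply: eq_bigr => c _; rewrite yE mulrN; congr (- _); rewrite mulr_sumr.
  by apply: eq_bigr => d _; rewrite mulrA /L (laplacian_symE wsym (enum_val d)).
Qed.

Lemma dirichletE (w : 'I_n -> 'I_n -> R) (x : 'I_n -> R) : (forall i j, w i j = w j i) ->
  dirichlet w x = \sum_i x i * \sum_j w i j * (x i - x j).
Proof.
move=> wsym; by rewrite sum_sym_form.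
Qed.

(** Up to a constant, [x] is [(x k - x l) * h] plus a remainder [z] vanishing at [k] and [l]. Since
    [h] is harmonic elsewhere, the two parts are orthogonal for the form, and the form of [z] is
    nonnegative. *)
Lemma dirichlet_principle (w : 'I_n -> 'I_n -> R) (x : 'I_n -> R) :
  (forall i j, w i j = w j i) -> psd_simple_zero (laplacian w) ->
  eff_cond (laplacian w) [set k] [set l] * (x k - x l) ^+ 2 <= dirichlet w x.
Proof.
move=> wsym Lpsd.
have [h [hk hl hC hE]] := eff_cond_harmonic wsym (laplacian_block_unit wsym Lpsd).
pose a := x k - x l; pose z i := x i - x l - a * h i.
have zk : z k = 0 by rewrite /z hk mulr1 subrr.
have zl : z l = 0 by rewrite /z hl mulr0 subr0 subrr.
have Dz : 0 <= dirichlet w z.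
  have := Lpsd.1.2 (\col_i z i); rewrite laplacian_form//.
  by rewrite (_ : (fun i => (\col_i z i) i 0) = z)//; apply/funext => i; rewrite mxE.
have Dh : dirichlet w h = eff_cond (laplacian w) [set k] [set l].
  rewrite dirichletE// (bigD1 k)//= hk mul1r -hk hE big1 ?addr0// => i ik.
  have [->|il] := eqVneq i l; first by rewrite hl mul0r.
  by rewrite hC// mulr0.
have cross : \sum_i z i * \sum_j w i j * (h i - h j) = 0.
  rewrite big1// => i _; have [->|ik] := eqVneq i k; first by rewrite zk mul0r.
  have [->|il] := eqVneq i l; first by rewrite zl mul0r.
  by rewrite hC// mulr0.
suff -> : dirichlet w x = a ^+ 2 * dirichlet w h
    + 2 * a * (\sum_i z i * \sum_j w i j * (h i - h j)) + dirichlet w z.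
  by rewrite cross Dh mulr0 addr0 mulrC lerDl.
rewrite sum_sym_form// /dirichlet !mulrA ![_ * 2^-1]mulrC -!mulrA -!mulrDr; congr (_ * _).
rewrite !mulr_sumr -!big_split; apply: eq_bigr => i _ /=.
rewrite !mulr_sumr -!big_split; apply: eq_bigr => j _ /=.
have -> : x i - x j = a * (h i - h j) + (z i - z j) by rewrite /z; ring.
by ring.
Qed.

Lemma eff_cond_gt0 (w : 'I_n -> 'I_n -> R) :
  (forall i j, w i j = w j i) -> psd_simple_zero (laplacian w) ->
  0 < eff_cond (laplacian w) [set k] [set l].
Proof.
move=> wsym Lpsd.
have [h [hk hl hC hE]] := eff_cond_harmonic wsym (laplacian_block_unit wsym Lpsd).
pose v := \col_i h i.
have vE : (v^T *m laplacian w *m v) 0 0 = eff_cond (laplacian w) [set k] [set l].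
  rewrite laplacian_form// (_ : (fun i => v i 0) = h); last by apply/funext => i; rewrite mxE.
  rewrite dirichletE// (bigD1 k)//= hk mul1r -hk hE big1 ?addr0// => i ik.
  have [->|il] := eqVneq i l; first by rewrite hl mul0r.
  by rewrite hC// mulr0.
rewrite lt_def -vE Lpsd.1.2 andbT; apply/eqP => v0.
have [a va] := laplacian_simple_kernel Lpsd v0.
have /colP/(_ k) := va; have /colP/(_ l) := va; rewrite !mxE hk hl => <- /eqP.
by rewrite oner_eq0.
Qed.

Lemma mxblk_del_edge (w : 'I_n -> 'I_n -> R) :
  mxblk (laplacian w) C C = mxblk (laplacian (del_edge w k l)) C C.
Proof.
have delC i j : i \in C -> del_edge w k l i j = w i j.
  by rewrite inC /del_edge => /andP[/negbTE -> /negbTE ->].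
apply/matrixP => c d; rewrite !mxE delC ?enum_valP//; case: ifP => _//.
by apply: eq_bigr => m _; rewrite delC ?enum_valP.
Qed.

(** Conductances in parallel add: the edge [(k,l)] enters neither the block of the other nodes nor
    the coupling of [k] to them. *)
Lemma eff_cond_del_edge (w : 'I_n -> 'I_n -> R) :
  eff_cond (laplacian w) [set k] [set l] =
  eff_cond (laplacian (del_edge w k l)) [set k] [set l] + w k l.
Proof.
rewrite !eff_condE mxblk_del_edge.
have LkC (c : 'I_#|C|) : laplacian w k (enum_val c) = laplacian (del_edge w k l) k (enum_val c).
  have := enum_valP c; rewrite inC => /andP[ck cl].
  by rewrite !mxE eq_sym (negbTE ck) /del_edge (negbTE cl) andbF/= (negbTE kl).
under eq_bigr do under eq_bigr do rewrite !LkC.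
rewrite addrAC; congr (_ - _); rewrite !mxE eqxx.
rewrite (bigD1 l)/= 1?eq_sym// addrC [in RHS](bigD1 l)/= 1?eq_sym//.
rewrite {1}/del_edge !eqxx/= add0r; congr (_ + _); apply: eq_bigr => m /andP[mk ml].
by rewrite /del_edge (negbTE ml) andbF/= (negbTE kl).
Qed.

Lemma dirichlet_del_edge (w : 'I_n -> 'I_n -> R) (x : 'I_n -> R) :
  (forall i j, w i j = w j i) ->
  dirichlet w x = dirichlet (del_edge w k l) x + w k l * (x k - x l) ^+ 2.
Proof.
move=> wsym; rewrite /dirichlet.
have split_w i j : w i j * (x i - x j) ^+ 2 = del_edge w k l i j * (x i - x j) ^+ 2
   + ((i == k) && (j == l))%:R * (w k l * (x k - x l) ^+ 2)
   + ((i == l) && (j == k))%:R * (w k l * (x k - x l) ^+ 2).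
  rewrite /del_edge; case: (i =P k) => [->|_]/=.
    rewrite (negbTE kl)/= mul0r addr0 orbF; case: eqP => [->|_]; rewrite /= ?mul0r ?mul1r ?addr0 ?add0r//.
  rewrite mul0r addr0; case: (i =P l) => [->|_]/=; last by rewrite mul0r addr0.
  case: eqP => [->|_]; rewrite ?mul0r ?mul1r ?addr0 ?add0r//.
  by rewrite wsym -sqrrN opprB.
under eq_bigr do under eq_bigr do rewrite split_w.
under eq_bigr do rewrite !big_split /=; rewrite !big_split /= !mulrDr.
have dlt a b (e : R) : \sum_i \sum_j ((i == a) && (j == b))%:R * e = e.
  rewrite (bigD1 a)//= (bigD1 b)//= !eqxx mul1r big1 ?addr0.
    by rewrite big1 ?addr0// => i /negbTE ia; rewrite big1// => j _; rewrite ia mul0r.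
  by move=> j /negbTE ->; rewrite andbF mul0r.
by rewrite !dlt -addrA; congr (_ + _); field.
Qed.

Lemma del_edge_sym (w : 'I_n -> 'I_n -> R) : (forall i j, w i j = w j i) ->
  forall i j, del_edge w k l i j = del_edge w k l j i.
Proof. by move=> wsym i j; rewrite /del_edge orbC ![(j == _) && _]andbC wsym. Qed.

(** By the Dirichlet principle a negative edge value consumes at most the fraction [- w k l / c] of
    the form without the edge, where [c] is the conductance without the edge. The hypothesis keeps
    this fraction below one. *)
Lemma dirichlet_coercive_of_eff_cond (w : 'I_n -> 'I_n -> R) :
  (forall i j, w i j = w j i) -> psd_simple_zero (laplacian (del_edge w k l)) ->
  0 < eff_cond (laplacian w) [set k] [set l] ->
  exists2 mu, 0 < mu & forall x : 'I_n -> R, \sum_i x i = 0 ->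
    mu * \sum_i x i ^+ 2 <= dirichlet w x.
Proof.
move=> wsym Dpsd; have dsym := del_edge_sym wsym.
have [mu mu0 muP] := laplacian_coercive dsym Dpsd.
have c0 := eff_cond_gt0 dsym Dpsd; rewrite eff_cond_del_edge.
set c := eff_cond _ _ _ in c0 *; move=> cw.
(* The fraction of the form that survives; the minimum with 1 covers a nonnegative edge value. *)
pose q := Num.min 1 (1 + w k l / c).
have q0 : 0 < q.
  by rewrite lt_min ltr01/= -(pmulr_lgt0 _ c0) mulrDl mul1r divfK// gt_eqF.
exists (q * mu); first exact: mulr_gt0.
move=> x x0; rewrite dirichlet_del_edge// -mulrA.
apply: (le_trans (ler_wpM2l (ltW q0) (muP x x0))).
have := dirichlet_principle x dsym Dpsd; rewrite -/c.
set d := dirichlet _ _; set s := (x k - x l) ^+ 2 => csd.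
have s0 : 0 <= s by exact: sqr_ge0.
have d0 : 0 <= d by apply: le_trans csd; rewrite mulr_ge0// ltW.
have [w0|w0] := leP 0 (w k l).
  have : q * d <= d by rewrite ler_piMl// /q ge_min lexx.
  by move/le_trans; apply; rewrite lerDl mulr_ge0.
have : q * d <= (1 + w k l / c) * d by rewrite ler_wpM2r// /q ge_min lexx orbT.
move/le_trans; apply; rewrite mulrDl mul1r lerD2l.
by rewrite -mulrA ler_nM2l// ler_pdivlMl.
Qed.
End effective_resistance.

Lemma what_sym (R : realType) (n : nat) (G : delay_graph R n) i j :
  what G i j = what G j i.
Proof. by rewrite /what weight_sym delay_sym. Qed.

Lemma reff_pos_eff_cond (R : realType) (n : nat) (L : 'M[R]_n) (A B : {set 'I_n}) :
  reff_pos L A B -> 0 < eff_cond L A B.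
Proof. by rewrite /reff_pos /reff invr_gt0 => -[]. Qed.

(** Both sides say that the conductance without the edge and that of the edge have a positive sum.
    Well-definedness on the left is inherited, because the eliminated block is the same with or
    without the edge. *)
Lemma reff_posP (R : realType) (n : nat) (w : 'I_n -> 'I_n -> R) (k l : 'I_n) : k != l ->
  (forall i j, w i j = w j i) -> psd_simple_zero (laplacian (del_edge w k l)) ->
  reff_pos (laplacian w) [set k] [set l] <->
  - w k l < 1 / reff (laplacian (del_edge w k l)) [set k] [set l].
Proof.
move=> kl wsym Lpsd; rewrite /reff div1r invrK -(ltrD2r (w k l)) addNr -(eff_cond_del_edge kl).
split; first exact: reff_pos_eff_cond.
move=> c0; split; last by rewrite /reff invr_gt0.
split; last by rewrite gt_eqF.
have -> : mxblk (laplacian w) (~: ([set k] :|: [set l])) (~: ([set k] :|: [set l]))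
   = mxblk (laplacian (del_edge w k l)) (~: ([set k] :|: [set l])) (~: ([set k] :|: [set l])).
  exact: mxblk_del_edge.
by apply: laplacian_block_unit => //; exact: del_edge_sym.
Qed.

(** * Coercivity of the symbol *)

Lemma is_derive_continuous (R : realType) (f : R -> R) (x d : R) :
  is_derive x 1 f d -> {for x, continuous f}.
Proof. by move=> [df _]; apply: differentiable_continuous; exact/derivable1_diffP. Qed.

Lemma mean_value (R : realType) (f df : R -> R) (a b : R) : a <= b ->
  (forall x, a <= x <= b -> is_derive x 1 f (df x)) ->
  exists2 c, a <= c <= b & f b - f a = df c * (b - a).
Proof.
move=> ab fd; have [x|x|c cab E] := @MVT_segment R f df a b ab.
- by rewrite in_itv/= => /andP[ax xb]; apply: fd; rewrite !ltW.
- apply: continuous_in_subspaceT => y; rewrite inE/= in_itv/= => yab.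
  exact: is_derive_continuous (fd y yab).
- by exists c => //; rewrite in_itv/= in cab.
Qed.

Lemma nonincreasing_of_derive (R : realType) (f df : R -> R) (a b : R) : a <= b ->
  (forall x, a <= x <= b -> is_derive x 1 f (df x)) ->
  (forall x, a <= x <= b -> df x <= 0) -> f b <= f a.
Proof.
move=> ab fd d0; have [c cab E] := mean_value ab fd.
by rewrite -subr_le0 E mulr_le0_ge0 ?subr_ge0// d0.
Qed.

Lemma cos_lipschitz (R : realType) (x y : R) : `|cos x - cos y| <= `|x - y|.
Proof.
wlog xy : x y / y <= x.
  by move=> H; have [/H//|/ltW/H] := leP y x; rewrite distrC [leRHS]distrC.
have [c _ ->] := mean_value xy (fun z _ => is_derive_cos z).
by rewrite normrM normrN ler_piMl// ler_norml sin_geN1 sin_le1.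
Qed.

Lemma cos_le_cos (R : realType) (x y : R) : 0 <= x -> x <= y -> y <= pi -> cos y <= cos x.
Proof.
move=> x0; rewrite le_eqVlt => /predU1P[->//|xy] ypi.
by apply/ltW; rewrite ltr_cos// in_itv/= ?x0/= ?(ltW (lt_le_trans xy ypi))// ypi (le_trans x0 (ltW xy)).
Qed.

Lemma cos_norm (R : realType) (x : R) : cos `|x| = cos x.
Proof. by case: (ler0P x) => _; rewrite ?cosN. Qed.

Lemma expRN_lipschitz (R : realType) (x y : R) : 0 <= y -> y <= x -> expR (- y) - expR (- x) <= x - y.
Proof.
move=> y0 yx; have -> : - x = - y - (x - y) by ring.
rewrite expRD -[X in X - _]mulr1 -mulrBr.
have : expR (- y) <= 1 by rewrite -expR0 ler_expR oppr_le0.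
have := expR_ge1Dx (- (x - y)); have := expR_gt0 (- y).
have : expR (- (x - y)) <= 1 by rewrite -expR0 ler_expR oppr_le0 subr_ge0.
move: (expR (- y)) (expR _) => a b; nra.
Qed.

(** Inside the box: for [t < pi / 2] both factors are nonnegative and decrease up to [t]; for
    [pi / 2 <= t < pi] the cosine at [t] is not positive, so [p = 0] is worst; beyond [pi] the
    cosine may be [-1]; a negative weight is worst at the origin. Leaving the box by [e] costs at
    most [e] in each factor. *)
Lemma what_le (R : realType) (n : nat) (G : delay_graph R n) i j (p phi e : R) :
  0 <= lambda_bar G -> 0 <= e ->
  0 <= p <= delay G i j * lambda_bar G + e ->
  `|phi| <= delay G i j * lambda_bar G + e ->
  what G i j - 2 * e * `|weight G i j| <= weight G i j * expR (- p) * cos phi.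
Proof.
move=> lam0 e0 /andP[p0 pe] phie.
have expp : 0 < expR (- p) <= 1 by rewrite expR_gt0 -expR0 ler_expR oppr_le0.
have cosb : -1 <= cos phi <= 1 by rewrite cos_geN1 cos_le1.
rewrite /what; set a := weight G i j; set t := delay G i j * lambda_bar G in pe phie *.
have t0 : 0 <= t by rewrite mulr_ge0// delay_ge0.
case: ifPn => [a0|]; last first.
  rewrite -leNgt => a0; rewrite -!mulrA.
  have : expR (- p) * cos phi <= 1.
    case/andP: expp; case/andP: cosb; move: (expR _) (cos _) => E c; nra.
  have := normr_ge0 a; move: (_ * cos _) `|a| => X b; nra.
rewrite gtr0_norm//.
(* Clamping to the box: on the relevant ranges the exponential and the cosine are 1-Lipschitz, which
   gives the two losses of at most [e]. *)
pose p' := Num.min p t; pose f' := Num.min `|phi| t.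
have p't : 0 <= p' <= t by rewrite /p' le_min p0 t0 ge_min lexx orbT.
have f't : 0 <= f' <= t by rewrite /f' le_min normr_ge0 t0 ge_min lexx orbT.
have dp : expR (- p') - expR (- p) <= e.
  apply: (le_trans (expRN_lipschitz _ _)); first by case/andP: p't.
    by rewrite /p' ge_min lexx.
  by rewrite /p'; case: (leP p t) => _; [rewrite subrr|rewrite lerBlDr addrC].
have df : cos f' - cos phi <= e.
  rewrite -(cos_norm phi) (le_trans (ler_norm _))// (le_trans (cos_lipschitz _ _))//.
  rewrite distrC /f'; case: (leP `|phi| t) => [_|/ltW tf]; first by rewrite subrr normr0.
  by rewrite ger0_norm ?subr_ge0// lerBlDr addrC.
have expp' : 0 < expR (- p') <= 1.
  by rewrite expR_gt0 -expR0 ler_expR oppr_le0; case/andP: p't.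
have cosb' : -1 <= cos f' <= 1 by rewrite cos_geN1 cos_le1.
suff W : (if delay G i j == 0 then a else if t < pi / 2 then a * expR (- t) * cos t
   else if t < pi then a * cos t else - a) <= a * (expR (- p') * cos f').
  rewrite lerBlDr (le_trans W)// -mulrA (mulrC _ a) -mulrDr ler_wpM2l ?(ltW a0)//.
  have E' : expR (- p) <= expR (- p') by rewrite ler_expR lerN2 /p' ge_min lexx.
  have h1 : expR (- p) * (cos f' - cos phi) <= e.
    case/andP: expp; move: (expR (- p)) (_ - _) df => E x; nra.
  have h2 : cos f' * (expR (- p') - expR (- p)) <= e.
    case/andP: cosb'; move: E'; rewrite -subr_ge0; move: (cos f') (_ - _) dp => c x; nra.
  lra.
case/andP: p't => p'0 p't; case/andP: f't => f'0 f't.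
case: ifPn => [/eqP d0|dn0].
  have tt : t = 0 by rewrite /t d0 mul0r.
  have -> : p' = 0 by apply/eqP; rewrite eq_le p'0 -[X in _ <= X]tt p't.
  have -> : f' = 0 by apply/eqP; rewrite eq_le f'0 -[X in _ <= X]tt f't.
  by rewrite oppr0 expR0 cos0 !mulr1.
case: ifPn => [tpi|]; last rewrite -leNgt => tpi.
  rewrite -mulrA ler_pM2l//.
  have ct : 0 <= cos t.
    by apply: cos_ge0_pihalf; rewrite (ltW tpi) andbT (le_trans _ t0)// oppr_le0 divr_ge0// pi_ge0.
  have c1 : cos t <= cos f'.
    by apply: cos_le_cos => //; rewrite (le_trans (ltW tpi))// ler_pdivrMr// mulr_natr mulr2n lerDl pi_ge0.
  by apply: ler_pM => //; rewrite ?expR_ge0 ?ler_expR ?lerN2.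
case: ifPn => [tpi2|]; last rewrite -leNgt => tpi2.
  rewrite ler_pM2l//.
  have c1 : cos t <= cos f' by apply: cos_le_cos => //; exact: ltW.
  have ct : cos t <= 0 by rewrite -(cos_pihalf R) cos_le_cos ?(ltW tpi2)// divr_ge0// pi_ge0.
  move: expp' c1 ct => /andP[]; move: (cos t) (cos f') (expR _) => x y z; nra.
rewrite -mulrN1 ler_pM2l//.
move: expp' cosb' => /andP[+ + /andP[]]; move: (expR (- p')) (cos f') => x y; nra.
Qed.

(** Half-angle formula together with [sin y >= y (1 - y)]. The leading coefficient 1 matters:
    [small_angle] may lose only a factor tending to 1. *)
Lemma one_sub_cos_lower (R : realType) (x : R) : 0 <= x -> x <= 1 ->
  x ^+ 2 * (1 - x / 2) ^+ 2 <= 2 * (1 - cos x).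
Proof.
move=> x0 x1; pose y := x / 2.
have y0 : 0 <= y by rewrite divr_ge0.
have y1 : y <= 2^-1 by rewrite /y; lra.
have pi2 : 1 <= pi :> R by have := @pi_ge2 R; lra.
have [c /andP[c0 cy] E] := mean_value y0 (fun z _ => is_derive_sin z).
rewrite sin0 !subr0 in E.
have cc : 1 - y <= cos c.
  have := cos_lipschitz 0 c; rewrite cos0 sub0r normrN (ger0_norm c0) => /(le_trans (ler_norm _)).
  lra.
have -> : cos x = 1 - 2 * sin y ^+ 2.
  have -> : x = y + y by rewrite /y; lra.
  rewrite cosD -!expr2; have := cos2Dsin2 y; lra.
rewrite E /y; have -> : x ^+ 2 * (1 - x / 2) ^+ 2 = 4 * (x / 2 * (1 - x / 2)) ^+ 2 by field.
rewrite -/y; have : (y * (1 - y)) ^+ 2 <= (cos c * y) ^+ 2.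
  by rewrite ler_sqr ?nnegrE ?mulr_ge0//; [nra|lra|lra].
lra.
Qed.

(** Chord against arc: [2 (1 - cos theta)] is the squared chord of the angle [theta]. If the chord
    scaled by [H] stays below [L], the angle is of order [1 / H], where chord and arc nearly
    agree. *)
Lemma small_angle (R : realType) (L L' : R) : 0 <= L -> L < L' ->
  exists2 H0 : R, 0 < H0 & forall H theta, H0 <= H -> `|theta| <= pi ->
    2 * (1 - cos theta) * H ^+ 2 <= L ^+ 2 -> `|theta| * H <= L'.
Proof.
move=> L0 LL'; have L'0 : 0 < L' by exact: le_lt_trans LL'.
(* At the angle [x = L' / H] the terms [L' + 1] give [x < 1], and the first term gives
   [L' * (1 - x / 2) > L]. *)
exists (L' ^+ 2 / (2 * (L' - L)) + L' + 1).
  by rewrite ltr_wpDl// addr_ge0 ?(ltW L'0)// divr_ge0 ?sqr_ge0 ?mulr_ge0// subr_ge0 ltW.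
move=> H theta HH tpi; apply: contraTT; rewrite -!ltNge => L't.
have q0 : 0 <= L' ^+ 2 / (2 * (L' - L)).
  by rewrite divr_ge0 ?sqr_ge0 ?mulr_ge0// subr_ge0 ltW.
have H_gt0 : 0 < H by lra.
pose x := L' / H.
have x0 : 0 < x by rewrite divr_gt0.
have x1 : x < 1 by rewrite ltr_pdivrMr// mul1r; lra.
have xt : x < `|theta| by rewrite ltr_pdivrMr.
have c1 : cos theta <= cos x by rewrite -cos_norm cos_le_cos// ltW.
have := one_sub_cos_lower (ltW x0) (ltW x1).
have xH : x * H = L' by rewrite divfK// gt_eqF.
have half : x / 2 * L' < L' - L.
  have : L' ^+ 2 / (2 * (L' - L)) < H by lra.
  rewrite ltr_pdivrMr ?mulr_gt0 ?subr_gt0// => h.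
  rewrite -(ltr_pM2r H_gt0); rewrite mulrAC (mulrAC x) xH; lra.
move=> K; have {K} : (x ^+ 2 * (1 - x / 2) ^+ 2) * H ^+ 2 <= 2 * (1 - cos theta) * H ^+ 2.
  by rewrite ler_pM2r ?exprn_gt0//; lra.
apply: lt_le_trans; rewrite -!exprMn mulrAC xH.
by rewrite ltr_sqr ?nnegrE//; [lra|lra].
Qed.

Section pointwise.
Context (R : realType) (n : nat) (G : delay_graph R n).
Local Notation lam := (lambda_bar G).
Local Notation a := (weight G).

Section symbol.
Context (sigma theta H : R) (d : 'I_n -> 'I_n -> nat) (x y : 'I_n -> R).
Hypothesis dsym : forall i j, d i j = d j i.

Local Notation A i j := (a i j * expR (- (sigma * delay G i j))).
(* Real and imaginary parts of (sigma + H (1 - e^(i theta)) + L) (x + i y),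
   where H (1 - e^(i theta)) comes from the backward difference quotient on a
   grid of mesh 1/H and L carries the delays as phases e^(i d theta). *)
Definition symb_re := sigma + (1 - cos theta) * H.
Definition symb_im := - sin theta * H.
Local Notation cs i j := (cos ((d i j)%:R * theta)).
Local Notation sn i j := (sin ((d i j)%:R * theta)).

Definition symb_x i := symb_re * x i - symb_im * y i +
  \sum_j A i j * (cs i j * (x i - x j) - sn i j * (y i - y j)).
Definition symb_y i := symb_re * y i + symb_im * x i +
  \sum_j A i j * (cs i j * (y i - y j) + sn i j * (x i - x j)).
Local Notation V := (\sum_i (x i ^+ 2 + y i ^+ 2)).
Local Notation sq i j := ((x i - x j) ^+ 2 + (y i - y j) ^+ 2).

(* Pairs the symbol applied to u = x + i y with (mr + i mi) u.  Direction 1 is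
   used when |symb_re + i symb_im| is at most about lambda_bar, the direction of
   symb_re + i symb_im beyond. *)
Lemma symb_pairing (mr mi : R) :
  \sum_i ((mr * x i - mi * y i) * symb_x i + (mr * y i + mi * x i) * symb_y i) =
  (mr * symb_re + mi * symb_im) * V +
  2^-1 * \sum_i \sum_j A i j * (mr * cs i j + mi * sn i j) * sq i j.
Proof.
pose X i := mr * x i - mi * y i; pose Y i := mr * y i + mi * x i.
have Ac i j : A i j * cs i j = A j i * cs j i by rewrite dsym weight_sym delay_sym.
have As i j : A i j * sn i j = A j i * sn j i by rewrite dsym weight_sym delay_sym.
transitivity ((mr * symb_re + mi * symb_im) * V
   + ((\sum_i X i * \sum_j A i j * cs i j * (x i - x j)
   - \sum_i X i * \sum_j A i j * sn i j * (y i - y j))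
   + (\sum_i Y i * \sum_j A i j * cs i j * (y i - y j)
   + \sum_i Y i * \sum_j A i j * sn i j * (x i - x j)))).
  rewrite mulr_sumr -sumrB -!big_split; apply: eq_bigr => i _ /=.
  rewrite /symb_x /symb_y.
  have -> : \sum_j A i j * (cs i j * (x i - x j) - sn i j * (y i - y j)) =
     \sum_j A i j * cs i j * (x i - x j) - \sum_j A i j * sn i j * (y i - y j).
    by rewrite -sumrB; apply: eq_bigr => j _; ring.
  have -> : \sum_j A i j * (cs i j * (y i - y j) + sn i j * (x i - x j)) =
     \sum_j A i j * cs i j * (y i - y j) + \sum_j A i j * sn i j * (x i - x j).
    by rewrite -big_split; apply: eq_bigr => j _ /=; ring.
  by rewrite /X /Y; ring.
congr (_ + _); rewrite (sum_sym_form X x Ac) (sum_sym_form X y As).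
rewrite (sum_sym_form Y y Ac) (sum_sym_form Y x As) -mulrBr -!mulrDr; congr (_ * _).
rewrite -sumrB -!big_split; apply: eq_bigr => i _ /=.
rewrite -sumrB -!big_split; apply: eq_bigr => j _ /=.
by rewrite /X /Y; ring.
Qed.

(** Since [mr + i mi] has modulus one, completing the square bounds [2 c] times the pairing by
    [c^2 V] plus the squared norm of the image under the symbol; the hypothesis bounds the pairing
    below by [c V]. *)
Lemma symb_lower (mr mi c : R) : mr ^+ 2 + mi ^+ 2 = 1 -> 0 < c ->
  c * V <= (mr * symb_re + mi * symb_im) * V +
  2^-1 * \sum_i \sum_j A i j * (mr * cs i j + mi * sn i j) * sq i j ->
  c ^+ 2 * V <= \sum_i (symb_x i ^+ 2 + symb_y i ^+ 2).
Proof.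
move=> m1 c0; rewrite -symb_pairing => h.
have : 2 * c * \sum_i ((mr * x i - mi * y i) * symb_x i + (mr * y i + mi * x i) * symb_y i)
    <= c ^+ 2 * V + \sum_i (symb_x i ^+ 2 + symb_y i ^+ 2).
  rewrite !mulr_sumr -big_split; apply: ler_sum => i _ /=.
  have -> : c ^+ 2 * (x i ^+ 2 + y i ^+ 2) = c ^+ 2 * (mr ^+ 2 + mi ^+ 2) * (x i ^+ 2 + y i ^+ 2).
    by rewrite m1 mulr1.
  rewrite -subr_ge0 (_ : _ - _ = (c * (mr * x i - mi * y i) - symb_x i) ^+ 2
    + (c * (mr * y i + mi * x i) - symb_y i) ^+ 2); last by ring.
  by rewrite addr_ge0 ?sqr_ge0.
move: h; set S := \sum_i (_ + _ * symb_y i); set Q := \sum_i (symb_x i ^+ 2 + _); set v := V.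
rewrite -(ler_pM2l c0); move: (S) (Q) (v) => s q w; nra.
Qed.
End symbol.
End pointwise.

Lemma trig_cauchy_schwarz (R : realType) (p q t : R) :
  (p * cos t + q * sin t) ^+ 2 <= p ^+ 2 + q ^+ 2.
Proof.
rewrite -[leRHS]mulr1 -(cos2Dsin2 t) -subr_ge0.
by rewrite (_ : _ - _ = (p * sin t - q * cos t) ^+ 2) ?sqr_ge0//; ring.
Qed.

Lemma symbol_coercive (R : realType) (n : nat) (G : delay_graph R n) (r mu : R) :
  0 <= lambda_bar G -> 0 < r -> (forall i j, delay G i j <= r) -> 0 < mu ->
  (forall x : 'I_n -> R, \sum_i x i = 0 -> mu * \sum_i x i ^+ 2 <= dirichlet (what G) x) ->
  exists c H0 : R, [/\ 0 < c, 0 < H0 &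
    forall (sigma theta H : R) (d : 'I_n -> 'I_n -> nat) (x y : 'I_n -> R),
    0 <= sigma -> `|theta| <= pi -> H0 <= H ->
    (forall i j, d i j = d j i) -> (forall i j, (d i j)%:R <= delay G i j * H) ->
    \sum_i x i = 0 -> \sum_i y i = 0 ->
    c ^+ 2 * \sum_i (x i ^+ 2 + y i ^+ 2) <=
    \sum_i (symb_x G sigma theta H d x y i ^+ 2 + symb_y G sigma theta H d x y i ^+ 2)].
Proof.
move=> lam0 r0 delay_r mu0 coer; set lam := lambda_bar G in lam0.
(* Chosen so that the error [2 * (2 * e * r) * lam] coming from [what_le] uses at most half of [mu];
   [lam + 1] keeps the denominator positive. *)
pose e := mu / (8 * r * (lam + 1)).
have e0 : 0 < e by rewrite divr_gt0// !mulr_gt0// ltr_wpDl.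
have [H1 H1_gt0 H1P] : exists2 H0 : R, 0 < H0 & forall H theta, H0 <= H -> `|theta| <= pi ->
    2 * (1 - cos theta) * H ^+ 2 <= (lam + e) ^+ 2 -> `|theta| * H <= lam + 2 * e.
  by apply: small_angle; lra.
exists (Num.min e (mu / 2)), H1; split=> //; first by rewrite lt_min e0 divr_gt0.
set c := Num.min _ _.
have c0 : 0 < c by rewrite lt_min e0 divr_gt0.
move=> sigma theta H d x y sigma0 tpi HH dsym dH x0 y0.
have H0 : 0 < H by exact: lt_le_trans HH.
set zr := symb_re sigma theta H; set zi := symb_im theta H.
set V := \sum_i (x i ^+ 2 + y i ^+ 2).
have V0 : 0 <= V by rewrite sumr_ge0// => i _; rewrite addr_ge0 ?sqr_ge0.
have VE : V = \sum_i x i ^+ 2 + \sum_i y i ^+ 2 by rewrite /V big_split.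
have expA i j : expR (- (sigma * delay G i j)) <= 1.
  by rewrite -expR0 ler_expR oppr_le0 mulr_ge0// delay_ge0.
pose D (w : 'I_n -> 'I_n -> R) := 2^-1 * \sum_i \sum_j w i j * ((x i - x j) ^+ 2 + (y i - y j) ^+ 2).
have DE w : D w = dirichlet w x + dirichlet w y.
  rewrite /D /dirichlet -mulrDr -big_split; congr (_ * _); apply: eq_bigr => i _.
  by rewrite -big_split; apply: eq_bigr => j _ /=; rewrite mulrDr.
have Dle w w' : (forall i j, w i j <= w' i j) -> D w <= D w'.
  move=> ww; rewrite /D ler_wpM2l ?invr_ge0//; apply: ler_sum => i _; apply: ler_sum => j _.
  by rewrite ler_wpM2r ?addr_ge0 ?sqr_ge0.
have Dabs : D (fun i j => `|weight G i j|) <= lam * V.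
  by rewrite DE VE mulrDr lerD// dirichlet_le_lambda_bar.
have Dlin s w w' : D (fun i j => w i j - s * w' i j) = D w - s * D w'.
  rewrite /D mulrCA -mulrBr; congr (_ * _); rewrite mulr_sumr -sumrB; apply: eq_bigr => i _.
  by rewrite mulr_sumr -sumrB; apply: eq_bigr => j _; ring.
(* A sum of nonnegative terms, so a bound on [|z|] bounds both [sigma] and the scaled chord
   [H |1 - exp(i theta)|]. *)
have zsq : zr ^+ 2 + zi ^+ 2 = sigma ^+ 2 + 2 * sigma * (1 - cos theta) * H
    + 2 * (1 - cos theta) * H ^+ 2.
  rewrite /zr /zi /symb_re /symb_im exprMn sqrrN.
  by have -> : sin theta ^+ 2 = 1 - cos theta ^+ 2 by [have := cos2Dsin2 theta; lra]; ring.
have cosle : 0 <= 1 - cos theta by rewrite subr_ge0 cos_le1.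
(* If [|z| >= lam + e], pairing along [z / |z|] gives [|z| V] minus a delayed part of size at most
   [lam V], which leaves [e V]. *)
have [big|small] := lerP ((lam + e) ^+ 2) (zr ^+ 2 + zi ^+ 2).
  pose m := Num.sqrt (zr ^+ 2 + zi ^+ 2).
  have m_ge : lam + e <= m.
    by rewrite -[lam + e]ger0_norm -?sqrtr_sqr ?ler_wsqrtr//; lra.
  have m_gt0 : 0 < m by lra.
  have m2 : m ^+ 2 = zr ^+ 2 + zi ^+ 2 by rewrite sqr_sqrtr// addr_ge0 ?sqr_ge0.
  have m1 : (zr / m) ^+ 2 + (zi / m) ^+ 2 = 1.
    have -> : (zr / m) ^+ 2 + (zi / m) ^+ 2 = (zr ^+ 2 + zi ^+ 2) / m ^+ 2.
      by field; rewrite gt_eqF.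
    by rewrite -m2 divff// sqrf_eq0 gt_eqF.
  apply: (symb_lower dsym (mr := zr / m) (mi := zi / m)) => //.
  have -> : zr / m * zr + zi / m * zi = m.
    by apply: (mulfI (lt0r_neq0 m_gt0)); rewrite -expr2 m2; field; rewrite gt_eqF.
  apply: (@le_trans _ _ (m * V - lam * V)).
    rewrite -mulrBl ler_wpM2r// /c ge_min; apply/orP; left; lra.
  rewrite lerD2l lerNl; apply: le_trans Dabs.
  rewrite -mulrN -sumrN; under eq_bigr do rewrite -sumrN.
  rewrite [X in X <= _](_ : _ = D (fun i j => - (weight G i j * expR (- (sigma * delay G i j)) *
      (zr / m * cos ((d i j)%:R * theta) + zi / m * sin ((d i j)%:R * theta))))); last first.
    by congr (_ * _); apply: eq_bigr => i _; apply: eq_bigr => j _; rewrite mulNr.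
  apply: Dle => i j; rewrite (le_trans (ler_norm _))// normrN !normrM -[leRHS]mulr1 -mulrA.
  rewrite ler_wpM2l// mulr_ile1// ?(ger0_norm (expR_ge0 _))//.
  rewrite -(@ler_pXn2r _ 2) ?nnegrE// expr1n real_normK ?num_real// -m1.
  exact: trig_cauchy_schwarz.
(* Now [sigma] and [H |theta|] exceed [lam] by at most [2 * e], so exponents and phases leave the
   box of [what_le] by at most [2 * e * r]. *)
have {}small := ltW small.
have sig_le : sigma <= lam + e.
  rewrite -(@ler_pXn2r _ 2) ?nnegrE//; last lra.
  by apply: le_trans small; rewrite zsq -addrA lerDl addr_ge0 // !mulr_ge0 ?sqr_ge0 ?(ltW H0) //.
have th_le : `|theta| * H <= lam + 2 * e.
  by apply: H1P => //; apply: le_trans small; rewrite zsq lerDr addr_ge0 ?sqr_ge0 // !mulr_ge0 ?(ltW H0) //.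
apply: (symb_lower dsym (mr := 1) (mi := 0)) => //.
  by rewrite expr1n expr0n addr0.
rewrite mul1r mul0r addr0.
have er0 : 0 <= 2 * e * r by rewrite mulr_ge0 ?(ltW r0)// mulr_ge0 ?(ltW e0).
have small_e : 2 * (2 * e * r) * lam <= mu / 2.
  rewrite /e (_ : _ * lam = mu / 2 * (lam / (lam + 1))); last by field; lra.
  by rewrite ler_piMr ?divr_ge0 ?(ltW mu0)// ler_pdivrMr; lra.
apply: (@le_trans _ _ (mu * V - 2 * (2 * e * r) * (lam * V))).
  have : c <= mu / 2 by rewrite /c ge_min lexx orbT.
  by rewrite mulrA -mulrBl => cm; rewrite ler_wpM2r//; lra.
rewrite -[leLHS]add0r lerD//.
  rewrite mulr_ge0// /zr /symb_re addr_ge0// mulr_ge0// ltW//.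
rewrite [leRHS](_ : _ = D (fun i j => weight G i j * expR (- (sigma * delay G i j)) *
      cos ((d i j)%:R * theta))); last first.
  by congr (_ * _); apply: eq_bigr => i _; apply: eq_bigr => j _; rewrite mul1r mul0r addr0.
apply: (@le_trans _ _ (D (fun i j => what G i j - 2 * (2 * e * r) * `|weight G i j|))).
  rewrite Dlin lerB//; last by rewrite ler_wpM2l// mulr_ge0.
  by rewrite DE VE mulrDr lerD// coer.
apply: Dle => i j; apply: what_le => //.
  rewrite mulr_ge0 ?delay_ge0//= mulrC (le_trans (ler_wpM2l (delay_ge0 _ _ _) sig_le))//.
  by rewrite mulrDr lerD2l; have := delay_r i j; have := delay_ge0 G i j; nra.
rewrite normrM ger0_norm ?ler0n//.
rewrite (le_trans (ler_wpM2r (normr_ge0 _) (dH i j)))//.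
have -> : delay G i j * H * `|theta| = delay G i j * (`|theta| * H) by ring.
rewrite (le_trans (ler_wpM2l (delay_ge0 _ _ _) th_le))//.
by rewrite mulrDr lerD2l; have := delay_r i j; have := delay_ge0 G i j; nra.
Qed.

(** * Window inequality for the energy *)

Section dft.
Context (R : realType).

Lemma sin_periodN (x : R) (j : nat) : sin (x + pi *+ 2 *+ j) = sin x.
Proof.
elim: j => [|j IH]; first by rewrite mulr0n addr0.
by rewrite mulrSr addrA sinD2pi.
Qed.

(** After multiplication by [sin (al / 2)] the sum telescopes over whole periods; [0 < j < N] makes
    this factor, [sin (pi j / N)], nonzero. *)
Lemma sum_cos_period (N j : nat) (b : R) : (0 < j < N)%N ->
  \sum_(m < N) cos (b + m%:R * (2 * pi * j%:R / N%:R)) = 0.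
Proof.
move=> /andP[j0 jN]; have N0 : (0 : R) < N%:R by rewrite ltr0n (ltn_trans j0).
set al := 2 * pi * j%:R / N%:R.
have s0 : sin (al / 2) != 0.
  rewrite gt_eqF// sin_gt0_pi//; have p0 := @pi_gt0 R.
  have -> : al / 2 = pi * (j%:R / N%:R) by rewrite /al; field; rewrite gt_eqF.
  rewrite mulr_gt0 ?divr_gt0 ?ltr0n ?(ltn_trans j0 jN)//=.
  by rewrite -[ltRHS]mulr1 ltr_pM2l// ltr_pdivrMr// mul1r ltr_nat.
apply: (mulfI s0); rewrite mulr0 mulr_sumr.
pose f m := sin (b + m%:R * al - al / 2) / 2.
have fE m : sin (al / 2) * cos (b + m%:R * al) = f m.+1 - f m.
  rewrite /f -[m.+1%:R]natr1.
  have -> : b + (m%:R + 1) * al - al / 2 = (b + m%:R * al) + al / 2 by field.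
  by rewrite sinB sinD; field.
rewrite -(big_mkord xpredT (fun m => sin (al / 2) * cos (b + m%:R * al))).
under eq_bigr do rewrite fE.
rewrite telescope_sumr// /f mul0r addr0.
have -> : b + N%:R * al - al / 2 = (b - al / 2) + pi *+ 2 *+ j.
  by rewrite -[_ *+ j]mulr_natr -[_ *+ 2]mulr_natr /al; field; rewrite gt_eqF.
by rewrite sin_periodN subrr.
Qed.

(** The [N] equally spaced frequencies start at [- pi] instead of 0, because the bound on the symbol
    is stated for [|theta| <= pi]. *)
Definition dft_angle (N m : nat) : R := - pi + m%:R * (2 * pi / N%:R).

Lemma dft_angle_bound (N m : nat) : (m < N)%N -> `|dft_angle N m| <= pi.
Proof.
move=> mN; have N0 : (0 : R) < N%:R by rewrite ltr0n (leq_trans _ mN).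
have p0 := @pi_gt0 R; rewrite /dft_angle ler_norml lerDl; apply/andP; split.
  by rewrite mulr_ge0// divr_ge0// mulr_ge0// ltW.
have : m%:R / N%:R <= 1 :> R by rewrite ler_pdivrMr// mul1r ler_nat ltnW.
have -> : m%:R * (2 * pi / N%:R) = pi * 2 * (m%:R / N%:R) :> R by ring.
by move: (_ / _) => q; nra.
Qed.

Lemma dft_orthogonality (N k l : nat) : (k < N)%N -> (l < N)%N ->
  \sum_(m < N) cos ((k%:R - l%:R) * dft_angle N m) = if k == l then N%:R else 0.
Proof.
wlog lk : k l / (l <= k)%N.
  move=> H kN lN; have [lk|kl] := leqP l k; first exact: H.
  rewrite eq_sym -H ?(ltnW kl)//; apply: eq_bigr => m _.
  by rewrite -cosN; congr cos; ring.
move=> kN lN; case: eqP => [->|/eqP kl].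
  under eq_bigr do rewrite subrr mul0r cos0.
  by rewrite sumr_const card_ord.
rewrite -natrB//; under eq_bigr do rewrite /dft_angle mulrDr.
have := @sum_cos_period N (k - l) ((k - l)%:R * - pi).
rewrite subn_gt0 ltn_neqAle eq_sym kl lk (leq_ltn_trans (leq_subr _ _) kN) => /(_ isT) E; rewrite -[RHS]E.
by apply: eq_bigr => m _; congr cos; ring.
Qed.

(** Real part, and below it the imaginary part, of the transform with kernel [exp(i k t)]. With this
    sign a shift by [d] becomes multiplication by [exp(i d t)], the phase used in the symbol. *)
Definition cos_transf (N : nat) (f : nat -> R) (t : R) := \sum_(k < N) f k * cos (k%:R * t).
Definition sin_transf (N : nat) (f : nat -> R) (t : R) := \sum_(k < N) f k * sin (k%:R * t).

Lemma dft_parseval (N : nat) (f : nat -> R) :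
  \sum_(m < N) (cos_transf N f (dft_angle N m) ^+ 2 + sin_transf N f (dft_angle N m) ^+ 2)
  = N%:R * \sum_(k < N) f k ^+ 2.
Proof.
have E m : cos_transf N f (dft_angle N m) ^+ 2 + sin_transf N f (dft_angle N m) ^+ 2
   = \sum_(k < N) \sum_(l < N) f k * f l * cos ((k%:R - l%:R) * dft_angle N m).
  rewrite !expr2 /cos_transf /sin_transf !mulr_suml -big_split; apply: eq_bigr => k _ /=.
  rewrite !mulr_sumr -big_split; apply: eq_bigr => l _ /=.
  by rewrite mulrBl cosB; ring.
under eq_bigr do rewrite E.
rewrite exchange_big mulr_sumr; apply: eq_bigr => k _ /=.
rewrite exchange_big (bigD1 k)//= [X in _ + X]big1 ?addr0.
  by rewrite -mulr_sumr dft_orthogonality// eqxx mulrC expr2.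
move=> l lk; rewrite -mulr_sumr dft_orthogonality// ifN ?mulr0//.
by rewrite eq_sym.
Qed.

(** Zeros in the last [d] places keep the shift from pushing anything off the grid; [f 0 = 0] makes
    the truncated subtraction harmless for [k < d]. *)
Lemma transf_shift (N d : nat) (f : nat -> R) (g : R -> R) (t : R) : (d <= N)%N ->
  f 0%N = 0 -> (forall k, (N - d <= k)%N -> f k = 0) ->
  \sum_(k < N) f (k - d)%N * g (k%:R * t) = \sum_(k < N) f k * g ((k + d)%:R * t).
Proof.
move=> dN f0 fN.
rewrite -(big_mkord xpredT (fun k => f (k - d)%N * g (k%:R * t))).
rewrite -(big_mkord xpredT (fun k => f k * g ((k + d)%:R * t))).
rewrite (big_cat_nat _ (n := d))//= [X in X + _]big_nat_cond big1 ?add0r; last first.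
  by move=> k /andP[/andP[_ kd] _]; rewrite (eqP (ltnW kd : (k - d)%N == 0%N)) f0 mul0r.
rewrite [RHS](big_cat_nat _ (n := (N - d)%N)) ?leq_subr//=.
rewrite [X in _ = _ + X]big_nat_cond [X in _ = _ + X]big1 ?addr0; last first.
  by move=> k /andP[/andP[kN _] _]; rewrite fN// mul0r.
rewrite -{1}[d]add0n big_addn; apply: eq_bigr => k _.
by rewrite addnK.
Qed.

Lemma cos_transf_shift (N d : nat) (f : nat -> R) (t : R) : (d <= N)%N ->
  f 0%N = 0 -> (forall k, (N - d <= k)%N -> f k = 0) ->
  cos_transf N (fun k => f (k - d)%N) t =
  cos (d%:R * t) * cos_transf N f t - sin (d%:R * t) * sin_transf N f t.
Proof.
move=> dN f0 fN; rewrite /cos_transf transf_shift// /sin_transf !mulr_sumr -sumrB.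
by apply: eq_bigr => k _; rewrite natrD mulrDl cosD; ring.
Qed.

Lemma sin_transf_shift (N d : nat) (f : nat -> R) (t : R) : (d <= N)%N ->
  f 0%N = 0 -> (forall k, (N - d <= k)%N -> f k = 0) ->
  sin_transf N (fun k => f (k - d)%N) t =
  cos (d%:R * t) * sin_transf N f t + sin (d%:R * t) * cos_transf N f t.
Proof.
move=> dN f0 fN; rewrite /sin_transf transf_shift// /cos_transf !mulr_sumr -big_split.
by apply: eq_bigr => k _ /=; rewrite natrD mulrDl sinD; ring.
Qed.
End dft.

(** * Discretized delay operator *)

Section grid.
Context (R : realType) (n : nat) (G : delay_graph R n).

(* k - 1 and k - d i j are truncated at 0; this is harmless because the
   operator is summed only for sequences vanishing at the start of the grid. *)
Definition grid_op (sigma H : R) (d : 'I_n -> 'I_n -> nat) (f : 'I_n -> nat -> R) i k :=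
  H * (f i k - f i (k - 1)%N) + sigma * f i k -
  \sum_j weight G i j * expR (- (sigma * delay G i j)) *
     (f j (k - d i j)%N - f i (k - d i j)%N).

Lemma grid_op_transf (g : R -> R) sigma H d f i N (t : R) :
  \sum_(k < N) grid_op sigma H d f i k * g (k%:R * t) =
  H * (\sum_(k < N) f i k * g (k%:R * t) - \sum_(k < N) f i (k - 1)%N * g (k%:R * t))
  + sigma * \sum_(k < N) f i k * g (k%:R * t) -
  \sum_j weight G i j * expR (- (sigma * delay G i j)) *
     (\sum_(k < N) f j (k - d i j)%N * g (k%:R * t)
      - \sum_(k < N) f i (k - d i j)%N * g (k%:R * t)).
Proof.
under [X in _ = _ - X]eq_bigr do rewrite -sumrB mulr_sumr.
rewrite [X in _ = _ - X]exchange_big -sumrB !mulr_sumr -big_split -sumrB /=.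
apply: eq_bigr => k _; rewrite /grid_op mulrBl mulr_suml; congr (_ - _); first by ring.
by apply: eq_bigr => j _; ring.
Qed.

(** Parseval turns the bound at each frequency into one on the grid. Support below [M] leaves a
    margin at the end of the grid, so shifts are exact and the transform of [grid_op] is the symbol
    applied to the transform; mean zero is inherited by linearity. *)
Lemma grid_coercive (r mu : R) :
  0 <= lambda_bar G -> 0 < r -> (forall i j, delay G i j <= r) -> 0 < mu ->
  (forall x : 'I_n -> R, \sum_i x i = 0 -> mu * \sum_i x i ^+ 2 <= dirichlet (what G) x) ->
  exists c H0 : R, [/\ 0 < c, 0 < H0 &
    forall (sigma H : R) (d : 'I_n -> 'I_n -> nat) (f : 'I_n -> nat -> R) (M N : nat),
    0 <= sigma -> H0 <= H ->
    (forall i j, d i j = d j i) -> (forall i j, (d i j)%:R <= delay G i j * H) ->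
    (forall i j, (M + d i j <= N)%N) -> (M + 1 <= N)%N ->
    (forall i, f i 0%N = 0) -> (forall i k, (M <= k)%N -> f i k = 0) ->
    (forall k, \sum_i f i k = 0) ->
    c * \sum_(k < N) \sum_i f i k ^+ 2 <=
    \sum_(k < N) \sum_i grid_op sigma H d f i k ^+ 2].
Proof.
move=> lam0 r0 delay_r mu0 coer.
have [c [H0 [c0 H0_gt0 cP]]] := symbol_coercive lam0 r0 delay_r mu0 coer.
exists (c ^+ 2), H0; split=> //; first by rewrite exprn_gt0.
move=> sigma H d f M N sigma0 HH dsym dH MN MN1 f0 fM fsum.
have N0 : (0 : R) < N%:R by rewrite ltr0n (leq_trans _ MN1)// addn1.
have shift_ok (e : nat) i k : (M + e <= N)%N -> (N - e <= k)%N -> f i k = 0.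
  move=> Me Nk; apply: fM; rewrite (leq_trans _ Nk)//; lia.
have le_N (e : nat) : (M + e <= N)%N -> (e <= N)%N by lia.
rewrite -(ler_pM2l N0) mulrCA.
have E (h : 'I_n -> nat -> R) : N%:R * \sum_(k < N) \sum_i h i k ^+ 2 = \sum_(m < N) \sum_i
   (cos_transf N (h i) (dft_angle R N m) ^+ 2 + sin_transf N (h i) (dft_angle R N m) ^+ 2).
  rewrite exchange_big mulr_sumr [RHS]exchange_big; apply: eq_bigr => i _ /=.
  by rewrite dft_parseval.
rewrite !E mulr_sumr; apply: ler_sum => m _; set t := dft_angle R N m.
have tsum (g : R -> R) : \sum_i \sum_(k < N) f i k * g (k%:R * t) = 0.
  by rewrite exchange_big big1// => k _; rewrite -mulr_suml fsum mul0r.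
have := cP sigma t H d (fun i => cos_transf N (f i) t) (fun i => sin_transf N (f i) t)
   sigma0 (dft_angle_bound R (ltn_ord m)) HH dsym dH (tsum cos) (tsum sin).
move/le_trans; apply; rewrite le_eqVlt; apply/orP; left; apply/eqP.
have shiftC e i : (M + e <= N)%N -> \sum_(k < N) f i (k - e)%N * cos (k%:R * t) =
    cos (e%:R * t) * cos_transf N (f i) t - sin (e%:R * t) * sin_transf N (f i) t.
  by move=> eN; apply: cos_transf_shift => [|//|k]; [exact: le_N|exact: shift_ok].
have shiftS e i : (M + e <= N)%N -> \sum_(k < N) f i (k - e)%N * sin (k%:R * t) =
    cos (e%:R * t) * sin_transf N (f i) t + sin (e%:R * t) * cos_transf N (f i) t.
  by move=> eN; apply: sin_transf_shift => [|//|k]; [exact: le_N|exact: shift_ok].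
apply: eq_bigr => i _; congr (_ ^+ 2 + _ ^+ 2).
  rewrite /symb_x [RHS](grid_op_transf cos) -/(cos_transf N (f i) t) (shiftC 1%N)//.
  under [in RHS]eq_bigr do rewrite !shiftC//.
  rewrite mul1r -sumrN; congr (_ + _); first by rewrite /symb_re /symb_im; ring.
  by apply: eq_bigr => j _; ring.
rewrite /symb_y [RHS](grid_op_transf sin) -/(sin_transf N (f i) t) (shiftS 1%N)//.
under [in RHS]eq_bigr do rewrite !shiftS//.
rewrite mul1r -sumrN; congr (_ + _); first by rewrite /symb_re /symb_im; ring.
by apply: eq_bigr => j _; ring.
Qed.
End grid.

(** * Cutoffs, window sums and Riemann sums *)

Section cutoff.
Context (R : realType).

(** A trapezoid with ramps of slope 1 and -1: the unit slope keeps difference quotients of the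
    cutoff at most 1 on every grid. *)
Definition cutoff (a b t : R) : R := Num.max 0 (Num.min 1 (Num.min (t - a) (b - t))).

Lemma cutoff_bound a b t : 0 <= cutoff a b t <= 1.
Proof. by rewrite /cutoff le_max lexx/= ge_max ler01 ge_min lexx. Qed.

Lemma cutoff_left a b t : t <= a -> cutoff a b t = 0.
Proof.
rewrite /cutoff; case: (leP (t - a) (b - t)) => ?; case: (leP 1 _) => ?; case: (leP 0 _) => ?; lra.
Qed.

Lemma cutoff_right a b t : b <= t -> cutoff a b t = 0.
Proof.
rewrite /cutoff; case: (leP (t - a) (b - t)) => ?; case: (leP 1 _) => ?; case: (leP 0 _) => ?; lra.
Qed.

Lemma cutoff_mid a b t : a + 1 <= t -> t <= b - 1 -> cutoff a b t = 1.
Proof.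
rewrite /cutoff; case: (leP (t - a) (b - t)) => ?; case: (leP 1 _) => ?; case: (leP 0 _) => ?; lra.
Qed.

Lemma cutoff_lipschitz a b s t : `|cutoff a b s - cutoff a b t| <= `|s - t|.
Proof.
have maxl (x y x' y' d : R) : `|x - x'| <= d -> `|y - y'| <= d ->
    `|Num.max x y - Num.max x' y'| <= d.
  by rewrite !ler_norml => /andP[? ?] /andP[? ?]; case: (leP x y) => ?; case: (leP x' y') => ?; lra.
have minl (x y x' y' d : R) : `|x - x'| <= d -> `|y - y'| <= d ->
    `|Num.min x y - Num.min x' y'| <= d.
  by rewrite !ler_norml => /andP[? ?] /andP[? ?]; case: (leP x y) => ?; case: (leP x' y') => ?; lra.
have E : `|(s - a) - (t - a)| <= `|s - t| by rewrite (_ : _ - _ = s - t)//; ring.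
have E' : `|(b - s) - (b - t)| <= `|s - t| by rewrite distrC (_ : _ - _ = s - t)//; ring.
apply: maxl; first by rewrite subrr normr0.
by apply: (minl) (minl _ _ _ _ _ E E'); rewrite subrr normr0.
Qed.
End cutoff.

Lemma sum_nat_widen (R : realDomainType) (p q p' q' : nat) (u : nat -> R) :
  (p' <= p)%N -> (q <= q')%N -> (forall k, 0 <= u k) ->
  \sum_(p <= k < q) u k <= \sum_(p' <= k < q') u k.
Proof.
move=> pp qq u0; have [qp|pq] := leqP q p; first by rewrite big_geq// sumr_ge0.
have pq' : (p <= q')%N by lia.
rewrite (big_cat_nat pp pq')/=.
rewrite ler_wpDl ?sumr_ge0// (big_cat_nat (ltnW pq) qq)/=.
by rewrite lerDl sumr_ge0.
Qed.

Lemma sum_nat_shift_le (R : realDomainType) (p q p' q' d : nat) (u : nat -> R) :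
  (p' + d <= p)%N -> (q <= q')%N -> (forall k, 0 <= u k) ->
  \sum_(p <= k < q) u (k - d)%N <= \sum_(p' <= k < q') u k.
Proof.
move=> pp qq u0; rewrite -(subnK (leq_trans (leq_addl _ _) pp)) big_addn.
under eq_bigr do rewrite addnK.
by apply: sum_nat_widen => //; lia.
Qed.

Lemma sqr_sum_le (R : realFieldType) (n : nat) (u : 'I_n -> R) :
  (\sum_i u i) ^+ 2 <= n%:R * \sum_i u i ^+ 2.
Proof.
have -> : n%:R * \sum_i u i ^+ 2 = \sum_i \sum_j 2^-1 * (u i ^+ 2 + u j ^+ 2).
  have -> : \sum_i \sum_j 2^-1 * (u i ^+ 2 + u j ^+ 2) =
     \sum_i (2^-1 * (n%:R * u i ^+ 2) + 2^-1 * \sum_j u j ^+ 2).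
    apply: eq_bigr => i _; rewrite -mulr_sumr big_split /= sumr_const card_ord mulrDr.
    by rewrite -[_ *+ n]mulr_natl.
  by rewrite big_split /= sumr_const card_ord -!mulr_sumr -[_ *+ n]mulr_natl; field.
rewrite expr2 mulr_suml; apply: ler_sum => i _; rewrite mulr_sumr; apply: ler_sum => j _.
by have := sqr_ge0 (u i - u j); lra.
Qed.

(** Right endpoints are used because the Taylor bound expands at the later time; each of the [q - p]
    cells costs [K / m^2]. *)
Lemma riemann_sum_error (R : realType) (F E : R -> R) (K B : R) (m p q : nat) :
  (0 < m)%N -> (p <= q)%N -> q%:R / m%:R <= B ->
  (forall s t, 0 <= s -> s <= t -> t <= B ->
     `|F t - F s - (t - s) * E t| <= K * (t - s) ^+ 2) ->
  `|F (q%:R / m%:R) - F (p%:R / m%:R) - (\sum_(p.+1 <= k < q.+1) E (k%:R / m%:R)) / m%:R|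
    <= K * (q - p)%:R / m%:R ^+ 2.
Proof.
move=> m0 pq qB FE; have m_gt0 : (0 : R) < m%:R by rewrite ltr0n.
have -> : \sum_(p.+1 <= k < q.+1) E (k%:R / m%:R) = \sum_(p <= k < q) E (k.+1%:R / m%:R).
  by rewrite big_add1.
rewrite -(telescope_sumr (fun k => F (k%:R / m%:R)) pq) mulr_suml -sumrB.
rewrite (le_trans (ler_norm_sum _ _ _))//.
have -> : K * (q - p)%:R / m%:R ^+ 2 = \sum_(p <= k < q) K / m%:R ^+ 2.
  by rewrite sumr_const_nat -mulr_natr; ring.
rewrite big_nat_cond [leRHS]big_nat_cond; apply: ler_sum => k /andP[/andP[pk kq] _].
have := FE (k%:R / m%:R) (k.+1%:R / m%:R).
have dE : k.+1%:R / m%:R - k%:R / m%:R = m%:R^-1 :> R by rewrite -natr1; ring.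
rewrite dE exprVn (mulrC _ (E _)); apply.
- by rewrite divr_ge0.
- by rewrite ler_pM2r ?invr_gt0// ler_nat.
- by rewrite (le_trans _ qB)// ler_pM2r ?invr_gt0// ler_nat.
Qed.

Section energy.
Context (R : realType) (n : nat) (G : delay_graph R n).

(** The derivative of [exp(- sigma t) x] when [x] solves the delay equation; the factor
    [expR (- (sigma * delay G i j))] is the damping accumulated over the delay. *)
Definition damped_rhs (sigma : R) (Y : 'I_n -> R -> R) i t :=
  - sigma * Y i t + \sum_j weight G i j * expR (- (sigma * delay G i j)) *
     (Y j (t - delay G i j) - Y i (t - delay G i j)).

Lemma expR_delay_le1 (sigma : R) i j : 0 <= sigma -> expR (- (sigma * delay G i j)) <= 1.
Proof. by move=> s0; rewrite -expR0 ler_expR oppr_le0 mulr_ge0// delay_ge0. Qed.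

(** Leibniz rule with a commutator that vanishes wherever the cutoff is constant over the preceding
    delays; this confines the error to the ends of the window. *)
Lemma grid_op_mul sigma H d (chi : nat -> R) (y : 'I_n -> nat -> R) i k :
  grid_op G sigma H d (fun i k => chi k * y i k) i k =
  chi k * grid_op G sigma H d y i k +
  (H * (chi k - chi (k - 1)%N) * y i (k - 1)%N +
   \sum_j weight G i j * expR (- (sigma * delay G i j)) *
     (chi k - chi (k - d i j)%N) * (y j (k - d i j)%N - y i (k - d i j)%N)).
Proof.
rewrite /grid_op [chi k * (_ - _)]mulrBr [chi k * (\sum__ _)]mulr_sumr.
have -> : \sum_j weight G i j * expR (- (sigma * delay G i j)) *
     (chi k - chi (k - d i j)%N) * (y j (k - d i j)%N - y i (k - d i j)%N) =
  \sum_j chi k * (weight G i j * expR (- (sigma * delay G i j)) *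
      (y j (k - d i j)%N - y i (k - d i j)%N)) -
  \sum_j weight G i j * expR (- (sigma * delay G i j)) *
     (chi (k - d i j)%N * y j (k - d i j)%N - chi (k - d i j)%N * y i (k - d i j)%N).
  by rewrite -sumrB; apply: eq_bigr => j _; ring.
by ring.
Qed.

Lemma commutator_bound sigma H d (chi : nat -> R) (y : 'I_n -> nat -> R) k :
  0 <= sigma -> (forall k, 0 <= chi k <= 1) -> `|H * (chi k - chi (k - 1)%N)| <= 1 ->
  \sum_i (H * (chi k - chi (k - 1)%N) * y i (k - 1)%N +
   \sum_j weight G i j * expR (- (sigma * delay G i j)) *
     (chi k - chi (k - d i j)%N) * (y j (k - d i j)%N - y i (k - d i j)%N)) ^+ 2 <=
  2 * \sum_i y i (k - 1)%N ^+ 2 + 8 * n%:R *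
    \sum_i \sum_j weight G i j ^+ 2 * \sum_l y l (k - d i j)%N ^+ 2.
Proof.
move=> sigma0 chi01 Hchi.
rewrite !mulr_sumr -big_split; apply: ler_sum => i _ /=.
set p := H * _ * _; set q := \sum_j _.
have pq : (p + q) ^+ 2 <= 2 * p ^+ 2 + 2 * q ^+ 2 by have := sqr_ge0 (p - q); lra.
apply: (le_trans pq); apply: lerD.
  rewrite ler_pM2l// /p exprMn ler_piMl ?sqr_ge0//.
  by rewrite -real_normK ?num_real// expr_le1.
(* The 2 comes from splitting the square, [n] from Cauchy-Schwarz over [j], and the 4 from
   [(u - v)^2 <= 2 u^2 + 2 v^2], each square being at most the full energy. *)
rewrite -[8](_ : 2 * 4 = 8 :> R); last by ring.
rewrite -!mulrA ler_pM2l// (le_trans (sqr_sum_le _))// mulrCA ler_wpM2l//.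
rewrite mulr_sumr; apply: ler_sum => j _.
set e := \sum_l _; have le_e l : y l (k - d i j)%N ^+ 2 <= e.
  by rewrite /e (bigD1 l)//= lerDl sumr_ge0// => ? _; rewrite sqr_ge0.
set c := chi k - _; set dy := _ - _.
have -> : (weight G i j * expR (- (sigma * delay G i j)) * c * dy) ^+ 2 =
  weight G i j ^+ 2 * ((expR (- (sigma * delay G i j)) * c) ^+ 2 * dy ^+ 2) by ring.
rewrite [leRHS]mulrCA ler_wpM2l ?sqr_ge0//.
have c1 : (expR (- (sigma * delay G i j)) * c) ^+ 2 <= 1.
  rewrite -real_normK ?num_real// expr_le1// normrM mulr_ile1//.
    by rewrite ger0_norm ?expR_ge0 ?expR_delay_le1.
  have := chi01 k; have := chi01 (k - d i j)%N.
  by rewrite /c ler_norml => /andP[? ?] /andP[? ?]; lra.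
rewrite (le_trans (ler_wpM2r (sqr_ge0 _) c1))// mul1r.
have := le_e i; have := le_e j; have := sqr_ge0 (y j (k - d i j)%N + y i (k - d i j)%N).
rewrite /dy; move: (y j _) (y i _) => u v; lra.
Qed.

(** Two errors of order [1 / m]: the backward difference, whose Taylor error [K / m^2] is multiplied
    by [m], and the rounding of delays to the mesh, which moves the argument of two Lipschitz terms
    by at most [1 / m]. *)
Lemma grid_op_consistent (r sigma K B : R) (Y : 'I_n -> R -> R) (m : nat)
    (d : 'I_n -> 'I_n -> nat) i k :
  0 <= sigma -> 0 <= K -> (0 < m)%N -> (forall i j, delay G i j <= r) ->
  (forall s t, 0 <= s -> s <= t -> t <= B -> forall i, `|Y i t - Y i s| <= K * (t - s) /\
     (r <= s -> `|Y i t - Y i s - (t - s) * damped_rhs sigma Y i t| <= K * (t - s) ^+ 2)) ->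
  (forall i j, (d i j)%:R <= delay G i j * m%:R < (d i j).+1%:R) ->
  r * m%:R <= k%:R - 1 -> k%:R <= B * m%:R ->
  `|grid_op G sigma m%:R d (fun i k => Y i (k%:R / m%:R)) i k| <=
  (K + \sum_i \sum_j `|weight G i j| * (2 * K)) / m%:R.
Proof.
move=> sigma0 K0 m0 delay_r YK dm rk kB.
have mp : (0 : R) < m%:R by rewrite ltr0n.
pose t : R := k%:R / m%:R; pose s : R := (k - 1)%N%:R / m%:R.
have r0 : 0 <= r by apply: le_trans (delay_r i i); exact: delay_ge0.
have k1 : (1 <= k)%N.
  by rewrite -(ler_nat R); have := mulr_ge0 r0 (ltW mp); lra.
have ts : t - s = m%:R^-1 by rewrite /t /s natrB//; field; rewrite gt_eqF.
have st : s <= t by rewrite -subr_ge0 ts invr_ge0 ltW.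
have rs : r <= s by rewrite ler_pdivlMr// natrB.
have s0 : 0 <= s by exact: le_trans rs.
have tB : t <= B by rewrite ler_pdivrMr.
have Ylip u v l : 0 <= u -> u <= B -> 0 <= v -> v <= B -> `|Y l u - Y l v| <= K * `|u - v|.
  move=> u0 uB v0 vB; have [uv|/ltW vu] := leP u v.
    by rewrite distrC [`|u - v|]distrC [in leRHS]ger0_norm ?subr_ge0//; apply: (YK _ _ u0 uv vB l).1.
  by rewrite [in leRHS]ger0_norm ?subr_ge0//; apply: (YK _ _ v0 vu uB l).1.
pose A j := weight G i j * expR (- (sigma * delay G i j)).
pose D j u := Y j u - Y i u.
have -> : grid_op G sigma m%:R d (fun i k => Y i (k%:R / m%:R)) i k =
   m%:R * (Y i t - Y i s - (t - s) * damped_rhs sigma Y i t) +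
   \sum_j A j * (D j (t - delay G i j) - D j ((k - d i j)%N%:R / m%:R)).
  have -> : \sum_j A j * (D j (t - delay G i j) - D j ((k - d i j)%N%:R / m%:R)) =
     \sum_j A j * D j (t - delay G i j) - \sum_j A j * D j ((k - d i j)%N%:R / m%:R).
    by rewrite -sumrB; apply: eq_bigr => j _; rewrite mulrBr.
  rewrite /grid_op /damped_rhs -/t -/s ts; set S1 := \sum_j _; set S2 := \sum_j _.
  by field; rewrite gt_eqF.
rewrite (le_trans (ler_normD _ _))// [leRHS]mulrDl lerD//.
  rewrite normrM (ger0_norm (ltW mp)) mulrC -ler_pdivlMr//.
  apply: (le_trans ((YK _ _ s0 st tB i).2 rs)); rewrite ts.
  by rewrite le_eqVlt; apply/orP; left; apply/eqP; field; rewrite gt_eqF.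
rewrite (le_trans (ler_norm_sum _ _ _))// [X in _ <= X / _](bigD1 i)//= [leRHS]mulrDl ler_wpDr//.
  rewrite mulr_ge0 ?invr_ge0 ?(ltW mp)// sumr_ge0// => a _.
  by rewrite sumr_ge0// => b _; rewrite mulr_ge0 ?mulr_ge0.
rewrite mulr_suml; apply: ler_sum => j _.
rewrite normrM -mulrA ler_pM//.
  by rewrite normrM (ger0_norm (expR_ge0 _)) ler_piMr// expR_delay_le1.
have dk : (d i j <= k)%N.
  rewrite -(ler_nat R); have /andP[dle _] := dm i j.
  by apply: (le_trans dle); have := ler_wpM2r (ltW mp) (delay_r i j); lra.
set u := t - delay G i j; set v := _ / m%:R.
have u0 : 0 <= u by rewrite subr_ge0 (le_trans (delay_r i j))// (le_trans rs).
have uB : u <= B by rewrite (le_trans _ tB)// gerBl delay_ge0.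
have v0 : 0 <= v by rewrite divr_ge0.
have uv : `|u - v| <= m%:R^-1.
  have -> : u - v = ((d i j)%:R - delay G i j * m%:R) / m%:R.
    by rewrite /u /v /t natrB//; field; rewrite gt_eqF.
  rewrite normrM [`|_^-1|]ger0_norm ?invr_ge0 ?(ltW mp)// ler_piMl ?invr_ge0 ?(ltW mp)//.
  by have := dm i j; rewrite -natr1 ler_norml => /andP[? ?]; lra.
have vB : v <= B.
  by rewrite (le_trans _ tB)// ler_pM2r ?invr_gt0// ler_nat leq_subr.
have -> : D j u - D j v = (Y j u - Y j v) - (Y i u - Y i v) by rewrite /D; ring.
rewrite (le_trans (ler_normB _ _))//.
have -> : 2 * K / m%:R = K / m%:R + K / m%:R by ring.
by apply: lerD; rewrite (le_trans (Ylip _ _ _ u0 uB v0 vB))// ler_wpM2l.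
Qed.
End energy.

Lemma riemann_sum_nat (R : realType) (F E : R -> R) (K : R) (m p q b : nat) :
  (0 < m)%N -> (p <= q)%N -> (q <= b)%N -> 0 <= K ->
  (forall s t, 0 <= s -> s <= t -> t <= b%:R ->
     `|F t - F s - (t - s) * E t| <= K * (t - s) ^+ 2) ->
  `|F q%:R - F p%:R - (\sum_((p * m).+1 <= k < (q * m).+1) E (k%:R / m%:R)) / m%:R|
    <= K * b%:R / m%:R.
Proof.
move=> m0 pq qb K0 FE; have mp : (0 : R) < m%:R by rewrite ltr0n.
have quo (a : nat) : (a * m)%:R / m%:R = a%:R :> R by rewrite natrM mulfK// gt_eqF.
have := @riemann_sum_error R F E K b%:R m (p * m) (q * m) m0.
rewrite !quo leq_mul2r pq orbT ler_nat qb => /(_ isT isT FE) /le_trans; apply.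
rewrite -mulnBl natrM -!mulrA ler_wpM2l//.
rewrite (_ : m%:R * _ = m%:R^-1); last by field; rewrite gt_eqF.
by rewrite ler_pM2r ?invr_gt0// ler_nat (leq_trans (leq_subr _ _)).
Qed.

Lemma le_of_le_add_inv (R : realType) (a b K : R) (m0 : nat) :
  (forall m, (m0 <= m)%N -> (0 < m)%N -> a <= b + K / m%:R) -> a <= b.
Proof.
move=> H; rewrite leNgt; apply/negP => ba.
have [N KN] : exists N : nat, K / (a - b) < N%:R.
  by exists (Num.truncn `|K / (a - b)|).+1; rewrite (le_lt_trans (ler_norm _))// truncnS_gt.
pose m := (N + m0).+1.
have m_gt0 : (0 : R) < m%:R by rewrite ltr0n.
have := H m (leqW (leq_addl _ _)) isT.
have NK : K / (a - b) < m%:R by rewrite (lt_le_trans KN)// ler_nat /m; lia.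
rewrite -lerBlDl leNgt ltr_pdivrMr// mulrC -ltr_pdivrMr ?subr_gt0//.
by rewrite NK.
Qed.

(** The cutoff varies on [[r, r + 1]] and [[T, T + 1]]; delays up to [r] spread the commutator to
    [[r, 2 r + 1]] and [[T, T + 1 + r]]. It looks back by up to [r], which produces the two windows
    of the conclusion. *)
Lemma window_sum_le (R : realFieldType) (r m T : nat) (gs W e : nat -> R) (delta Gam : R) :
  (0 < m)%N -> (0 < r)%N -> (2 * r + 1 <= T)%N -> (forall k, 0 <= e k) ->
  (forall k, (k < (T + 1 + r) * m)%N -> gs k <= delta + W k) ->
  (forall k, (k < (T + 1 + r) * m)%N ->
     (k <= r * m)%N || (((2 * r + 1) * m < k) && (k <= T * m))%N -> gs k <= delta) ->
  (forall p q p' q', (p' + r * m <= p)%N -> (q <= q')%N ->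
     \sum_(p <= k < q) W k <= Gam * \sum_(p' <= k < q') e k) ->
  0 <= Gam ->
  \sum_(k < (T + 1 + r) * m) gs k <= ((T + 1 + r) * m)%:R * delta + Gam *
    (\sum_((0 * m).+1 <= k < ((2 * r + 1) * m).+1) e k
     + \sum_(((T - r) * m).+1 <= k < ((T + 1 + r) * m).+1) e k).
Proof.
move=> m0 r0 rT e0 gsW gs_small WS Gam0.
set N := ((T + 1 + r) * m)%N; pose p1 := (r * m).+1; pose p2 := ((2 * r + 1) * m).+1.
pose p3 := (T * m).+1.
have p12 : (p1 <= p2)%N by rewrite /p1 /p2; lia.
have p23 : (p2 <= p3)%N by rewrite /p2 /p3 ltnS leq_mul2r rT orbT.
have p3N : (p3 <= N)%N by rewrite /p3 /N; nia.
pose U k := if (p1 <= k < p2)%N || (p3 <= k)%N then W k else 0.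
have gsU k : (k < N)%N -> gs k <= delta + U k.
  move=> kN; rewrite /U; case: ifPn => [_|out]; first exact: gsW.
  rewrite addr0; apply: gs_small => //; move: out; rewrite /p1 /p2 /p3; lia.
apply: (@le_trans _ _ (\sum_(k < N) (delta + U k))).
  by apply: ler_sum => k _; exact: gsU.
rewrite big_split /= sumr_const card_ord -[delta *+ _]mulr_natl lerD2l.
rewrite -(big_mkord xpredT U).
rewrite (big_cat_nat (leq0n p1) (leq_trans p12 (leq_trans p23 p3N)))/=.
rewrite (big_cat_nat p12 (leq_trans p23 p3N))/= (big_cat_nat p23 p3N)/=.
have zero a b : (b <= p1)%N || (p2 <= a)%N && (b <= p3)%N -> \sum_(a <= k < b) U k = 0.
  move=> ab; rewrite big_nat_cond big1// => k /andP[/andP[ak kb] _]; rewrite /U ifF//.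
  by apply/negbTE; move: ab ak kb; clear -p12 p23; lia.
have full a b : (p1 <= a)%N && (b <= p2)%N || (p3 <= a)%N ->
    \sum_(a <= k < b) U k = \sum_(a <= k < b) W k.
  move=> ab; rewrite big_nat_cond [RHS]big_nat_cond; apply: eq_bigr => k /andP[/andP[ak kb] _].
  by rewrite /U ifT//; move: ab ak kb; clear; lia.
rewrite zero ?leqnn// add0r full ?leqnn// zero ?leqnn ?orbT// add0r full ?leqnn ?orbT//.
rewrite mulrDr lerD//; apply: WS => //; rewrite /p1 /p3; clear -rT r0; nia.
Qed.

Lemma delayed_sum_le (R : realFieldType) (n p q L : nat) (w : 'I_n -> 'I_n -> R)
    (d : 'I_n -> 'I_n -> nat) (e : nat -> R) (c s : R) :
  (forall i j, 0 <= w i j) -> 0 <= c -> (1 <= L)%N -> (forall i j, (d i j <= L)%N) ->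
  (forall l, (l <= L)%N -> \sum_(p <= k < q) e (k - l)%N <= s) ->
  \sum_(p <= k < q) 2 * (2 * e (k - 1)%N + c * \sum_i \sum_j w i j * e (k - d i j)%N) <=
  2 * (2 + c * \sum_i \sum_j w i j) * s.
Proof.
move=> w0 c0 L1 dL sh; rewrite -mulr_sumr -mulrA ler_pM2l// big_split /= [leRHS]mulrDl.
rewrite -mulr_sumr lerD// ?ler_pM2l ?sh// -mulr_sumr -mulrA ler_wpM2l//.
rewrite exchange_big mulr_suml; apply: ler_sum => i _ /=.
rewrite exchange_big mulr_suml; apply: ler_sum => j _ /=.
by rewrite -mulr_sumr ler_wpM2l// sh.
Qed.

Lemma window_arith (R : realFieldType) (c Gam X kap m F1 F2 F3 F4 F5 F6 s0 s1 s2 : R) :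
  0 < c -> 0 < Gam -> 0 <= X -> 1 <= m ->
  F1 - F2 - s0 / m <= kap / m -> - (kap / m) <= F4 - F3 - s1 / m ->
  - (kap / m) <= F5 - F6 - s2 / m -> c * s0 <= X / m + Gam * (s1 + s2) ->
  F1 - F2 <= Gam / c * (F4 - F3 + (F5 - F6)) + (kap + (X + 2 * Gam * kap) / c) / m.
Proof.
move=> c0 Gam0 X0 m1 R1 R2 R3 up; have m0 : 0 < m by exact: lt_le_trans m1.
have h1 := ler_wpM2l (ltW c0) R1.
have h2 : Gam * (s1 / m + s2 / m) <= Gam * (F4 - F3 + kap / m + (F5 - F6 + kap / m)).
  by rewrite ler_pM2l//; lra.
have im : 0 < m^-1 by rewrite invr_gt0.
have h3 : c * (s0 / m) <= X / m / m + Gam * (s1 / m + s2 / m).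
  have := ler_wpM2r (ltW im) up.
  have -> : c * s0 / m = c * (s0 / m) by ring.
  by have -> : (X / m + Gam * (s1 + s2)) / m = X / m / m + Gam * (s1 / m + s2 / m) by ring.
have h4 : X / m / m <= X / m by rewrite ler_piMr ?divr_ge0 ?(ltW m0)// invf_le1.
rewrite -(ler_pM2l c0).
have -> : c * (Gam / c * (F4 - F3 + (F5 - F6)) + (kap + (X + 2 * Gam * kap) / c) / m) =
   Gam * (F4 - F3 + kap / m + (F5 - F6 + kap / m)) + c * (kap / m) + X / m.
  by field; rewrite !gt_eqF.
rewrite (_ : c * (F1 - F2) = c * (F1 - F2 - s0 / m) + c * (s0 / m)); last by ring.
lra.
Qed.

Section window.
Context (R : realType) (n : nat) (G : delay_graph R n).

(* F is a primitive of the energy of Y; first-order Taylor bounds replace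
   derivatives so that they apply directly to samples. *)
Definition smooth_orbit (r : nat) (sigma : R) (Y : 'I_n -> R -> R) (F : R -> R) :=
  (forall t, 0 <= t -> \sum_i Y i t = 0) /\
  forall B : R, exists K : R, 0 <= K /\ forall s t, 0 <= s -> s <= t -> t <= B ->
    (forall i, `|Y i t - Y i s| <= K * (t - s) /\
      (r%:R <= s -> `|Y i t - Y i s - (t - s) * damped_rhs G sigma Y i t| <= K * (t - s) ^+ 2)) /\
    `|F t - F s - (t - s) * \sum_i Y i t ^+ 2| <= K * (t - s) ^+ 2.

Lemma energy_window (r : nat) (mu : R) :
  0 <= lambda_bar G -> (0 < r)%N -> (forall i j, delay G i j <= r%:R) -> 0 < mu ->
  (forall x : 'I_n -> R, \sum_i x i = 0 -> mu * \sum_i x i ^+ 2 <= dirichlet (what G) x) ->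
  exists2 C : R, 0 < C & forall sigma Y F, 0 <= sigma -> smooth_orbit r sigma Y F ->
    forall T : nat, (2 * r + 1 <= T)%N ->
    F T%:R - F (r + 1)%:R <=
      C * ((F (2 * r + 1)%:R - F 0) + (F (T + 1 + r)%:R - F (T - r)%N%:R)).
Proof.
move=> lam0 r0 delay_r mu0 coer.
have r_gt0 : (0 : R) < r%:R by rewrite ltr0n.
have [c [H0 [c0 H0_gt0 cP]]] := grid_coercive lam0 r_gt0 delay_r mu0 coer.
pose a2 := \sum_i \sum_j weight G i j ^+ 2.
have a2_ge0 : 0 <= a2 by rewrite sumr_ge0// => i _; rewrite sumr_ge0// => j _; rewrite sqr_ge0.
pose Gam := 2 * (2 + 8 * n%:R * a2).
have Gam0 : 0 < Gam by rewrite mulr_gt0// ltr_wpDr// mulr_ge0// mulr_ge0.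
exists (Gam / c); first exact: divr_gt0.
move=> sigma Y F sigma0 [Ysum Yreg] T rT.
pose b := (T + 1 + r)%N.
have [K [K0 YK]] := Yreg b%:R.
pose K1 := K + \sum_i \sum_j `|weight G i j| * (2 * K).
pose K3 := K * b%:R + (b%:R * (2 * n%:R * K1 ^+ 2) + 2 * Gam * (K * b%:R)) / c.
(* The constants [K] and [K1] depend on the orbit and on the window, but they enter only through
   [K3 / m] and vanish in the limit, so that [Gam / c] is uniform. *)
apply: (@le_of_le_add_inv _ _ _ K3 (Num.truncn H0).+1) => m Hm m0.
have mp : (0 : R) < m%:R by rewrite ltr0n.
have HH : H0 <= m%:R.
  by rewrite ltW// (lt_le_trans (truncnS_gt _))// ler_nat.
(* Rounded down, so that the phases stay within [delay * H * |theta|]. *)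
pose d i j := Num.truncn (delay G i j * m%:R).
have dm i j : (d i j)%:R <= delay G i j * m%:R < (d i j).+1%:R.
  by apply: truncn_itv; rewrite mulr_ge0 ?delay_ge0.
have dsym i j : d i j = d j i by rewrite /d delay_sym.
have dH i j : (d i j)%:R <= delay G i j * m%:R by case/andP: (dm i j).
have drm i j : (d i j <= r * m)%N.
  by rewrite -(ler_nat R) natrM (le_trans (dH i j))// ler_wpM2r// ltW.
have r1m : (1 <= r * m)%N by rewrite muln_gt0 r0.
(* The cutoff starts at [r], where the Taylor bound of [smooth_orbit] becomes available; the grid
   extends to [T + 1 + r] to leave room for the largest shift. *)
pose chi k := cutoff r%:R (T + 1)%:R (k%:R / m%:R : R).
pose y i (k : nat) := Y i (k%:R / m%:R).
pose f i k := chi k * y i k.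
have chi0 k : (k <= r * m)%N -> chi k = 0.
  by move=> krm; apply: cutoff_left; rewrite ler_pdivrMr// -natrM ler_nat.
have chiT k : ((T + 1) * m <= k)%N -> chi k = 0.
  by move=> krm; apply: cutoff_right; rewrite ler_pdivlMr// -natrM ler_nat.
have chi1 k : ((r + 1) * m <= k)%N -> (k <= T * m)%N -> chi k = 1.
  move=> rk kT; apply: cutoff_mid.
    by rewrite -(natrD _ r 1) ler_pdivlMr// -natrM ler_nat.
  by rewrite natrD addrK ler_pdivrMr// -natrM ler_nat.
have chi01 k : 0 <= chi k <= 1 by exact: cutoff_bound.
have chi_lip k : `|m%:R * (chi k - chi (k - 1)%N)| <= 1.
  case: k => [|k]; first by rewrite subrr mulr0 normr0.
  rewrite normrM ger0_norm ?(ltW mp)// -ler_pdivlMl// mulr1.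
  rewrite (le_trans (cutoff_lipschitz _ _ _ _))// subSS subn0.
  have -> : k.+1%:R / m%:R - k%:R / m%:R = m%:R^-1 :> R by rewrite -natr1; ring.
  by rewrite ger0_norm// invr_ge0 ltW.
pose e k := \sum_i y i k ^+ 2.
have e0 k : 0 <= e k by rewrite sumr_ge0// => i _; rewrite sqr_ge0.
pose N := (b * m)%N.
pose gs k := \sum_i grid_op G sigma m%:R d f i k ^+ 2.
have main : c * \sum_(k < N) \sum_i f i k ^+ 2 <= \sum_(k < N) gs k.
  apply: (cP sigma m%:R d f ((T + 1) * m)%N N) => //.
  - by move=> i j; move: (drm i j); rewrite /N /b; clear; lia.
  - by move: r1m; rewrite /N /b; clear; lia.
  - by move=> i; rewrite /f chi0 ?mul0r.
  - by move=> i k kT; rewrite /f chiT ?mul0r.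
  - by move=> k; rewrite /f -mulr_sumr Ysum ?mulr0// divr_ge0.
pose W k := 2 * (2 * e (k - 1)%N + 8 * n%:R * \sum_i \sum_j weight G i j ^+ 2 * e (k - d i j)%N).
pose delta := 2 * n%:R * K1 ^+ 2 / m%:R ^+ 2.
have K1_ge0 : 0 <= K1.
  by rewrite addr_ge0// sumr_ge0// => i _; rewrite sumr_ge0// => j _; rewrite !mulr_ge0.
have delta0 : 0 <= delta.
  by rewrite divr_ge0 ?exprn_ge0// ?(ltW mp)// mulr_ge0 ?sqr_ge0// mulr_ge0.
have consistent k i : (k < N)%N ->
    (chi k * grid_op G sigma m%:R d y i k) ^+ 2 <= K1 ^+ 2 / m%:R ^+ 2.
  move=> kN; have rhs0 : 0 <= K1 ^+ 2 / m%:R ^+ 2 by rewrite divr_ge0 ?sqr_ge0.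
  have [kr|rk] := leqP k (r * m); first by rewrite chi0// mul0r expr0n.
  have := @grid_op_consistent R n G r%:R sigma K b%:R Y m d i k sigma0 K0 m0 delay_r.
  have -> : r%:R * m%:R <= k%:R - 1 :> R.
    by rewrite lerBrDr -natrM natr1 ler_nat.
  have -> : k%:R <= b%:R * m%:R :> R by rewrite -natrM ler_nat ltnW.
  move=> /(_ _ dm isT isT) H; rewrite exprMn -[leRHS]mul1r ler_pM ?sqr_ge0//.
    by rewrite expr_le1//; case/andP: (chi01 k).
  rewrite -expr_div_n -[leLHS]real_normK ?num_real// ler_sqr ?nnegrE ?divr_ge0//.
  by apply: H => s t s0 st tB; exact: (YK s t s0 st tB).1.
have gsW k : (k < N)%N -> gs k <= delta + W k.
  move=> kN; rewrite /gs /f; under eq_bigr do rewrite grid_op_mul.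
  have CB := @commutator_bound R n G sigma m%:R d chi y k sigma0 chi01 (chi_lip k).
  rewrite /W -/(e _) in CB *.
  apply: le_trans (lerD (lexx _) (ler_wpM2l (ler0n _ 2) CB)).
  have -> : delta = \sum_(i < n) 2 * (K1 ^+ 2 / m%:R ^+ 2).
    by rewrite sumr_const card_ord -mulr_natl /delta; ring.
  rewrite mulr_sumr -big_split; apply: ler_sum => i _ /=.
  have := consistent k i kN; move: (chi k * _) (_ + \sum__ _) => p q pK.
  by move: pK; have := sqr_ge0 (p - q); clear; lra.
have gs_small k : (k < N)%N -> (k <= r * m)%N || (((2 * r + 1) * m < k) && (k <= T * m))%N ->
    gs k <= delta.
  move=> kN out; rewrite /gs /f; under eq_bigr do rewrite grid_op_mul.
  have -> : delta = \sum_(i < n) 2 * (K1 ^+ 2 / m%:R ^+ 2).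
    by rewrite sumr_const card_ord -mulr_natl /delta; ring.
  apply: ler_sum => i _; have chiE (l : nat) : (l <= r * m)%N -> chi (k - l)%N = chi k.
    case/orP: out => [kr|/andP[kr kT]] lr; first by rewrite !chi0 ?(leq_trans (leq_subr _ _) kr).
    by rewrite !chi1//; move: kr kT lr; clear; lia.
  rewrite chiE// subrr mulr0 mul0r add0r big1 ?addr0; last first.
    by move=> j _; rewrite chiE// subrr mulr0 mul0r.
  by apply: le_trans (consistent k i kN) _; rewrite mulr_natl mulr2n lerDl divr_ge0 ?sqr_ge0.
pose S (p q : nat) := \sum_((p * m).+1 <= k < (q * m).+1) e k.
have WS p q p' q' : (p' + r * m <= p)%N -> (q <= q')%N ->
    \sum_(p <= k < q) W k <= Gam * \sum_(p' <= k < q') e k.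
  move=> pp qq; set s := \sum_(p' <= k < q') e k.
  have sh l : (l <= r * m)%N -> \sum_(p <= k < q) e (k - l)%N <= s.
    by move=> lr; apply: sum_nat_shift_le => //; rewrite (leq_trans _ pp)// leq_add2l.
  by apply: delayed_sum_le sh => // i j; exact: sqr_ge0.
have upper : \sum_(k < N) gs k <= N%:R * delta + Gam * (S 0%N (2 * r + 1)%N + S (T - r)%N b).
  exact: (window_sum_le m0 r0 rT e0 gsW gs_small WS (ltW Gam0)).
have lower : S (r + 1)%N T <= \sum_(k < N) \sum_i f i k ^+ 2.
  rewrite -(big_mkord xpredT (fun k => \sum_i f i k ^+ 2)).
  apply: (@le_trans _ _ (\sum_(((r + 1) * m).+1 <= k < (T * m).+1) \sum_i f i k ^+ 2)).
    rewrite /S big_nat_cond [leRHS]big_nat_cond; apply: ler_sum => k /andP[/andP[k1 k2] _].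
    by rewrite /f /e; apply: ler_sum => i _; rewrite chi1 ?mul1r// ltnW.
  apply: sum_nat_widen => //; first by move: r1m; rewrite /N /b; clear; lia.
  by move=> k; rewrite sumr_ge0// => i _; rewrite sqr_ge0.
have FE s t : 0 <= s -> s <= t -> t <= b%:R ->
     `|F t - F s - (t - s) * \sum_i Y i t ^+ 2| <= K * (t - s) ^+ 2.
  by move=> s0 st tb; exact: (YK s t s0 st tb).2.
have rie p q : (p <= q)%N -> (q <= b)%N -> `|F q%:R - F p%:R - S p q / m%:R| <= K * b%:R / m%:R.
  by move=> pq qb; exact: (@riemann_sum_nat _ F (fun t => \sum_i Y i t ^+ 2)).
have R1 : `|F T%:R - F (r + 1)%:R - S (r + 1)%N T / m%:R| <= K * b%:R / m%:R.
  by apply: rie; move: rT; rewrite /b; clear; lia.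
have R2 : `|F (2 * r + 1)%:R - F 0 - S 0%N (2 * r + 1)%N / m%:R| <= K * b%:R / m%:R.
  apply: (rie 0%N) => //; move: rT; rewrite /b; clear; lia.
have R3 : `|F b%:R - F (T - r)%N%:R - S (T - r)%N b / m%:R| <= K * b%:R / m%:R.
  by apply: rie; move: rT; rewrite /b; clear; lia.
have := le_trans (ler_wpM2l (ltW c0) lower) (le_trans main upper).
have -> : N%:R * delta = b%:R * (2 * n%:R * K1 ^+ 2) / m%:R.
  by rewrite /N natrM /delta; field; rewrite gt_eqF.
move: R1 R2 R3; rewrite !ler_norml -/b.
set s0 := S (r + 1)%N T; set s1 := S 0%N _; set s2 := S (T - r)%N b.
move=> /andP[_ R1] /andP[R2 _] /andP[R3 _] up.
rewrite /K3; apply: (window_arith c0 Gam0 _ _ R1 R2 R3 up).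
  by rewrite mulr_ge0// mulr_ge0 ?sqr_ge0// mulr_ge0.
by rewrite ler1n.
Qed.
End window.

(** * Absolutely continuous functions *)

Section abs_continuous.
Context (R : realType).
Local Notation mu := (@lebesgue_measure R).

Lemma le_lebesgue_measure (A B : set R) : measurable A -> measurable B ->
  (A `<=` B)%classic -> (mu A <= mu B)%E.
Proof. by move=> mA mB AB; apply: le_measure => //; exact: mem_set. Qed.

Lemma lebesgue_measure_null_diff (A N : set R) : measurable A -> measurable N ->
  mu N = 0%E -> (mu A <= mu (A `\` N)%classic)%E.
Proof.
move=> mA mN N0; have mAN : measurable (A `&` N)%classic by exact: measurableI.
have -> : mu A = (mu (A `\` N)%classic + mu (A `&` N)%classic)%E by exact: measureDI.
rewrite [mu (A `&` N)%classic](_ : _ = 0%E) ?adde0//.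
by apply/eqP; rewrite -measure_le0 -N0; apply: le_lebesgue_measure => // x [].
Qed.

(** [g s] is the measure of the part of [U] to the left of [s]: a running budget for the intervals
    inside [U]. *)
Lemma open_length (U : set R) (d : R) : open U -> (mu U < d%:E)%E ->
  exists g : R -> R, [/\ forall s, 0 <= g s < d, forall u v, u <= v -> g u <= g v
    & forall u v, u <= v -> `[u, v]%classic `<=` U -> g u + (v - u) <= g v]%classic.
Proof.
move=> Uo Ud; pose S s := (U `&` `]-oo, s])%classic.
have mU : measurable U by exact: measurable_realfun.open_measurable.
have mS s : measurable (S s) by apply: measurableI.
have SU s : (mu (S s) <= mu U)%E by apply: le_lebesgue_measure => // x [].
have Sfin s : mu (S s) \is a fin_num.
  by rewrite ge0_fin_numE// (le_lt_trans (SU s))// (lt_trans Ud)// ltry.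
exists (fun s => fine (mu (S s))); split=> [s|u v uv|u v uv uvU].
- rewrite fine_ge0//= -lte_fin fineK//; exact: le_lt_trans (SU s) Ud.
- rewrite fine_le//; apply: le_lebesgue_measure => //.
  by move=> x [Ux /=]; rewrite !in_itv/= => xu; split=> //=; rewrite in_itv/= (le_trans xu).
- rewrite -lee_fin EFinD !fineK//.
  have lenE : mu `]u, v]%classic = (v - u)%:E.
    by rewrite lebesgue_measure_itv/= lte_fin; case: ltgtP uv => // ->; rewrite subrr.
  have <- : mu (S u `|` `]u, v])%classic = (mu (S u) + (v - u)%:E)%E.
    rewrite -lenE; apply: measureU; [exact: mS|exact: measurable_itv|].
    rewrite -subset0 => x [[_ /=]]; rewrite !in_itv/= => xu /andP[ux _].
    by rewrite ltNge xu in ux.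
  apply: le_lebesgue_measure => //; first by apply: measurableU => //; exact: measurable_itv.
  move=> x [[Ux /=]|/=]; rewrite !in_itv/=.
    by move=> xu; split=> //=; rewrite in_itv/= (le_trans xu).
  move=> /andP[ux xv]; split; last by rewrite /= in_itv/=.
  by apply: uvU; rewrite /= in_itv/= xv ltW.
Qed.

Definition nonoverlap (p q : R * R) := (p.2 <= q.1) || (q.2 <= p.1).

Lemma abs_continuous_seq (f : R -> R) (a b : R) : abs_continuous_on f a b ->
  forall e, 0 < e -> exists2 d, 0 < d & forall l : seq (R * R),
    all (fun p => [&& a <= p.1, p.1 <= p.2 & p.2 <= b]) l -> pairwise nonoverlap l ->
    \sum_(p <- l) (p.2 - p.1) < d -> \sum_(p <- l) `|f p.2 - f p.1| < e.
Proof.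
move=> ac e /ac[d d0 dP]; exists d => // l lab ldis.
rewrite !(big_nth (0, 0)) !big_mkord => ld.
apply: (dP _ (fun i => (nth (0, 0) l i).1) (fun i => (nth (0, 0) l i).2)) => //.
- by move=> i; have /allP/(_ _ (mem_nth (0, 0) (ltn_ord i)))/and3P := lab; case.
- move=> i j ij; have /(pairwiseP (0, 0)) dis := ldis.
  have [ltij|] := ltnP i j; last rewrite leq_eqVlt => /predU1P[/val_inj ji|ltji].
  + by have /orP[] := dis i j (ltn_ord i) (ltn_ord j) ltij; [left|right].
  + by rewrite ji eqxx in ij.
  + by have /orP[] := dis j i (ltn_ord j) (ltn_ord i) ltji; [right|left].
Qed.

(** Supremum argument. The step has to carry [P] across [s], from any nearby [u] on the left to any
    nearby [v] on the right, which suits information known only near each point. *)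
Lemma real_induction (a b : R) (P : R -> Prop) : a <= b -> P a ->
  (forall s, a <= s <= b -> exists2 d, 0 < d & forall u v, a <= u <= s -> s <= v <= b ->
     s - d < u -> v < s + d -> P u -> P v) -> P b.
Proof.
move=> ab Pa step; pose E := [set s | a <= s <= b /\ P s]%classic.
have Ea : E a by split=> //; rewrite lexx.
have Esup : has_sup E by split; [exists a|exists b => s [/andP[]]].
pose s := sup E.
have as_ : a <= s by apply: ub_le_sup => //; exact: Esup.2.
have sb : s <= b by apply: ge_sup; [exists a|move=> t [/andP[]]].
have [d d0 dP] : exists2 d, 0 < d & forall u v, a <= u <= s -> s <= v <= b ->
     s - d < u -> v < s + d -> P u -> P v by apply: step; rewrite as_.
have [u [/andP[au ub] Pu] su] := sup_adherent d0 Esup; rewrite -/s in su.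
have us : u <= s by apply: ub_le_sup; [exact: Esup.2|split=> //; rewrite au].
pose v := Num.min b (s + d / 2).
have sv : s <= v by rewrite /v le_min sb lerDl divr_ge0// ltW.
have vb : v <= b by rewrite /v ge_min lexx.
have vd : v < s + d by rewrite /v gt_min; apply/orP; right; lra.
have Pv : P v by apply: (dP u v) => //; apply/andP.
have vs : v <= s by apply: ub_le_sup; [exact: Esup.2|split=> //; rewrite (le_trans as_)].
have : v = b; last by move=> <-.
by move: vs; rewrite /v; case: (leP b (s + d / 2)) => //; lra.
Qed.

Lemma is_derive_approx (f : R -> R) (t d e : R) : is_derive t 1 f d -> 0 < e ->
  exists2 eta, 0 < eta & forall s, `|s - t| < eta -> `|f s - f t - d * (s - t)| <= e * `|s - t|.
Proof.
move=> [df <-] e0.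
have /cvgrPdist_le/(_ e e0) : (h^-1 *: (f (h *: 1 + t) - f t) @[h --> 0^'] --> 'D_1 f t)%classic by [].
rewrite near_withinE => /nbhs_ballP[eta /= eta0 etaP].
exists eta => // s st; have [->|nst] := eqVneq s t; first by rewrite !subrr mulr0 subr0 normr0 mulr0.
have h0 : s - t != 0 by rewrite subr_eq0.
have := etaP (s - t); rewrite /ball/= sub0r normrN => /(_ st h0).
rewrite /GRing.scale /= mulr1 subrK => H.
have -> : f s - f t - 'D_1 f t * (s - t) =
   - ('D_1 f t - (s - t)^-1 * (f s - f t)) * (s - t) by field.
by rewrite normrM normrN ler_wpM2r.
Qed.

(** A substitute for integrating the derivative. Real induction crosses the good points at rate
    [M + e], and those of the null set along intervals inside an open set [U] of measure below [d],
    where absolute continuity bounds the total change of [f] by [e]. *)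
Lemma abs_continuous_mean_value (f D : R -> R) (a b M : R) (N : set R) :
  a <= b -> 0 <= M -> abs_continuous_on f a b -> mu.-negligible N ->
  (forall t, a <= t <= b -> ~ N t -> is_derive t 1 f (D t)) ->
  (forall t, a <= t <= b -> `|D t| <= M) ->
  `|f b - f a| <= M * (b - a).
Proof.
move=> ab M0 ac [N' [mN' N'0 NN']] fD DM.
suff H e : 0 < e -> `|f b - f a| <= (M + e) * (b - a) + e.
  apply/ler_addgt0Pr => e e0.
  have c0 : 0 < b - a + 1 by rewrite ltr_wpDl// subr_ge0.
  have := H (e / (b - a + 1)) (divr_gt0 e0 c0); move/le_trans; apply.
  by rewrite le_eqVlt; apply/orP; left; apply/eqP; field; rewrite gt_eqF.
move=> e0; have [d d0 dP] := abs_continuous_seq ac e0.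
have [U [Uo NU Ud]] : exists U : set R, [/\ open U, (N' `<=` U)%classic & (mu (U `\` N')%classic < d%:E)%E].
  apply: lebesgue_regularity_outer => //.
  by apply: (@le_lt_trans _ _ 0%E); [rewrite -N'0|exact: ltry].
have {}Ud : (mu U < d%:E)%E.
  apply: le_lt_trans Ud; have mU : measurable U by exact: measurable_realfun.open_measurable.
  exact: lebesgue_measure_null_diff.
have [g [gd gmono gU]] := open_length Uo Ud.
(* [l] lists the intervals crossed inside [U]; their total length stays within [g s < d], so that
   absolute continuity applies at the end. *)
pose P s := exists l : seq (R * R), [/\
  all (fun p => [&& a <= p.1, p.1 <= p.2 & p.2 <= s]) l, pairwise nonoverlap l,
  \sum_(p <- l) (p.2 - p.1) <= g s
  & `|f s - f a| <= (M + e) * (s - a) + \sum_(p <- l) `|f p.2 - f p.1|].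
have : P b.
  apply: (@real_induction a b P) => //.
    exists [::]; split=> //; rewrite !big_nil; first by case/andP: (gd a).
    by rewrite !subrr normr0 mulr0 addr0.
  move=> s /andP[as_ sb].
  have stepU u v : a <= u -> u <= v -> (`[u, v] `<=` U)%classic -> P u -> P v.
    move=> au uv uvU [l [lab ldis lg lf]]; exists ((u, v) :: l); split => /=.
    - rewrite au uv lexx/=; apply/allP => p /(allP lab)/and3P[-> -> /= pu].
      exact: le_trans uv.
    - by rewrite ldis andbT; apply/allP => p /(allP lab)/and3P[_ _ pu]; rewrite /nonoverlap pu orbT.
    - by rewrite big_cons/= addrC (le_trans _ (gU u v uv uvU))// lerD2r.
    - rewrite big_cons/=; have -> : f v - f a = (f v - f u) + (f u - f a) by ring.
      rewrite (le_trans (ler_normD _ _))// addrCA lerD2l (le_trans lf)// lerD2r.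
      by rewrite ler_wpM2l ?lerD2r// addr_ge0// ltW.
  have stepM u v : a <= u -> u <= v -> `|f v - f u| <= (M + e) * (v - u) -> P u -> P v.
    move=> au uv fuv [l [lab ldis lg lf]]; exists l; split => //=.
    - by apply/allP => p /(allP lab)/and3P[-> -> /= pu]; exact: le_trans uv.
    - exact: le_trans (gmono _ _ uv).
    - have -> : f v - f a = (f v - f u) + (f u - f a) by ring.
      rewrite (le_trans (ler_normD _ _))// (le_trans (lerD fuv lf))//.
      by rewrite addrA -mulrDr (_ : v - u + (u - a) = v - a)//; ring.
  have [Ns|Ns] := pselect (N' s).
    have /nbhs_ballP[eta /= eta0 etaU] : nbhs s U.
      by apply: open_nbhs_nbhs; split=> //; exact: NU.
    exists eta => // u v /andP[au us] /andP[sv vb] su vs; apply: stepU => //.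
      exact: le_trans us sv.
    move=> x /=; rewrite in_itv/= => /andP[ux xv]; apply: etaU.
    by rewrite /ball/= ltr_norml; apply/andP; split; lra.
  have sab : a <= s <= b by rewrite as_.
  have [eta eta0 etaP] := is_derive_approx (fD s sab (fun x => Ns (NN' _ x))) e0.
  exists eta => // u v /andP[au us] /andP[sv vb] su vs; apply: stepM => //.
    exact: le_trans us sv.
  have app w : `|w - s| < eta -> `|f w - f s| <= (M + e) * `|w - s|.
    move=> /etaP ws; have -> : f w - f s = (f w - f s - D s * (w - s)) + D s * (w - s) by ring.
    rewrite (le_trans (ler_normD _ _))// mulrDl addrC lerD// normrM ler_wpM2r//.
    exact: DM.
  have -> : f v - f u = (f v - f s) - (f u - f s) by ring.
  rewrite (le_trans (ler_normB _ _))//.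
  have av := app v; have au' := app u.
  rewrite (ger0_norm (_ : 0 <= v - s)) ?subr_ge0// in av.
  rewrite (ler0_norm (_ : u - s <= 0)) ?subr_le0// opprB in au'.
  have -> : (M + e) * (v - u) = (M + e) * (v - s) + (M + e) * (s - u) by ring.
  by rewrite lerD//; [apply: av|apply: au']; lra.
move=> [l [lab ldis lg lf]]; rewrite (le_trans lf)// lerD2l ltW//.
by apply: dP => //; rewrite (le_lt_trans lg)//; case/andP: (gd b).
Qed.
End abs_continuous.

(** * Calculus on an interval and the growth gap *)

Lemma within_continuous_of_for (R : realType) (f : R -> R) (a b : R) :
  (forall t, a <= t <= b -> {for t, continuous f}) -> {within `[a, b], continuous f}%classic.
Proof.
by move=> fc; apply: continuous_in_subspaceT => y; rewrite inE/= in_itv/= => /fc.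
Qed.

(** Integrating from [-1] makes 0 an interior point, so the derivative there is two-sided. *)
Lemma primitive_exists (R : realType) (f : R -> R) :
  (forall t, -1 <= t -> {for t, continuous f}) ->
  exists F : R -> R, forall t : R, 0 <= t -> is_derive t 1 F (f t).
Proof.
move=> fc; exists (fun t => \int[lebesgue_measure]_(x in `[-1, t]) f x) => t t0.
have [||||dF F'] := @continuous_FTC1 R f (BLeft (-1)) t (t + 1).
- by rewrite ltrDl.
- apply: continuous_compact_integrable; first exact: segment_compact.
  by apply: within_continuous_of_for => s /andP[s1 _]; exact: fc.
- by rewrite /Order.lt /=; lra.
- by apply: fc; lra.
exact: (DeriveDef dF (etrans (esym (derive1E _ _)) F')).
Qed.

Lemma bounded_on_segment (R : realType) (f : R -> R) (a b : R) :
  (forall t, a <= t <= b -> {for t, continuous f}) ->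
  exists2 K, 0 <= K & forall t, a <= t <= b -> `|f t| <= K.
Proof.
move=> fc; have [ab|ba] := leP a b; last first.
  by exists 0 => // t /andP[at_ tb]; have := le_trans at_ tb; rewrite leNgt ba.
have gc t : a <= t <= b -> {for t, continuous (fun s => `|f s|)}.
  by move=> /fc ft; apply: (@continuous_comp _ _ _ f (fun x => `|x|)) => //; exact: norm_continuous.
have [c cab cmax] := EVT_max ab (within_continuous_of_for gc).
by exists `|f c| => // t tab; apply: cmax; rewrite in_itv.
Qed.

Lemma max_derive_ge0 (R : realType) (f : R -> R) (a t d : R) :
  a < t -> is_derive t 1 f d -> (forall s, a <= s <= t -> f s <= f t) -> 0 <= d.
Proof.
move=> at_ ft fmax; rewrite leNgt; apply/negP => d0.
have [|eta eta0 etaP] := @is_derive_approx _ _ _ _ (- d / 2) ft; first by lra.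
pose h := Num.min (t - a) (eta / 2).
have h0 : 0 < h by rewrite lt_min subr_gt0 at_/= divr_gt0.
have hle : h <= t - a by rewrite /h ge_min lexx.
have heta : h <= eta / 2 by rewrite /h ge_min lexx orbT.
have := etaP (t - h); have -> : t - h - t = - h by ring.
rewrite normrN gtr0_norm// => /(_ _) H.
have {}H : `|f (t - h) - f t - d * - h| <= - d / 2 * h by apply: H; lra.
have := fmax (t - h); have -> : a <= t - h <= t by apply/andP; split; lra.
move=> /(_ isT); move: H; rewrite ler_norml => /andP[H _]; nra.
Qed.

Lemma bernoulli_le (R : realFieldType) (x : R) (k : nat) : 0 <= x -> 1 + k%:R * x <= (1 + x) ^+ k.
Proof.
move=> x0; elim: k => [|k IH]; first by rewrite expr0 mul0r addr0.
rewrite exprS -natr1; apply: le_trans (ler_wpM2l _ IH); last by lra.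
by have := mulr_ge0 (ler0n R k) (sqr_ge0 x); lra.
Qed.

(* Past any point where f exceeds C0 the excess gains the factor 1 + 1/C over
   every 2w steps, which no rate q with q^(2w) < 1 + 1/C allows. *)
Lemma growth_gap (R : realType) (f : nat -> R) (C C0 K q : R) (w T1 : nat) :
  0 < C -> {homo f : x y / (x <= y)%N >-> x <= y} ->
  (forall T, (T1 <= T)%N -> f (T + w)%N <= C0 + C * (f (T + 2 * w)%N - f T)) ->
  (forall T, f T <= K * q ^+ T) -> 1 <= q -> q ^+ (2 * w) < 1 + C^-1 ->
  forall T, f T <= C0.
Proof.
move=> C0_gt0 fmono step fK q1 qC T; rewrite leNgt; apply/negP => fT.
pose T0 := (T + T1)%N; pose p k := f (T0 + 2 * w * k)%N - C0.
have p0 : 0 < p 0%N.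
  by rewrite /p muln0 addn0 subr_gt0 (lt_le_trans fT)// fmono// leq_addr.
set b := 1 + C^-1 in qC; set a := q ^+ (2 * w) in qC.
have a1 : 1 <= a by rewrite exprn_ege1.
(* By monotonicity the value of [f] after [w] more steps is no smaller, so [step] gives
   [p k <= C * (p k.+1 - p k)]. *)
have pS k : b * p k <= p k.+1.
  have := step (T0 + 2 * w * k)%N; rewrite /T0 -addnA addnCA leq_addr => /(_ isT).
  rewrite addnCA -addnA -/T0 => st.
  have -> : p k.+1 = f (T0 + 2 * w * k + 2 * w)%N - C0.
    by rewrite /p mulnS [(2 * w + _)%N]addnC addnA.
  have m1 : f (T0 + 2 * w * k)%N <= f (T0 + 2 * w * k + w)%N by rewrite fmono// leq_addr.
  have {st} : f (T0 + 2 * w * k + w)%N <= C0 + C * (f (T0 + 2 * w * k + 2 * w)%N - f (T0 + 2 * w * k)%N).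
    by apply: step; rewrite /T0 -!addnA addnCA leq_addr.
  rewrite /p; move: m1; move: (f _) (f _) (f _) => x y z xy yz.
  have : z - C0 <= C * (x - z) by lra.
  by rewrite -ler_pdivrMl// /b mulrDl mul1r; lra.
have pk k : b ^+ k * p 0%N <= p k.
  elim: k => [|k IH]; first by rewrite expr0 mul1r.
  by rewrite exprS -mulrA (le_trans _ (pS k))// ler_wpM2l// (le_trans _ (ltW qC))// (le_trans ler01).
pose L := `|K| * q ^+ T0 + `|C0|.
have pL k : p k <= L * a ^+ k.
  have := fK (T0 + 2 * w * k)%N; rewrite /p exprD exprM -/a => H.
  have ak : 1 <= a ^+ k by rewrite exprn_ege1.
  have q0 : 0 <= q ^+ T0 by rewrite exprn_ge0// (le_trans ler01).
  rewrite /L mulrDl -mulrA lerD//.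
    by rewrite (le_trans H)// ler_wpM2r ?ler_norm// mulr_ge0// (le_trans ler01).
  by rewrite (le_trans (ler_norm _))// normrN ler_peMr.
have a0 : 0 < a by exact: lt_le_trans a1.
(* [p] grows at least like [b^k] and at most like [a^k], so the powers of [b / a = 1 + x] stay
   bounded; Bernoulli's inequality contradicts this. *)
pose x := b / a - 1.
have x0 : 0 < x by rewrite /x subr_gt0 ltr_pdivlMr// mul1r.
have bound k : k%:R * x <= L / p 0%N.
  have h := le_trans (pk k) (pL k).
  have h2 : (1 + x) ^+ k <= L / p 0%N.
    have -> : 1 + x = b / a by rewrite /x; ring.
    have ak : 0 < a ^+ k by exact: exprn_gt0.
    by rewrite ler_pdivlMr// expr_div_n mulrAC ler_pdivrMr.
  by have := bernoulli_le k (ltW x0); lra.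
have := bound (Num.truncn (L / p 0%N / x)).+1.
by apply/negP; rewrite -ltNge -ltr_pdivrMr// truncnS_gt.
Qed.

(** * Decay of mean-zero orbits *)

Section derive_rules.
Context (R : realType).
Implicit Types (f g : R -> R) (t : R).

Lemma is_derive_id1 t : is_derive t 1 (fun s : R => s) 1.
Proof. exact: is_derive_id. Qed.

Lemma is_derive_cst1 (c t : R) : is_derive t 1 (fun _ : R => c) 0.
Proof. exact: is_derive_cst. Qed.

Lemma is_derive_add f g (df dg t : R) : is_derive t 1 f df -> is_derive t 1 g dg ->
  is_derive t 1 (fun s => f s + g s) (df + dg).
Proof. by move=> hf hg; exact: is_deriveD. Qed.

Lemma is_derive_opp f (df t : R) : is_derive t 1 f df -> is_derive t 1 (fun s => - f s) (- df).
Proof. by move=> hf; exact: is_deriveN. Qed.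

Lemma is_derive_mul f g (df dg t : R) : is_derive t 1 f df -> is_derive t 1 g dg ->
  is_derive t 1 (fun s => f s * g s) (f t * dg + df * g t).
Proof. by move=> hf hg; rewrite [df * _]mulrC; exact: is_deriveM. Qed.

Lemma is_derive_scale f (c df t : R) : is_derive t 1 f df -> is_derive t 1 (fun s => c * f s) (c * df).
Proof.
by move=> hf; have := is_derive_mul (is_derive_cst1 c t) hf; rewrite mul0r addr0.
Qed.

Lemma is_derive_shift f (c d t : R) : is_derive (t + c) 1 f d ->
  is_derive t 1 (fun s => f (s + c)) d.
Proof.
move=> hf; have hg := is_derive_add (is_derive_id1 t) (is_derive_cst1 c t).
by have := @is_derive1_comp R f (fun s => s + c) t d (1 + 0) hf hg; rewrite addr0 mulr1.
Qed.

Lemma is_derive_bigsum (n : nat) (F : 'I_n -> R -> R) (dF : 'I_n -> R) t :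
  (forall i, is_derive t 1 (F i) (dF i)) ->
  is_derive t 1 (fun s => \sum_i F i s) (\sum_i dF i).
Proof.
move=> hF; have := is_derive_sum hF.
by rewrite (_ : \sum_(i < n) F i = fun s => \sum_i F i s)//; apply/funext => s; rewrite fct_sumE.
Qed.

Lemma is_derive_expR_lin (c t : R) : is_derive t 1 (fun s => expR (c * s)) (c * expR (c * t)).
Proof.
have hg : is_derive t 1 (fun s : R => c * s) c.
  by have := is_derive_scale c (is_derive_id1 t); rewrite mulr1.
by have := is_derive1_comp (is_derive_expR (c * t)) hg; rewrite mulrC.
Qed.
End derive_rules.

Section decay.
Context (R : realType) (n : nat) (G : delay_graph R n) (r : nat).
Hypothesis r_gt0 : (0 < r)%N.
Hypothesis delay_r : forall i j, delay G i j <= r%:R.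
Context (z : 'I_n -> R -> R).
Let D i t := \sum_j weight G i j * (z j (t - delay G i j) - z i (t - delay G i j)).
(** Two delays of history: from [-2 r] on the orbit is locally bounded, from [- r] on the equation
    then makes it locally Lipschitz, and from 0 on its right-hand side is locally Lipschitz too, as
    the Taylor bounds require. *)
Hypothesis z_cont : forall i (t : R), - (2 * r%:R) <= t -> {for t, continuous (z i)}.
Hypothesis z_derive : forall i (t : R), - r%:R <= t -> is_derive t 1 (z i) (D i t).
Hypothesis z_sum : forall t, 0 <= t -> \sum_i z i t = 0.

Definition damp (sigma : R) i t := expR (- sigma * t) * z i t.
Definition damp_energy (sigma : R) t := \sum_i damp sigma i t ^+ 2.

Lemma is_derive_damp sigma i (t : R) : - r%:R <= t ->
  is_derive t 1 (damp sigma i) (damped_rhs G sigma (damp sigma) i t).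
Proof.
move=> rt; have H := is_derive_mul (is_derive_expR_lin (- sigma) t) (z_derive i rt).
apply: is_derive_eq; rewrite /damped_rhs /D addrC mulr_sumr /damp mulrA; congr (_ + _).
apply: eq_bigr => j _.
have -> : expR (- sigma * t) = expR (- (sigma * delay G i j)) * expR (- sigma * (t - delay G i j)).
  by rewrite -expRD; congr expR; ring.
by ring.
Qed.

Lemma damp_continuous sigma i (t : R) : - (2 * r%:R) <= t -> {for t, continuous (damp sigma i)}.
Proof.
move=> rt; apply: (@continuousM _ _ (fun s : R => expR (- sigma * s)) (z i)).
  exact: is_derive_continuous (is_derive_expR_lin (- sigma) t).
exact: z_cont.
Qed.

Lemma damp_bounded sigma (B : R) : exists2 K, 0 <= K &
  forall i t, - (2 * r%:R) <= t <= B -> `|damp sigma i t| <= K.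
Proof.
have bnd i : exists K, 0 <= K /\ forall t, - (2 * r%:R) <= t <= B -> `|damp sigma i t| <= K.
  have [|K K0 KP] := @bounded_on_segment R (damp sigma i) (- (2 * r%:R)) B; last by exists K.
  by move=> t /andP[rt _]; exact: damp_continuous.
have [K KP] := choice bnd.
exists (\sum_i K i); first by rewrite sumr_ge0// => i _; exact: (KP i).1.
move=> i t tB; rewrite (le_trans ((KP i).2 t tB))// (bigD1 i)//= lerDl sumr_ge0// => j _.
exact: (KP j).1.
Qed.

Lemma delayed_window i j (t : R) (B : R) (c : R) : - c <= t -> t <= B ->
  - (c + r%:R) <= t - delay G i j <= B.
Proof.
by move=> ct tB; have := delay_r i j; have := delay_ge0 G i j => ? ?; apply/andP; split; lra.
Qed.

Lemma delayed_sum_norm (sigma K : R) (u : 'I_n -> R) i : 0 <= sigma -> 0 <= K ->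
  (forall j, `|u j| <= 2 * K) ->
  `|\sum_j weight G i j * expR (- (sigma * delay G i j)) * u j| <=
  2 * (\sum_i \sum_j `|weight G i j|) * K.
Proof.
move=> sigma0 K0 uK.
have rowle : \sum_j `|weight G i j| <= \sum_i \sum_j `|weight G i j|.
  by rewrite [leRHS](bigD1 i)//= lerDl sumr_ge0// => a _; rewrite sumr_ge0.
rewrite (le_trans (ler_norm_sum _ _ _))//.
apply: (@le_trans _ _ ((\sum_j `|weight G i j|) * (2 * K))); last first.
  rewrite (_ : 2 * _ * K = (\sum_i \sum_j `|weight G i j|) * (2 * K)); last by ring.
  by rewrite ler_wpM2r// mulr_ge0.
rewrite mulr_suml; apply: ler_sum => j _; rewrite normrM ler_pM//.
by rewrite normrM (ger0_norm (expR_ge0 _)) ler_piMr// expR_delay_le1.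
Qed.

Lemma damped_rhs_lip (sigma K : R) (Y : 'I_n -> R -> R) i s t : 0 <= sigma ->
  `|Y i t - Y i s| <= K ->
  (forall j, `|Y i (t - delay G i j) - Y i (s - delay G i j)| <= K) ->
  (forall j, `|Y j (t - delay G i j) - Y j (s - delay G i j)| <= K) ->
  `|damped_rhs G sigma Y i t - damped_rhs G sigma Y i s| <=
  (sigma + 2 * \sum_i \sum_j `|weight G i j|) * K.
Proof.
move=> sigma0 h1 h2 h3; have K0 : 0 <= K by exact: le_trans h1.
have -> : damped_rhs G sigma Y i t - damped_rhs G sigma Y i s = - sigma * (Y i t - Y i s)
  + \sum_j weight G i j * expR (- (sigma * delay G i j)) *
   ((Y j (t - delay G i j) - Y j (s - delay G i j)) - (Y i (t - delay G i j) - Y i (s - delay G i j))).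
  rewrite /damped_rhs opprD addrACA -sumrB -mulrBr; congr (_ + _).
  by apply: eq_bigr => j _; ring.
rewrite (le_trans (ler_normD _ _))// mulrDl lerD//.
  by rewrite normrM normrN (ger0_norm sigma0) ler_wpM2l.
apply: delayed_sum_norm => // j.
by rewrite (le_trans (ler_normB _ _))// mulrDl mul1r lerD.
Qed.

Lemma damp_smooth_orbit (sigma : R) (F : R -> R) : 0 <= sigma ->
  (forall t : R, 0 <= t -> is_derive t 1 F (damp_energy sigma t)) ->
  smooth_orbit G r sigma (damp sigma) F.
Proof.
move=> sigma0 FE; split=> [t t0|B].
  by rewrite /damp -mulr_sumr z_sum// mulr0.
have r0 : (0 : R) < r%:R by rewrite ltr0n.
have [K0 K0_ge0 K0P] := damp_bounded sigma B.
pose S := \sum_i \sum_j `|weight G i j|.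
have S0 : 0 <= S by rewrite sumr_ge0// => i _; rewrite sumr_ge0.
pose K1 := sigma * K0 + 2 * S * K0.
have K1_ge0 : 0 <= K1 by rewrite addr_ge0 ?mulr_ge0.
have rhsK1 i t : - r%:R <= t -> t <= B -> `|damped_rhs G sigma (damp sigma) i t| <= K1.
  move=> rt tB; have dw j : - (2 * r%:R) <= t - delay G i j <= B.
    by have := delayed_window i j rt tB; rewrite (_ : 2 * r%:R = r%:R + r%:R)//; ring.
  have tw : - (2 * r%:R) <= t <= B by rewrite tB andbT; lra.
  rewrite /damped_rhs (le_trans (ler_normD _ _))// lerD//.
    by rewrite normrM normrN (ger0_norm sigma0) ler_wpM2l// K0P.
  apply: delayed_sum_norm => // j.
  by rewrite (le_trans (ler_normB _ _))// mulrDl mul1r lerD// K0P.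
have lip i s t : - r%:R <= s -> s <= t -> t <= B ->
    `|damp sigma i t - damp sigma i s| <= K1 * (t - s).
  move=> rs st tB.
  have [|c /andP[sc ct] ->] := @mean_value R (damp sigma i)
      (damped_rhs G sigma (damp sigma) i) s t st.
    by move=> x /andP[sx _]; apply: is_derive_damp; exact: le_trans sx.
  rewrite normrM [X in _ * X]ger0_norm ?subr_ge0// ler_wpM2r ?subr_ge0//.
  by apply: rhsK1; [exact: le_trans sc|exact: le_trans tB].
(* A Lipschitz constant of the right-hand side, hence a second-order Taylor constant for the orbit;
   [K3] does the same for the primitive of the energy. *)
pose K2 := (sigma + 2 * S) * K1.
have K2_ge0 : 0 <= K2 by rewrite mulr_ge0// addr_ge0// mulr_ge0.
pose K3 := n%:R * (2 * K0 * K1).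
have K3_ge0 : 0 <= K3 by rewrite !mulr_ge0.
exists (K1 + K2 + K3); split; first by rewrite addr_ge0 // addr_ge0.
move=> s t s0 st tB; have ts0 : 0 <= t - s by rewrite subr_ge0.
have wid (x : R) : 0 <= x -> - r%:R <= x by move=> x0; rewrite (le_trans _ x0)// oppr_le0 ltW.
split=> [i|].
  split=> [|_].
    rewrite (le_trans (lip i s t (wid _ s0) st tB))// ler_wpM2r// -addrA lerDl addr_ge0//.
  have [|c /andP[sc ct] ->] := @mean_value R (damp sigma i)
      (damped_rhs G sigma (damp sigma) i) s t st.
    by move=> x /andP[sx _]; apply: is_derive_damp; rewrite wid// (le_trans s0).
  rewrite [X in X - _]mulrC -mulrBr normrM ger0_norm// mulrC expr2 mulrA ler_wpM2r//.
  have ct0 : 0 <= t - c by rewrite subr_ge0.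
  have cts : t - c <= t - s by rewrite lerD2l lerN2.
  have c0 : 0 <= c by exact: le_trans sc.
  have dl a j : `|damp sigma a (t - delay G i j) - damp sigma a (c - delay G i j)| <= K1 * (t - c).
    have -> : t - c = (t - delay G i j) - (c - delay G i j) by ring.
    apply: lip; [|by rewrite lerD2r|].
      by rewrite lerBrDr (le_trans _ c0)// addrC subr_le0.
    by rewrite (le_trans _ tB)// gerBl delay_ge0.
  rewrite distrC (le_trans (damped_rhs_lip sigma0 (lip i c t (wid _ c0) ct tB) (dl i) (fun j => dl j j)))//.
  rewrite -/S mulrA -/K2 (le_trans (ler_wpM2l K2_ge0 cts))// ler_wpM2r//.
  by rewrite addrAC lerDr addr_ge0.
have [|c /andP[sc ct] ->] := @mean_value R F (damp_energy sigma) s t st.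
  by move=> x /andP[sx _]; apply: FE; exact: le_trans sx.
rewrite [X in X - _]mulrC -mulrBr normrM ger0_norm// mulrC expr2 mulrA ler_wpM2r//.
have ct0 : 0 <= t - c by rewrite subr_ge0.
have cts : t - c <= t - s by rewrite lerD2l lerN2.
have c0 : 0 <= c by exact: le_trans sc.
apply: (@le_trans _ _ (K3 * (t - c))); last first.
  by rewrite (le_trans (ler_wpM2l K3_ge0 cts))// ler_wpM2r// lerDr addr_ge0.
rewrite /damp_energy -sumrB (le_trans (ler_norm_sum _ _ _))//.
have -> : K3 * (t - c) = \sum_(i < n) 2 * K0 * (K1 * (t - c)).
  by rewrite sumr_const card_ord -[RHS]mulr_natl /K3; ring.
apply: ler_sum => i _; rewrite subr_sqr normrM mulrC ler_pM//; last first.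
  by rewrite distrC lip ?wid.
have cB : c <= B by exact: le_trans tB.
have w x : 0 <= x -> x <= B -> `|damp sigma i x| <= K0.
  by move=> x0 xB; apply: K0P; rewrite xB andbT (le_trans _ x0)// oppr_le0 mulr_ge0// ltW.
by rewrite (le_trans (ler_normD _ _))// mulrDl mul1r lerD// w// (le_trans c0).
Qed.

Lemma is_derive_damp_energy sigma (t : R) : - r%:R <= t ->
  is_derive t 1 (damp_energy sigma)
    (\sum_i 2 * (damp sigma i t * damped_rhs G sigma (damp sigma) i t)).
Proof.
move=> rt; apply: (is_derive_bigsum (F := fun i s => damp sigma i s ^+ 2)) => i.
have H := is_derive_damp sigma i rt.
have -> : (fun s => damp sigma i s ^+ 2) = (fun s => damp sigma i s * damp sigma i s).
  by apply/funext => s; rewrite expr2.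
rewrite (_ : 2 * _ = damp sigma i t * damped_rhs G sigma (damp sigma) i t
  + damped_rhs G sigma (damp sigma) i t * damp sigma i t); last by ring.
exact: (is_derive_mul H H).
Qed.

Lemma damp_energy_ge0 sigma t : 0 <= damp_energy sigma t.
Proof. by rewrite sumr_ge0// => i _; rewrite sqr_ge0. Qed.

Lemma damp_energy_derive_le sigma (t : R) : 0 <= sigma ->
  \sum_i 2 * (damp sigma i t * damped_rhs G sigma (damp sigma) i t) <=
  - (2 * sigma) * damp_energy sigma t + \sum_i \sum_j `|weight G i j| *
     (damp_energy sigma t + 4 * damp_energy sigma (t - delay G i j)).
Proof.
move=> sigma0; rewrite {1}/damp_energy mulr_sumr -big_split; apply: ler_sum => i _ /=.
have le_e s l : damp sigma l s ^+ 2 <= damp_energy sigma s.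
  by rewrite /damp_energy (bigD1 l)//= lerDl sumr_ge0// => ? _; rewrite sqr_ge0.
rewrite /damped_rhs mulrDr mulrDr lerD//.
  by rewrite le_eqVlt; apply/orP; left; apply/eqP; ring.
rewrite !mulr_sumr; apply: ler_sum => j _; set u := damp sigma j _ - _.
have u4 : u ^+ 2 <= 4 * damp_energy sigma (t - delay G i j).
  have := le_e (t - delay G i j) i; have := le_e (t - delay G i j) j.
  have := sqr_ge0 (damp sigma j (t - delay G i j) + damp sigma i (t - delay G i j)).
  by rewrite /u; move: (damp sigma j _) (damp sigma i _) => a b; lra.
have := le_e t i; have := expR_delay_le1 G i j sigma0; have := expR_ge0 (- (sigma * delay G i j)).
move: (expR _) (damp sigma i t) (damp_energy sigma t) (damp_energy sigma _) u4 => e y w1 w2 u4 e0 e1 yw.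
apply: (@le_trans _ _ (`|weight G i j| * (y ^+ 2 + u ^+ 2))); last by rewrite ler_wpM2l// lerD.
rewrite (_ : 2 * _ = weight G i j * (2 * e * y * u)); last by ring.
rewrite (le_trans (ler_norm _))// normrM ler_wpM2l//.
rewrite !normrM (ger0_norm e0) (ger0_norm (_ : 0 <= 2))//.
rewrite -(@real_normK _ y) ?num_real// -(@real_normK _ u) ?num_real//.
have := sqr_ge0 (`|y| - `|u|); have := mulr_ge0 (normr_ge0 y) (normr_ge0 u).
by move: (`|y|) (`|u|) => p q; nra.
Qed.

(** Maximum principle: if the energy on [[- r, T]] has a positive peak at some [c > 0], its
    derivative there is nonnegative. The delayed energies are at most the one at [c], so
    [damp_energy_derive_le] bounds that derivative by [5 S - 2 s0 < 0] times the energy. *)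
Lemma damp_energy_eventually_bounded : exists sigma0 K : R, [/\ 0 <= sigma0, 0 <= K &
  forall t, 0 <= t -> damp_energy sigma0 t <= K].
Proof.
have r0 : (0 : R) < r%:R by rewrite ltr0n.
pose S := \sum_i \sum_j `|weight G i j|.
have S0 : 0 <= S by rewrite sumr_ge0// => i _; rewrite sumr_ge0.
pose s0 := 5 * S + 1; have s0_gt0 : 0 < s0 by rewrite ltr_wpDl// mulr_ge0.
have Wc t : - r%:R <= t -> {for t, continuous (damp_energy s0)}.
  by move=> rt; exact: is_derive_continuous (is_derive_damp_energy s0 rt).
have [|K K0 KP] := @bounded_on_segment R (damp_energy s0) (- r%:R) 0.
  by move=> t /andP[rt _]; exact: Wc.
exists s0, K; split=> [||T T0]; rewrite ?(ltW s0_gt0)//.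
have rT : - r%:R <= T by rewrite (le_trans _ T0)// oppr_le0 ltW.
have [|c] := @EVT_max R (damp_energy s0) (- r%:R) T rT.
  by apply: within_continuous_of_for => t /andP[rt _]; exact: Wc.
rewrite in_itv/= => /andP[rc cT] cmax.
have TW : damp_energy s0 T <= damp_energy s0 c by apply: cmax; rewrite in_itv/= rT lexx.
apply: (le_trans TW); have [c0|c0] := leP c 0.
  by rewrite (le_trans (ler_norm _))// KP// rc.
have := damp_energy_ge0 s0 c; rewrite le_eqVlt => /predU1P[<-//|Wpos].
have : 0 <= \sum_i 2 * (damp s0 i c * damped_rhs G s0 (damp s0) i c).
  have rc' : - r%:R < c by rewrite (lt_trans _ c0)// oppr_lt0.
  apply: (max_derive_ge0 rc' (is_derive_damp_energy s0 rc)) => s /andP[rs sc].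
  by apply: cmax; rewrite in_itv/= rs (le_trans sc).
have := damp_energy_derive_le c (ltW s0_gt0).
have : \sum_i \sum_j `|weight G i j| *
     (damp_energy s0 c + 4 * damp_energy s0 (c - delay G i j)) <= S * (5 * damp_energy s0 c).
  rewrite /S mulr_suml; apply: ler_sum => i _; rewrite mulr_suml; apply: ler_sum => j _.
  rewrite ler_wpM2l//.
  have : damp_energy s0 (c - delay G i j) <= damp_energy s0 c.
    apply: cmax; rewrite in_itv/=; apply/andP; split.
      by rewrite lerBrDr (le_trans _ (ltW c0))// addrC subr_le0.
    by rewrite (le_trans _ cT)// gerBl delay_ge0.
  by move: (damp_energy s0 c) (damp_energy s0 _) => a b; lra.
move=> h1 h2 h3; have : 0 <= - (2 * s0) * damp_energy s0 c + S * (5 * damp_energy s0 c) by lra.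
rewrite (_ : _ + _ = - ((5 * S + 2) * damp_energy s0 c)); last by rewrite /s0; ring.
by rewrite oppr_ge0 leNgt mulr_gt0// ltr_wpDl// mulr_ge0.
Qed.

Lemma damp_energy_scale sigma eta t :
  damp_energy sigma t = expR (2 * eta * t) * damp_energy (sigma + eta) t.
Proof.
rewrite /damp_energy mulr_sumr; apply: eq_bigr => i _; rewrite /damp.
have -> : expR (- sigma * t) = expR (eta * t) * expR (- (sigma + eta) * t).
  by rewrite -expRD; congr expR; ring.
have -> : expR (2 * eta * t) = expR (eta * t) ^+ 2.
  by rewrite expr2 -expRD; congr expR; ring.
by ring.
Qed.

Lemma damp_primitive sigma : exists F : R -> R,
  forall t : R, 0 <= t -> is_derive t 1 F (damp_energy sigma t).
Proof.
apply: primitive_exists => t t1; apply: is_derive_continuous (is_derive_damp_energy sigma _).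
by rewrite (le_trans _ t1)// lerN2 ler1n.
Qed.

Definition energy_bounded sigma := exists F K, (forall t : R, 0 <= t ->
  is_derive t 1 F (damp_energy sigma t)) /\ forall t, 0 <= t -> F t - F 0 <= K.

Context (C : R).
Hypothesis C_gt0 : 0 < C.
Hypothesis window : forall sigma Y F, 0 <= sigma -> smooth_orbit G r sigma Y F ->
  forall T : nat, (2 * r + 1 <= T)%N ->
  F T%:R - F (r + 1)%:R <= C * ((F (2 * r + 1)%:R - F 0) + (F (T + 1 + r)%:R - F (T - r)%N%:R)).

Lemma primitive_nondecreasing sigma F :
  (forall t : R, 0 <= t -> is_derive t 1 F (damp_energy sigma t)) ->
  forall s t, 0 <= s -> s <= t -> F s <= F t.
Proof.
move=> FE s t s0 st; have [|c _ E] := @mean_value R F (damp_energy sigma) s t st.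
  by move=> x /andP[sx _]; apply: FE; exact: le_trans sx.
by rewrite -subr_ge0 E mulr_ge0 ?damp_energy_ge0// subr_ge0.
Qed.

(** The window inequality at [T + (r + 1)] is the recursion of [growth_gap] with [w = r + 1], once
    [F (T + 1)] is replaced by the smaller [F T]. *)
Lemma energy_bounded_of_slow_growth sigma q K F : 0 <= sigma ->
  (forall t : R, 0 <= t -> is_derive t 1 F (damp_energy sigma t)) ->
  1 <= q -> q ^+ (2 * (r + 1)) < 1 + C^-1 ->
  (forall T : nat, F T%:R - F 0 <= K * q ^+ T) -> energy_bounded sigma.
Proof.
move=> sigma0 FE q1 qC FK; have Fmono := primitive_nondecreasing FE.
pose C0 := F (r + 1)%:R - F 0 + C * (F (2 * r + 1)%:R - F 0).
exists F, C0; split=> // t t0.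
have fC : forall T : nat, F T%:R - F 0 <= C0.
  apply: (@growth_gap R (fun T => F T%:R - F 0) C C0 K q (r + 1) (2 * r + 1)) => //.
    by move=> a b ab; rewrite lerD2r Fmono ?ler_nat.
  move=> T rT; have := window sigma0 (damp_smooth_orbit sigma0 FE) (T := (T + (r + 1))%N).
  rewrite (leq_trans rT (leq_addr _ _)) => /(_ isT).
  have -> : (T + (r + 1) + 1 + r = T + 2 * (r + 1))%N by ring.
  have -> : (T + (r + 1) - r = T + 1)%N by rewrite addnCA addKn.
  have m1 : F T%:R <= F (T + 1)%:R by rewrite Fmono ?ler_nat ?leq_addr.
  have m2 := ler_wpM2l (ltW C_gt0) m1.
  by move: m2; rewrite /C0; lra.
apply: le_trans (fC (Num.truncn t).+1); rewrite lerD2r Fmono// ltW//.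
exact: truncnS_gt.
Qed.

(** The rate depends on [C] and [r] only, not on [sigma], so finitely many steps of size [eta] reach
    0. The witness makes the power equal to the square root of [1 + C^-1]. *)
Lemma exists_small_rate : exists2 eta : R, 0 < eta & expR (2 * eta) ^+ (2 * (r + 1)) < 1 + C^-1.
Proof.
have b1 : 1 < 1 + C^-1 by rewrite ltrDl invr_gt0.
have l0 : 0 < ln (1 + C^-1) by apply: ln_gt0.
have w0 : (0 : R) < (2 * (r + 1))%:R by rewrite ltr0n muln_gt0 addn1.
exists (ln (1 + C^-1) / (4 * (2 * (r + 1))%:R)); first by rewrite divr_gt0// mulr_gt0.
rewrite -expRM_natl -[ltRHS]lnK ?posrE ?(lt_trans ltr01)// ltr_expR.
rewrite (_ : _ * _ = ln (1 + C^-1) / 2); last by field; rewrite gt_eqF.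
by rewrite ltr_pdivrMr// mulr_natr mulr2n ltrDl.
Qed.

Lemma energy_bounded0 : energy_bounded 0.
Proof.
have [eta eta0 etaC] := exists_small_rate.
have q1 : 1 <= expR (2 * eta) by rewrite -expR0 ler_expR mulr_ge0// ltW.
have qE (T : nat) : expR (2 * eta) ^+ T = expR (2 * eta * T%:R) by rewrite -expRM_natr.
(* Removing the damping [eta] multiplies the energy up to time [T] by at most [expR (2 * eta * T)],
   so boundedness at [sigma + eta] gives growth below the gap at [sigma]. *)
have descent sigma : 0 <= sigma -> energy_bounded (sigma + eta) -> energy_bounded sigma.
  move=> sigma0 [F' [K [F'E F'K]]]; have [F FE] := damp_primitive sigma.
  apply: (energy_bounded_of_slow_growth (K := K) sigma0 FE q1 etaC) => T.
  rewrite qE; set e := expR _.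
  have e0 : 0 <= e by exact: expR_ge0.
  have T0 : 0 <= T%:R :> R by [].
  have H : F T%:R - e * F' T%:R <= F 0 - e * F' 0.
    apply: (@nonincreasing_of_derive R (fun t => F t - e * F' t)
      (fun t => damp_energy sigma t - e * damp_energy (sigma + eta) t)) => // t /andP[t0 tT].
      by apply: is_derive_add (FE t t0) (is_derive_opp (is_derive_scale e (F'E t t0))).
    rewrite subr_le0 (damp_energy_scale sigma eta) ler_wpM2r ?damp_energy_ge0// ler_expR.
    by rewrite ler_wpM2l// mulr_ge0// ltW.
  by have := ler_wpM2l e0 (F'K _ T0); lra.
have [s0 [K [s0_ge0 K0 sK]]] := damp_energy_eventually_bounded.
pose M := (Num.truncn (s0 / eta)).+1.
have base : energy_bounded (M%:R * eta).
  have M0 : 0 <= M%:R * eta by rewrite mulr_ge0// ltW.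
  have [F FE] := damp_primitive (M%:R * eta).
  (* A bounded energy has a primitive of at most linear growth, and
     [2 * eta * T <= expR (2 * eta * T)]. *)
  apply: (energy_bounded_of_slow_growth (K := K / (2 * eta)) M0 FE q1 etaC) => T.
  have T0 : 0 <= T%:R :> R by [].
  have [|c /andP[c0 cT] ->] := @mean_value R F (damp_energy (M%:R * eta)) 0 T%:R T0.
    by move=> x /andP[x0 _]; exact: FE.
  have eK : damp_energy (M%:R * eta) c <= K.
    apply: le_trans (sK c c0).
    rewrite (damp_energy_scale s0 (M%:R * eta - s0)) (_ : s0 + _ = M%:R * eta); last by ring.
    rewrite ler_peMl ?damp_energy_ge0// -[leLHS]expR0 ler_expR !mulr_ge0//.
    by rewrite subr_ge0 -ler_pdivrMr// ltW// truncnS_gt.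
  rewrite subr0 (le_trans (ler_wpM2r T0 eK))// -mulrA ler_wpM2l// qE.
  by rewrite ler_pdivlMl ?mulr_gt0//; have := expR_ge1Dx (2 * eta * T%:R); lra.
elim: M base => [|M IH]; first by rewrite mul0r.
move=> h; apply: IH; apply: descent; first by rewrite mulr_ge0// ltW.
by rewrite (_ : _ + eta = M.+1%:R * eta)// -natr1; ring.
Qed.

(* Subtracting a suitable combination of F and its delayed values from the
   energy gives a nonincreasing function, so the pointwise energy is controlled
   by its integral over a recent window, which tends to 0. *)
Lemma orbit_decay i : (z i t @[t --> +oo] --> 0)%classic.
Proof.
have [F [K [FE FK]]] := energy_bounded0; have Fmono := primitive_nondecreasing FE.
pose S := \sum_i \sum_j `|weight G i j|.
have S0 : 0 <= S by rewrite sumr_ge0// => a _; rewrite sumr_ge0.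
have r0 : (0 : R) < r%:R by rewrite ltr0n.
have point t : r%:R + 1 <= t ->
    damp_energy 0 t <= (1 + 5 * S) * (F t - F (t - 1 - r%:R)).
  move=> rt; have t1 : t - 1 <= t by rewrite gerBl.
  (* [xi] is a time in [[t - 1, t]] at which the energy equals its mean [F t - F (t - 1)]. *)
  have [|xi /andP[xi1 xit]] := @mean_value R F (damp_energy 0) (t - 1) t t1.
    by move=> x /andP[x1 _]; apply: FE; lra.
  rewrite (_ : t - (t - 1) = 1); last by ring.
  rewrite mulr1 => Exi.
  pose Psi s := damp_energy 0 s - \sum_i \sum_j `|weight G i j| * (F s + 4 * F (s - delay G i j)).
  have H : Psi t <= Psi xi.
    apply: (@nonincreasing_of_derive R Psi (fun s =>
       \sum_i 2 * (damp 0 i s * damped_rhs G 0 (damp 0) i s) - \sum_i \sum_j `|weight G i j| *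
     (damp_energy 0 s + 4 * damp_energy 0 (s - delay G i j))) xi t xit) => s /andP[xs st].
      have s0 : 0 <= s by lra.
      apply: is_derive_add; first by apply: is_derive_damp_energy; lra.
      apply: is_derive_opp; apply: is_derive_bigsum => a; apply: is_derive_bigsum => b.
      apply: is_derive_scale; apply: is_derive_add (FE s s0) _; apply: is_derive_scale.
      by apply: is_derive_shift; apply: FE; have := delay_r a b; lra.
    by have := damp_energy_derive_le s (lexx 0); lra.
  have HS : \sum_i \sum_j `|weight G i j| * (F t + 4 * F (t - delay G i j)) -
     \sum_i \sum_j `|weight G i j| * (F xi + 4 * F (xi - delay G i j)) <=
     S * (5 * (F t - F (t - 1 - r%:R))).
    rewrite -sumrB /S mulr_suml; apply: ler_sum => a _.
    rewrite -sumrB mulr_suml; apply: ler_sum => b _; rewrite -mulrBr ler_wpM2l//.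
    have d0 := delay_ge0 G a b; have dr := delay_r a b.
    have m1 : F (t - 1 - r%:R) <= F xi by apply: Fmono; lra.
    have m2 : F (t - 1 - r%:R) <= F (xi - delay G a b) by apply: Fmono; lra.
    have m3 : F (t - delay G a b) <= F t by apply: Fmono; lra.
    by lra.
  have m4 : F (t - 1 - r%:R) <= F (t - 1) by apply: Fmono; lra.
  by move: H; rewrite /Psi; lra.
apply/cvgrPdist_le => e e0.
(* [F] is nondecreasing and bounded, so its increments over windows of fixed length tend to 0. *)
pose E := [set F t | t in [set t | 0 <= t]]%classic.
have Esup : has_sup E.
  split; first by exists (F 0), 0 => /=.
  by exists (F 0 + K) => _ [t /= t0 <-]; have := FK t t0; lra.
have d0 : 0 < e ^+ 2 / (1 + 5 * S) by rewrite divr_gt0 ?exprn_gt0// ltr_wpDr ?mulr_ge0.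
have [_ [t0 /= t0_ge0 <-] st0] := sup_adherent d0 Esup.
near=> t.
have t_big : t0 + 1 + r%:R <= t by near: t; apply: nbhs_pinfty_ge; exact: num_real.
have Ft : F t <= sup E by apply: ub_le_sup; [exact: Esup.2|exists t => //=; lra].
have Ft0 : F t0 <= F (t - 1 - r%:R) by apply: Fmono; lra.
have Ee : damp_energy 0 t <= e ^+ 2.
  have t_r : r%:R + 1 <= t by lra.
  apply: (le_trans (point t t_r)); rewrite -ler_pdivlMl ?ltr_wpDr ?mulr_ge0//.
  by rewrite mulrC; lra.
rewrite sub0r normrN -(@ler_pXn2r _ 2) ?nnegrE ?(ltW e0)// real_normK ?num_real//.
apply: le_trans Ee; rewrite /damp_energy (bigD1 i)//= /damp oppr0 mul0r expR0 mul1r.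
by rewrite lerDl sumr_ge0// => j _; rewrite sqr_ge0.
Unshelve. all: by end_near. Qed.

End decay.

(** * Regularity of solutions *)

Section abs_continuous_closure.
Context (R : realType).

Lemma abs_continuous_sub (f : R -> R) (a b a' b' : R) : a <= a' -> b' <= b ->
  abs_continuous_on f a b -> abs_continuous_on f a' b'.
Proof.
move=> aa bb fac e /fac[d d0 dP]; exists d => // m u v uv; apply: dP => i.
by have [h1 [h2 h3]] := uv i; split; [exact: le_trans h1|split=> //; exact: le_trans bb].
Qed.

Lemma abs_continuous_add (f g : R -> R) (a b : R) :
  abs_continuous_on f a b -> abs_continuous_on g a b ->
  abs_continuous_on (fun t => f t + g t) a b.
Proof.
move=> fac gac e e0; have e2 : 0 < e / 2 by rewrite divr_gt0.
have [d1 d10 P1] := fac _ e2; have [d2 d20 P2] := gac _ e2.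
exists (Num.min d1 d2); first by rewrite lt_min d10.
move=> m u v uv dis; rewrite lt_min => /andP[h1 h2].
have := P1 m u v uv dis h1; have := P2 m u v uv dis h2 => H2 H1.
apply: (@le_lt_trans _ _ (\sum_(i < m) `|f (v i) - f (u i)| + \sum_(i < m) `|g (v i) - g (u i)|)).
  rewrite -big_split; apply: ler_sum => i _ /=.
  by rewrite opprD addrACA; exact: ler_normD.
by rewrite [ltRHS](splitr e) ltrD.
Qed.

Lemma abs_continuous_lipschitz (f : R -> R) (a b K : R) : 0 <= K ->
  (forall u v, u <= v -> `|f v - f u| <= K * (v - u)) -> abs_continuous_on f a b.
Proof.
move=> K0 fK e e0; have K1 : 0 < K + 1 by rewrite ltr_wpDl.
exists (e / (K + 1)); first exact: divr_gt0.
move=> m u v uv _ uvd.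
apply: (@le_lt_trans _ _ (K * \sum_(i < m) (v i - u i))).
  by rewrite mulr_sumr; apply: ler_sum => i _; apply: fK; case: (uv i) => _ [].
have s0 : 0 <= \sum_(i < m) (v i - u i).
  by rewrite sumr_ge0// => i _; rewrite subr_ge0; case: (uv i) => _ [].
rewrite ltr_pdivlMr// in uvd; rewrite (le_lt_trans _ uvd)// mulrC ler_wpM2l//.
by rewrite lerDl.
Qed.

Lemma abs_continuous_sum (n : nat) (f : 'I_n -> R -> R) (a b : R) :
  (forall i, abs_continuous_on (f i) a b) ->
  abs_continuous_on (fun t => \sum_i f i t) a b.
Proof.
elim: n f => [|n IH] f fac.
  apply: (@abs_continuous_lipschitz _ _ _ 0) => // u v _.
  by rewrite !big_ord0 subrr normr0 mul0r.
rewrite (_ : (fun t => _) = (fun t => f ord0 t + \sum_i f (lift ord0 i) t)).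
  by apply: abs_continuous_add => //; apply: IH.
by apply/funext => t; rewrite big_ord_recl.
Qed.
End abs_continuous_closure.

Lemma sum_antisym (R : numDomainType) (I : finType) (u : I -> I -> R) :
  (forall i j, u i j = - u j i) -> \sum_i \sum_j u i j = 0.
Proof.
move=> ua; apply/eqP; rewrite -[_ == 0](mulrn_eq0 _ 2) mulr2n; apply/eqP.
rewrite {2}exchange_big -big_split big1// => i _; rewrite -big_split big1// => j _ /=.
by rewrite ua addNr.
Qed.

Lemma continuous_bigsum (R : realType) (n : nat) (F : 'I_n -> R -> R) (t : R) :
  (forall i, {for t, continuous (F i)}) -> {for t, continuous (fun s => \sum_i F i s)}.
Proof.
elim: n F => [|n IH] F Fc.
  rewrite (_ : (fun s => _) = (fun=> 0)); first exact: cst_continuous.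
  by apply/funext => s; rewrite big_ord0.
rewrite (_ : (fun s => _) = (fun s => F ord0 s + \sum_i F (lift ord0 i) s)).
  by apply: continuousD => //; exact: IH.
by apply/funext => s; rewrite big_ord_recl.
Qed.

Lemma continuous_shift (R : realType) (f : R -> R) (c t : R) :
  {for (t - c), continuous f} -> {for t, continuous (fun s => f (s - c))}.
Proof.
move=> fc; apply: (@continuous_comp _ _ _ (fun s => s - c) f) => //.
exact: is_derive_continuous (is_derive_add (is_derive_id1 t) (is_derive_cst1 (- c) t)).
Qed.

Lemma is_derive_of_approx (R : realType) (f : R -> R) (t d : R) :
  (forall e, 0 < e -> exists2 eta, 0 < eta & forall s, `|s - t| < eta ->
     `|f s - f t - d * (s - t)| <= e * `|s - t|) -> is_derive t 1 f d.
Proof.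
move=> app; have H : (h^-1 *: (f (h *: 1 + t) - f t) @[h --> 0^'] --> d)%classic.
  apply/cvgrPdist_le => e e0; have [eta eta0 etaP] := app e e0.
  rewrite near_withinE; apply/nbhs_ballP; exists eta => //= h.
  rewrite /ball/= sub0r normrN => heta h0; rewrite /GRing.scale /= mulr1.
  have := etaP (h + t); rewrite addrK => /(_ heta) hle.
  rewrite -(@ler_pM2r _ `|h|) ?normr_gt0// -normrM; apply: le_trans hle.
  by rewrite -normrN le_eqVlt; apply/orP; left; apply/eqP; congr `|_|; field.
by apply: DeriveDef; [exact: (cvgP d)|exact: cvg_lim].
Qed.

Section solutions.
Context (R : realType) (n : nat) (G : delay_graph R n) (x : 'I_n -> R -> R).
Hypothesis sol : solution G x.
Let D i t := \sum_(j < n) weight G i j * (x j (t - delay G i j) - x i (t - delay G i j)).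

Lemma solution_null_set : exists2 N : set R, (@lebesgue_measure R).-negligible N &
  forall t, 0 <= t -> ~ N t -> forall i, is_derive t 1 (x i) (D i t).
Proof.
case: sol => _ _ _ ae.
exists (~` [set t : R | 0 <= t -> forall i, is_derive t (1 : R) (x i) (D i t)])%classic.
  exact: ae.
by move=> t t0 Nt i; have /contrapT := Nt; apply.
Qed.

Lemma solution_continuous i t : 0 < t -> {for t, continuous (x i)}.
Proof.
move=> t0; case: sol => _ xc _ _.
have /continuous_within_itvcyP[xin _] := xc i.
by apply: xin; rewrite in_itv/= t0.
Qed.

(** The flows along an edge cancel because both ends read it with the same delay. So the sum has
    derivative zero almost everywhere, and absolute continuity turns this into constancy. *)
Lemma solution_sum t : 0 <= t -> \sum_i x i t = \sum_i x i 0.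
Proof.
rewrite le_eqVlt => /predU1P[<-//|t0].
have [N N0 NP] := solution_null_set; case: sol => _ _ xac _.
apply/eqP; rewrite -subr_eq0 -normr_le0.
have := @abs_continuous_mean_value R (fun t => \sum_i x i t) (fun _ => 0) 0 t 0 N (ltW t0) (lexx 0).
rewrite mul0r; apply=> //.
- by apply: abs_continuous_sum => i; exact: xac.
- move=> s /andP[s0 _] Ns; have := is_derive_bigsum (fun i => NP s s0 Ns i).
  suff -> : \sum_i D i s = 0 by [].
  by apply: sum_antisym => a b; rewrite weight_sym delay_sym -mulrN opprB.
- by move=> s _; rewrite normr0.
Qed.

(** Delays strictly below [r] keep the delayed times positive near [t], away from the jump at 0, so
    the right-hand side is continuous at [t]. The mean value inequality then applies to [x i] minus
    a linear function of slope [D i t]. *)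
Lemma solution_derive (r : R) i t : (forall j, delay G i j < r) -> r <= t ->
  is_derive t 1 (x i) (D i t).
Proof.
move=> delay_r rt.
have r0 : 0 < r by rewrite (le_lt_trans (delay_ge0 G i i)).
have [N N0 NP] := solution_null_set; case: sol => _ _ xac _.
have Dc : {for t, continuous (D i)}.
  apply: (@continuous_bigsum _ _ (fun j s => weight G i j *
    (x j (s - delay G i j) - x i (s - delay G i j)))) => j.
  have tj : 0 < t - delay G i j by rewrite subr_gt0 (lt_le_trans (delay_r j)).
  apply: continuousM; first exact: cst_continuous.
  by apply: continuousB; apply: continuous_shift; exact: solution_continuous.
apply: is_derive_of_approx => e e0; have /cvgrPdist_le/(_ e e0) := Dc.
move=> /nbhs_ballP[eta /= eta0 etaP].
exists (Num.min eta r); first by rewrite lt_min eta0.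
move=> s; rewrite lt_min => /andP[st sr].
pose f u := x i u + - D i t * u.
have seg a b : 0 <= a -> a <= b -> (forall u, a <= u <= b -> `|t - u| < eta) ->
    `|f b - f a| <= e * (b - a).
  move=> a0 ab near_t.
  apply: (@abs_continuous_mean_value R f (fun u => D i u - D i t) a b e N) => //.
  - exact: ltW.
  - have b1 : 0 < b + 1 by rewrite ltr_wpDl// (le_trans a0).
    apply: abs_continuous_add.
      by apply: abs_continuous_sub (xac i _ b1); rewrite ?a0 ?lerDl.
    apply: (@abs_continuous_lipschitz _ _ _ _ `|D i t|) => // u v uv.
    by rewrite -mulrBr normrM normrN (ger0_norm (_ : 0 <= v - u)) ?subr_ge0.
  - move=> u /andP[au ub] Nu; apply: is_derive_add (NP u (le_trans a0 au) Nu i) _.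
    by have := is_derive_scale (- D i t) (is_derive_id1 u); rewrite mulr1.
  - by move=> u uab; rewrite distrC; apply: etaP; exact: near_t.
have fE u v : f u - f v = x i u - x i v - D i t * (u - v) by rewrite /f; ring.
have [s_le|/ltW t_le] := leP s t.
  rewrite -fE distrC [`|s - t|]distrC (ger0_norm (_ : 0 <= t - s)) ?subr_ge0//.
  apply: seg => //.
    by move: sr; rewrite distrC ger0_norm ?subr_ge0//; lra.
  move=> u /andP[su ut]; rewrite ger0_norm ?subr_ge0//.
  by move: st; rewrite distrC ger0_norm ?subr_ge0//; lra.
rewrite -fE (ger0_norm (_ : 0 <= s - t)) ?subr_ge0//.
apply: seg => //; first by rewrite (le_trans (ltW r0)).
move=> u /andP[tu us]; rewrite distrC ger0_norm ?subr_ge0//.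
by move: st; rewrite ger0_norm ?subr_ge0//; lra.
Qed.
End solutions.

(** * From coercivity to consensus *)

Lemma average_consensus_of_coercive (R : realType) (n : nat) (G : delay_graph R n) (mu : R) :
  0 <= lambda_bar G -> 0 < mu ->
  (forall x : 'I_n -> R, \sum_i x i = 0 -> mu * \sum_i x i ^+ 2 <= dirichlet (what G) x) ->
  average_consensus G.
Proof.
move=> lam0 mu0 coer x sol i.
(* The successor makes [r] positive and a strict bound on all delays. *)
pose r := (Num.truncn (\sum_a \sum_b delay G a b)).+1.
have delay_lt a b : delay G a b < r%:R.
  apply: le_lt_trans (truncnS_gt _); rewrite (bigD1 a)//= (bigD1 b)//= -addrA lerDl.
  rewrite addr_ge0// sumr_ge0// => *; rewrite ?delay_ge0// sumr_ge0// => *; exact: delay_ge0.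
have delay_r a b : delay G a b <= r%:R by exact: ltW.
have r_gt0 : (0 < r)%N by [].
have r0 : (0 : R) < r%:R by rewrite ltr0n.
have [C C0 window] := energy_window lam0 r_gt0 delay_r mu0 coer.
(* The shift by [3 r] moves the history interval [[-2 r, 0]] to [[r, 3 r]], where solutions are
   differentiable everywhere. *)
set c := (\sum_j x j 0) / n%:R; pose s0 : R := 3 * r%:R.
pose z a t := x a (t + s0) + - c.
have zc a (t : R) : - (2 * r%:R) <= t -> {for t, continuous (z a)}.
  move=> rt; apply: continuousD; last exact: cst_continuous.
  have := @continuous_shift R (x a) (- s0) t; rewrite opprK; apply.
  by apply: (solution_continuous sol); rewrite /s0; lra.
have zd a (t : R) : - r%:R <= t -> is_derive t 1 (z a)
    (\sum_b weight G a b * (z b (t - delay G a b) - z a (t - delay G a b))).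
  move=> rt; have rt' : r%:R <= t + s0 by rewrite /s0; lra.
  have H := is_derive_shift (solution_derive sol (delay_lt a) rt').
  have := is_derive_add H (is_derive_cst1 (- c) t); rewrite addr0 => {}H.
  apply: is_derive_eq; apply: eq_bigr => b _; rewrite /z addrAC; congr (_ * _); ring.
have zs (t : R) : 0 <= t -> \sum_a z a t = 0.
  move=> t0; rewrite big_split /= (solution_sum sol)//; last by rewrite addr_ge0// mulr_ge0.
  rewrite sumr_const card_ord -[_ *+ n]mulr_natr mulNr /c divfK ?subrr// pnatr_eq0.
  by case: n i {G lam0 coer x sol delay_lt delay_r window c z zc zd r r_gt0 r0 s0 t0} => -[].
have /cvgrPdist_le zlim := orbit_decay r_gt0 delay_r zc zd zs C0 window i.
apply/cvgrPdist_le => e e0; have [M [Mreal MP]] := zlim e e0.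
exists (M + s0); split; first exact: num_real.
move=> t Mt; have := MP (t - s0); rewrite ltrBrDr => /(_ Mt).
by rewrite /z subrK sub0r opprB.
Qed.

Theorem corollary4 (R : realType) (n : nat) (G : delay_graph R n)
    (k l : 'I_n)
    (L0_psd : psd_simple_zero (L0 G))
    (edge_kl : edge G k l)
    (delay_kl : pi / 2 < delay G k l * lambda_bar G)
    (Ldel_psd : psd_simple_zero (Lhat_del G k l)) :
  (reff_pos (Lhat G) [set k] [set l] -> average_consensus G) /\
  reff_defined (Lhat_del G k l) [set k] [set l] /\
  (0 < weight G k l ->
     (reff_pos (Lhat G) [set k] [set l] <->
       (pi / 2 < delay G k l * lambda_bar G < pi ->
          - weight G k l * cos (delay G k l * lambda_bar G)
            < 1 / reff (Lhat_del G k l) [set k] [set l]) /\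
       (pi <= delay G k l * lambda_bar G ->
          weight G k l < 1 / reff (Lhat_del G k l) [set k] [set l]))).
Proof.
have kl : k != l by apply: contraTneq edge_kl => ->; rewrite edge_irr.
have wsym := what_sym G; have dsym := del_edge_sym k l wsym.
have t_gt0 : 0 < delay G k l * lambda_bar G.
  by apply: lt_trans delay_kl; rewrite divr_gt0 ?pi_gt0.
have lam0 : 0 <= lambda_bar G.
  rewrite leNgt; apply: contraTN t_gt0 => lam0.
  by rewrite -leNgt mulr_ge0_le0 ?delay_ge0// ltW.
split.
  move=> /reff_pos_eff_cond c0.
  have [mu mu0 coer] := dirichlet_coercive_of_eff_cond kl wsym Ldel_psd c0.
  exact: average_consensus_of_coercive lam0 mu0 coer.
split.
  by split; [exact: laplacian_block_unit|rewrite gt_eqF// eff_cond_gt0].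
(* The edge value at [(k,l)] is [a cos t] or [- a] according to the range of [t]; the implication
   for the other range is vacuous. *)
move=> a0; rewrite (reff_posP kl wsym Ldel_psd) {1}/what a0.
have -> : (delay G k l == 0) = false.
  by apply: contraTF t_gt0 => /eqP ->; rewrite mul0r ltxx.
rewrite [_ < pi / 2]ltNge (ltW delay_kl)/= delay_kl/= [pi <= _]leNgt.
case: ifP => _; first by rewrite mulNr; split=> [h|[h _]]; [split|exact: h].
by rewrite opprK; split=> [h|[_ h]]; [split|exact: h].
Qed.
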